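(* Let $d\ge 2$, $N\ge 1$, and let $J\subset\{1,\dots,N\}$. Let $(\Omega_k)_{k\in\mathbb N}$ be an increasing sequence of open subsets of $\mathbb R^d$ with $\bigcup_k\Omega_k=\mathbb R^d$, and for every $k$ let $\mathbf E^k=(E^k_1,\dots,E^k_N)$ be a locally $J$-isoperimetric (possibly improper) $N$-partition of $\Omega_k$. Suppose that there exists an $N$-partition $\mathbf E=(E_1,\dots,E_N)$ of $\mathbb R^d$ such that for every $j=1,\dots,N$ one has $E^k_j\to E_j$ in $L^1_{\mathrm{loc}}(\mathbb R^d)$ as $k\to+\infty$ (i.e. $|(E^k_j\triangle E_j)\cap K|\to 0$ for every compact $K\subset\mathbb R^d$; note $K\subset\Omega_k$ for $k$ large). Then $\mathbf E$ is a locally $J$-isoperimetric partition of $\mathbb R^d$.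
   Context: $|\cdot|$ is Lebesgue measure on $\mathbb R^d$; sets are identified when they differ by a null set. For a measurable set $E$ and an open set $U$, $P(E,U)\in[0,+\infty]$ is the total variation in $U$ of the distributional derivative $D\mathbf 1_E$. $E$ has locally finite perimeter (is a Caccioppoli set) in an open set $\Omega$ if $D\mathbf 1_E$ is a vector-valued Radon measure on $\Omega$; then $P(E,B)=\|D\mathbf 1_E\|(B)$ for Borel $B\subset\Omega$. An $N$-partition of an open set $\Omega\subset\mathbb R^d$ is an $N$-uple $\mathbf E=(E_1,\dots,E_N)$ of measurable sets (regions) with $|E_k\cap E_j\cap\Omega|=0$ for $k\ne j$ and $|\Omega\setminus\bigcup_k E_k|=0$. Regions may have measure zero; if some region has measure zero the partition is called improper. Its perimeter is $P(\mathbf E,B)=\frac12\sum_{k=1}^N P(E_k,B)$. Locally $J$-isoperimetric: for $J\subset\{1,\dots,N\}$, an $N$-partition $\mathbf E$ of an open set $\Omega$, with regions of locally finite perimeter in $\Omega$, is locally $J$-isoperimetric if for every compact set $B\subset\Omega$ and every $N$-partition $\mathbf F=(F_1,\dots,F_N)$ of $\Omega$ with regions of locally finite perimeter in $\Omega$ such that $F_i\triangle E_i\subset B$ for all $i=1,\dots,N$ and $|F_j\cap B|=|E_j\cap B|$ for all $j\in J$, one has $P(\mathbf E,B)\le P(\mathbf F,B)$. *)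

(* Defs.v *)
From HB Require Import structures.
From mathcomp Require Import all_boot all_order all_algebra.
From mathcomp Require Import all_classical all_reals all_analysis.

Set Implicit Arguments.
Unset Strict Implicit.
Unset Printing Implicit Defensive.

Import Order.TTheory GRing.Theory Num.Theory.
Import numFieldNormedType.Exports.

Local Open Scope classical_set_scope.
Local Open Scope ring_scope.

(* R^d is 'rV[R]_d, with its library topology (that of the sup norm). *)

Section lebesgue.
Context {R : realType} {d : nat}.
Local Notation V := 'rV[R]_d.

Definition box (q : V * V) : set V :=
  [set x | forall i, q.1 0 i < x 0 i <= q.2 0 i].

Definition box_volume (q : V * V) : R :=
  \prod_(i < d) Num.max 0 (q.2 0 i - q.1 0 i).

Local Open Scope ereal_scope.

(* Countable families of boxes, rather than sequences, so that the empty set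
   has measure 0 even when d = 0. *)
Definition box_cover (A : set V) : set (set (V * V)) :=
  [set C | countable C /\ A `<=` \bigcup_(q in C) box q].

Definition lebesgue_Rd (A : set V) : \bar R :=
  ereal_inf [set \esum_(q in C) (box_volume q)%:E | C in box_cover A].

Lemma box_volume_ge0 (q : V * V) : 0 <= (box_volume q)%:E.
Proof. by rewrite lee_fin prodr_ge0// => i _; rewrite le_max lexx. Qed.

Lemma lebesgue_Rd_ge0 A : 0 <= lebesgue_Rd A.
Proof.
apply: le_ereal_inf_tmp => _ [C _ <-].
by apply: esum_ge0 => q _; exact: box_volume_ge0.
Qed.

Lemma lebesgue_Rd0 : lebesgue_Rd set0 = 0.
Proof.
apply/eqP; rewrite eq_le lebesgue_Rd_ge0 andbT.
apply: ereal_inf_lbound; exists set0; last by rewrite esum_set0.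
by split; [exact: countable0 | exact: sub0set].
Qed.

Lemma le_lebesgue_Rd : {homo lebesgue_Rd : A B / A `<=` B >-> A <= B}.
Proof.
move=> A B AB; apply: ereal_inf_le_tmp => _ [C [cC BC] <-].
by exists C => //; split => //; exact: subset_trans BC.
Qed.

Lemma lebesgue_Rd_sigma_subadditive : sigma_subadditive lebesgue_Rd.
Proof.
move=> A; have [[i ioo]|] := pselect (exists i, lebesgue_Rd (A i) = +oo).
  rewrite (eseries_pinfty _ _ ioo) ?leey// => n _.
  by rewrite -ltNye (lt_le_trans _ (lebesgue_Rd_ge0 _)).
rewrite -forallNE => Aoo.
suff add2e (e : {posnum R}) : lebesgue_Rd (\bigcup_n A n) <=
    \sum_(i <oo) lebesgue_Rd (A i) + e%:num%:E.
  by apply/lee_addgt0Pr => _/posnumP[].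
rewrite (le_trans _ (epsilon_trick _ _ _))//; last first.
  by move=> n; exact: lebesgue_Rd_ge0.
pose P n (C : set (V * V)) := box_cover (A n) C /\
  \esum_(q in C) (box_volume q)%:E <=
    lebesgue_Rd (A n) + (e%:num / (2 ^ n.+1)%:R)%:E.
have [G PG] : {G : (set (V * V))^nat & forall n, P n (G n)}.
  apply: (@choice _ _ P) => n; rewrite /P.
  have en1 : (0 < e%:num / (2 ^ n.+1)%:R)%R by [].
  have fA : lebesgue_Rd (A n) \is a fin_num.
    by rewrite ge0_fin_numE ?lebesgue_Rd_ge0// lt_neqAle leey andbT; apply/eqP.
  have [_ [C AC <-] Ce] := lb_ereal_inf_adherent en1 fA.
  by exists C; split => //; exact: ltW.
apply: (@le_trans _ _ (\esum_(q in \bigcup_n G n) (box_volume q)%:E)).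
  apply: ereal_inf_lbound; exists (\bigcup_n G n) => //; split.
    by apply: bigcup_countable => // n _; have [[]] := PG n.
  move=> x [n _ /((PG n).1.2)[q Gq xq]]; exists q => //.
  by exists n.
rewrite seqDU_bigcup_eq esum_bigcupT; [|exact: trivIset_seqDU|exact: box_volume_ge0].
rewrite -nneseries_esumT; last first.
  by move=> n; apply: esum_ge0 => q _; exact: box_volume_ge0.
apply: lee_nneseries => [n _ _|n _].
  by apply: esum_ge0 => q _; exact: box_volume_ge0.
apply: le_trans (PG n).2.
apply: ereal_sup_le => _ [D [fD DS] <-].
by exists D => //; split => //; exact: subset_trans (@subset_seqDU _ G n).
Qed.

HB.instance Definition _ := isOuterMeasure.Build R V lebesgue_Rd
  lebesgue_Rd0 lebesgue_Rd_ge0 le_lebesgue_Rd lebesgue_Rd_sigma_subadditive.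

Definition lebesgue_outer : {outer_measure set V -> \bar R} := lebesgue_Rd.

(* The Lebesgue-measurable sets are the Caratheodory-measurable ones, and
   [caratheodory_type lebesgue_outer] is a copy of V equipped with them. *)
Definition lebesgue_set (A : set V) : Prop :=
  lebesgue_outer.-cara.-measurable A.

Definition lebesgue_measure_Rd :
    {measure set (caratheodory_type lebesgue_outer) -> \bar R} :=
  (lebesgue_outer : set (caratheodory_type lebesgue_outer) -> \bar R).

End lebesgue.

Section perimeter.
Context {R : realType} {d : nat}.
Local Notation V := 'rV[R]_d.
Local Notation borel := (g_sigma_algebraType (@open V)).

Definition partial (i : 'I_d) (f : V -> R) : V -> R :=
  fun x => 'D_(delta_mx 0 i) f x.

Definition smooth (f : V -> R) : Prop :=
  forall s : seq 'I_d, let g := foldr partial f s in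
    continuous g /\ forall i x, derivable g x (delta_mx 0 i).

Definition test_function (U : set V) (f : V -> R) : Prop :=
  let supp := closure [set x | f x != 0] in
  [/\ smooth f, compact supp & supp `<=` U].

(* The i-th component of the vector-valued measure is the difference of the
   positive measures [pos_part i] and [neg_part i] (not necessarily mutually
   singular). *)
Record vmeasure := VMeasure {
  pos_part : 'I_d -> {measure set borel -> \bar R} ;
  neg_part : 'I_d -> {measure set borel -> \bar R} }.

Definition radon_on (U : set V) (m : vmeasure) : Prop :=
  forall i (K : set V), compact K -> K `<=` U ->
    (pos_part m i K < +oo)%E /\ (neg_part m i K < +oo)%E.

(* Meaningful on the Borel sets on which the components are finite, e.g. on
   those that are relatively compact in U when [radon_on U m]. *)
Definition vvalue (m : vmeasure) (A : set V) : V :=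
  \row_i (fine (pos_part m i A) - fine (neg_part m i A)).

Definition vintegral (m : vmeasure) (f : V -> R) (i : 'I_d) : R :=
  \int[pos_part m i]_x f x - \int[neg_part m i]_x f x.

Definition euclidean_norm (v : V) : R := Num.sqrt (\sum_i v 0 i ^+ 2).

Definition borel_partition (U B : set V) : set ((set V)^nat) :=
  [set A | [/\ trivIset setT A, \bigcup_n A n = B &
    forall n, [/\ measurable (A n : set borel), compact (closure (A n)) &
                  closure (A n) `<=` U]]].

Definition vmeasure_variation (U : set V) (m : vmeasure) (B : set V) : \bar R :=
  ereal_sup [set (\sum_(n <oo) (euclidean_norm (vvalue m (A n)))%:E)%E
            | A in borel_partition U B].

(* m is the distributional derivative D 1_E on U, as a Radon measure *)
Definition is_derivative (U E : set V) (m : vmeasure) : Prop :=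
  radon_on U m /\
  forall f, test_function U f -> forall i,
    \int[lebesgue_measure_Rd]_(x in E) partial i f x = - vintegral m f i.

Definition locally_finite_perimeter (U E : set V) : Prop :=
  exists m, is_derivative U E m.

(* P(E, B) for a Borel subset B of the open set U. The derivative of 1_E on U
   is unique on the Borel sets relatively compact in U, hence all the
   representations m have the same total variation; the infimum only selects
   this common value (and +oo when there is no m). *)
Definition perimeter (U E B : set V) : \bar R :=
  ereal_inf [set vmeasure_variation U m B | m in is_derivative U E].

End perimeter.

Section partitions.
Context {R : realType} {d : nat} {N : nat}.
Local Notation V := 'rV[R]_d.

Definition is_partition (U : set V) (E : 'I_N -> set V) : Prop :=
  [/\ forall k, lebesgue_set (E k),
      forall k j, k != j -> lebesgue_Rd (E k `&` E j `&` U) = 0%E &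
      lebesgue_Rd (U `\` \bigcup_(k in [set: 'I_N]) E k) = 0%E].

Definition partition_perimeter (U : set V) (E : 'I_N -> set V) (B : set V) :
  \bar R := ((2^-1)%R%:E * \sum_(k < N) perimeter U (E k) B)%E.

(* The inclusion of the symmetric difference of F_i and E_i in B is up to a
   null set, as sets are identified when they differ by a null set. *)
Definition locally_isoperimetric (J : {set 'I_N}) (U : set V)
    (E : 'I_N -> set V) : Prop :=
  [/\ is_partition U E,
      forall k, locally_finite_perimeter U (E k) &
      forall (B : set V) (F : 'I_N -> set V),
        compact B -> B `<=` U ->
        is_partition U F ->
        (forall k, locally_finite_perimeter U (F k)) ->
        (forall i, lebesgue_Rd ((F i `+` E i) `\` B) = 0%E) ->
        (forall j, j \in J ->
           lebesgue_Rd (F j `&` B) = lebesgue_Rd (E j `&` B)) ->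
        (partition_perimeter U E B <= partition_perimeter U F B)%E].

End partitions.

(* Main.v *)
(** Perimeters are handled through fluxes: [flux unit_ball E W] is the supremum
    of the integrals over E of div phi, for test fields phi with values in the
    unit ball and supports in W. As a function of the open set W it extends to a
    Borel measure (De Giorgi-Letta); a Riesz representation shows that E has
    locally finite perimeter when its flux is finite on relatively compact open
    sets, and this measure is then the total variation of D 1_E.

    Let F be a competitor of E that differs from E only inside a cube Q_a. For k
    large there is r in ]a, b] such that E^k and F hardly differ near the
    boundary of Q_r, so that F can be substituted for E^k inside Q_r at a small
    cost in perimeter. The volumes are then restored by transferring the content
    of small cubes between the regions and a fixed nonnegligible one: as d >= 2,
    the cost of a cube of radius rho is O(rho^(d-1)), hence negligible. The
    minimality of E^k yields P(E^k, Q_a) <= P(F, Q_b) + o(1) for all a < b close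
    enough, thus P(E, Q_b) <= P(F, Q_b) by lower semicontinuity, and the
    perimeters of E and F agree outside of the set where E and F differ.
    The perimeters of the E^k are locally bounded by comparison with concentric
    cubic shells of the prescribed volumes, so that E has locally finite
    perimeter. *)
Require Import Defs.
From HB Require Import structures.
From mathcomp Require Import all_boot all_order all_algebra.
From mathcomp Require Import all_classical all_reals all_analysis.
From mathcomp Require Import measurable_realfun.
From mathcomp Require Import ring lra.
Import Order.TTheory GRing.Theory Num.Theory.
Import numFieldNormedType.Exports.

Set Implicit Arguments.
Unset Strict Implicit.
Unset Printing Implicit Defensive.

Local Open Scope classical_set_scope.
Local Open Scope ring_scope.

(** * Smooth cutoff functions *)

(** Admissibility is stated with perimeters on compact sets, whereas suprema over test fields are
    lower semicontinuous on open sets. The link is that the flux in an open U is the variation on a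
    compact K inside U plus the flux in the open set U minus K: two partitions that agree outside K
    may be compared on U instead, so that every estimate concerns fluxes.

    A competitor of E^k must satisfy the volume constraints exactly, while E^k and F satisfy them
    only up to a small error. As an o(1) in the perimeter disappears in the limit, the correction
    need not have a cost proportional to the volume, and no regularity of E^k enters. The delicate
    point is improper partitions, since a negligible region has nothing to give; but a region with
    |F_j| = 0 can only have to gain volume.

    Neither traces nor a coarea formula are used. A cutoff of slope 1/e costs 1/e times the volume
    where F and E^k differ in a shell of thickness e; hence the radius must make this volume at most
    lambda e for all small e, which a minimality property of the radius ensures. *)

Section flat.
Context {R : realType}.
Implicit Types (p : {poly R}) (t : R).

(** Polynomials in 1/t are allowed in front of exp(-1/t) to make the family stable under
    differentiation; [p = 1] is the classical flat function. *)
Definition flat p t : R := if 0 < t then p.[t^-1] * expR (- t^-1) else 0.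

Lemma poly_bound p : exists2 A, 0 <= A &
  forall s, 1 <= s -> `|p.[s]| <= A * s ^+ size p.
Proof.
exists (\sum_(i < size p) `|p`_i|); first exact: sumr_ge0.
move=> s s1; rewrite horner_coef (le_trans (ler_norm_sum _ _ _))// mulr_suml.
apply: ler_sum => i _; rewrite normrM ler_wpM2l// normrX ger0_norm; last lra.
by apply: ler_weXn2l => //; exact: ltnW.
Qed.

(** With n the size of p, p(1/t) is O(t^-n), while the exponential series gives exp(-1/t) <= (n+2)!
    t^(n+2). The two spare powers of t make the difference quotient at 0 tend to 0. *)
Lemma flat_bound p : exists2 C, 0 <= C &
  forall t, `|t| <= 1 -> `|flat p t| <= C * t ^+ 2.
Proof.
have [A A0 pA] := poly_bound p.
set n := size p in pA.
exists (A * (n.+2)`!%:R); first by rewrite mulr_ge0.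
move=> t t1; rewrite /flat; case: ifPn => t0; last first.
  by rewrite normr0 mulr_ge0 ?sqr_ge0// mulr_ge0.
have s1 : 1 <= t^-1 by rewrite invf_ge1//; rewrite ger0_norm// ltW in t1.
have t'0 : 0 < t^-1 by rewrite invr_gt0.
rewrite normrM (@ger0_norm _ (expR _)) ?expR_ge0// expRN.
have e1 : (t^-1) ^+ n.+2 / n.+2`!%:R <= expR t^-1.
  by apply: le_trans (expR_ge1Dxn n.+1 (ltW t'0)); rewrite lerDr.
apply: (@le_trans _ _ (A * t^-1 ^+ n * ((t^-1) ^+ n.+2 / n.+2`!%:R)^-1)).
  apply: ler_pM => //; [exact: pA|].
  by rewrite lef_pV2 ?posrE ?expR_gt0// divr_gt0 ?exprn_gt0// ltr0n fact_gt0.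
rewrite le_eqVlt; apply/orP; left; apply/eqP.
rewrite -[n.+2]addn2 exprD !exprVn; field.
by rewrite expf_neq0 ?gt_eqF// pnatr_eq0 -lt0n fact_gt0.
Qed.

Lemma flat_le0 p t : t <= 0 -> flat p t = 0.
Proof. by rewrite /flat leNgt => /negbTE ->. Qed.

Lemma is_derive_flat p t :
  is_derive t 1 (flat p) (flat ('X^2 * (p - p^`()))  t).
Proof.
have [t0|t0|->] := ltgtP t 0.
- rewrite [X in is_derive _ _ _ X]flat_le0; last exact: ltW.
  apply: (@near_eq_is_derive _ _ _ (cst 0)).
    near=> x; rewrite flat_le0//=.
    by near: x; exact: lt_le_nbhsl.
- rewrite [X in is_derive _ _ _ X]/flat t0.
  apply: (@near_eq_is_derive _ _ _ (fun t => p.[t^-1] * expR (- t^-1))).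
    near=> x; rewrite /flat ifT//.
    by near: x; exact: lt_nbhsr.
  have dV : is_derive t 1 (fun x : R => x^-1) (- t ^- 2 *: 1).
    by apply: is_deriveV; rewrite gt_eqF.
  have dp : is_derive t 1 (fun x : R => p.[x^-1]) (p^`().[t^-1] * (- t ^- 2 *: 1)).
    exact: (@is_derive1_comp _ (horner p) (fun x => x^-1)).
  have de : is_derive t 1 (fun x : R => expR (- x^-1))
      (expR (- t^-1) * - (- t ^- 2 *: 1)).
    exact: (@is_derive1_comp _ expR (fun x => - x^-1)).
  apply: is_derive_eq.
  rewrite /GRing.scale /= hornerM hornerXn hornerD hornerN !exprVn; ring.
- have [C C0 pC] := flat_bound p.
  suff F : (fun h => h^-1 *: ((flat p \o shift 0) (h *: 1) - flat p 0)) @ 0^' --> (0 : R).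
    apply: DeriveDef; first by apply/cvg_ex; exists 0.
    rewrite [RHS]flat_le0//; exact: cvg_lim.
  apply/cvgr0Pnorm_lt => e e0.
  near=> h.
  have h0 : h != 0 by near: h; exact: nbhs_dnbhs_neq.
  have h1 : `|h| <= Num.min 1 (e / 2 / (C + 1)).
    near: h; apply: dnbhs0_le.
    by rewrite lt_min ltr01 !divr_gt0//; lra.
  apply: (@le_lt_trans _ _ (e / 2)); last by rewrite ltr_pdivrMr//; lra.
  rewrite /= addr0 [X in _ - X]flat_le0// subr0 [_ *: 1]mulr1 normrZ normfV.
  rewrite ler_pdivrMl ?normr_gt0//.
  move: h1; rewrite le_min => /andP[h1 h2].
  apply: le_trans (pC _ h1) _.
  rewrite -real_normK ?num_real// expr2 mulrCA ler_wpM2l//.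
  move: h2; rewrite ler_pdivlMr; last lra.
  by apply: le_trans; rewrite mulrC ler_wpM2l//; lra.
Unshelve. all: by end_near. Qed.

End flat.

Section smooth.
Context {R : realType} {d : nat}.
Local Notation V := 'rV[R]_d.

(** Only a directional derivative of f is assumed, so the chain rule is reduced to that of one
    variable on the line through x directed by v. *)
Lemma is_derive_compl (x v : V) (f : V -> R) (g : R -> R) (a b : R) :
  is_derive x v f a -> is_derive (f x) 1 g b -> is_derive x v (g \o f) (b * a).
Proof.
move=> [df fa] dg.
have E (h : V -> R) : 'D_v h x = 'D_1 (fun t : R => h (t *: v + x)) 0.
  rewrite /derive; set u := fun _ => _; set w := fun _ => _.
  suff -> : u = w by []; apply/funext => t; rewrite /u /w /=.
  by rewrite addr0 scale0r add0r [_ *: 1]mulr1.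
have df' : is_derive (0 : R) (1 : R) (fun t : R => f (t *: v + x)) a.
  by apply: DeriveDef; [move/derivable1P : df|rewrite -E].
have : is_derive (0 : R) (1 : R) (g \o (fun t : R => f (t *: v + x))) (b * a).
  by apply: is_derive1_comp; rewrite scale0r add0r.
move=> [D1 D2]; apply: DeriveDef; last by rewrite E.
by apply/derivable1P.
Qed.

(** [smooth] speaks of all iterated partial derivatives. It holds for any class of continuous
    functions that contains the partial derivatives of its members; this class is such, and contains
    the inverses and flat functions from which cutoffs are built. *)
Inductive smooth_expr : (V -> R) -> Prop :=
| se_smooth f : smooth f -> smooth_expr f
| se_cst (c : R) : smooth_expr (fun=> c)
| se_coord i : smooth_expr (fun x => x 0 i)
| se_add f g : smooth_expr f -> smooth_expr g -> smooth_expr (fun x => f x + g x)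
| se_mul f g : smooth_expr f -> smooth_expr g -> smooth_expr (fun x => f x * g x)
| se_inv f : (forall x, f x != 0) -> smooth_expr f ->
    smooth_expr (fun x => (f x)^-1)
| se_flat p f : smooth_expr f -> smooth_expr (fun x => flat p (f x)).

Lemma smooth_partial i (f : V -> R) : smooth f ->
  smooth (partial (R:=R) i f).
Proof.
move=> sf s.
have -> : foldr partial (partial i f) s = foldr partial f (rcons s i).
  by rewrite foldr_rcons.
exact: sf.
Qed.

Lemma smooth_expr_continuous f : smooth_expr f -> continuous f.
Proof.
elim => [{}f sf|c|i|{}f g _ cf _ cg|{}f g _ cf _ cg|{}f f0 _ cf|p {}f _ cf] x.
- exact: (sf [::]).1.
- exact: cst_continuous.
- exact: coord_continuous.
- by apply: (@continuousD R R^o); [exact: cf|exact: cg].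
- by apply: continuousM; [exact: cf|exact: cg].
- by apply: continuousV; [exact: f0|exact: cf].
- apply: continuous_comp; first exact: cf.
  apply/differentiable_continuous/derivable1_diffP.
  by have [] := is_derive_flat p (f x).
Qed.

Lemma smooth_expr_derive f (i : 'I_d) : smooth_expr f ->
  exists2 g, smooth_expr g & forall x, is_derive x (delta_mx 0 i) f (g x).
Proof.
elim => [{}f sf|c|j|{}f g sf [f' sf' ff'] sg [g' sg' gg']|
  {}f g sf [f' sf' ff'] sg [g' sg' gg']|{}f f0 sf [f' sf' ff']|
  p {}f sf [f' sf' ff']].
- exists (partial i f); first by apply: se_smooth; exact: smooth_partial.
  by move=> x; apply: derivableP; exact: (sf [::]).2.
- by exists (fun=> 0) => [|x]; [exact: se_cst|exact: is_derive_cst].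
- exists (fun=> (delta_mx 0 i : V) 0 j) => [|x]; first exact: se_cst.
  apply: DeriveDef; first exact/diff_derivable/differentiable_coord.
  apply: cvg_lim => //; apply: cvg_near_cst.
  near=> h; have h0 : h != 0 by near: h; exact: nbhs_dnbhs_neq.
  by rewrite /= !mxE addrK scalerA mulVf// scale1r.
- exists (fun x => f' x + g' x) => [|x]; first exact: se_add.
  exact: is_deriveD.
- exists (fun x => f x * g' x + g x * f' x) => [|x].
    by apply: se_add; exact: se_mul.
  exact: is_deriveM.
- exists (fun x => - 1 * ((f x)^-1 * (f x)^-1 * f' x)) => [|x].
    apply: se_mul; first exact: se_cst.
    by do !apply: se_mul => //; exact: se_inv.
  have [df fE] := ff' x.
  apply: DeriveDef; first exact: derivableV.
  rewrite deriveV// fE.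
  by rewrite mulN1r /GRing.scale/= mulNr expr2 invfM.
- exists (fun x => flat ('X^2 * (p - p^`())) (f x) * f' x) => [|x].
    by apply: se_mul => //; exact: se_flat.
  apply: is_derive_compl; exact: is_derive_flat.
Unshelve. all: by end_near. Qed.

Lemma smooth_expr_smooth f : smooth_expr f -> smooth f.
Proof.
move=> sf s.
suff : smooth_expr (foldr partial f s).
  move=> {}sf; split; first exact: smooth_expr_continuous.
  by move=> i x; have [g _ /(_ x)[]] := smooth_expr_derive i sf.
elim: s => //= i s ih; have [g sg gE] := smooth_expr_derive i ih.
suff -> : partial i (foldr partial f s) = g by [].
by apply/funext => x; have [] := gE x.
Qed.

Lemma smooth_cst (c : R) : smooth (fun _ : V => c).
Proof. exact/smooth_expr_smooth/se_cst. Qed.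

Lemma smooth_add (f g : V -> R) : smooth f -> smooth g ->
  smooth (fun x => f x + g x).
Proof. by move=> ? ?; apply/smooth_expr_smooth/se_add; exact: se_smooth. Qed.

Lemma smooth_mul (f g : V -> R) : smooth f -> smooth g ->
  smooth (fun x => f x * g x).
Proof. by move=> ? ?; apply/smooth_expr_smooth/se_mul; exact: se_smooth. Qed.

Lemma smooth_continuous (f : V -> R) : smooth f -> continuous f.
Proof. by move=> /(_ [::])[]. Qed.

Lemma smooth_derivable (f : V -> R) i x : smooth f ->
  derivable f x (delta_mx 0 i).
Proof. by move=> /(_ [::])[_]; exact. Qed.

Definition step (t : R) : R := flat 1 t / (flat 1 t + flat 1 (1 - t)).

Lemma flat1_ge0 (t : R) : 0 <= flat 1 t.
Proof. by rewrite /flat; case: ifP => // _; rewrite hornerC mul1r expR_ge0. Qed.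

Lemma flat1_gt0 (t : R) : 0 < t -> 0 < flat 1 t.
Proof. by move=> t0; rewrite /flat t0 hornerC mul1r expR_gt0. Qed.

Lemma step_den_gt0 (t : R) : 0 < flat 1 t + flat 1 (1 - t).
Proof.
have [t0|t0] := ltP 0 t; first by rewrite ltr_wpDr ?flat1_ge0 ?flat1_gt0.
by rewrite ltr_wpDl ?flat1_ge0 ?flat1_gt0//; lra.
Qed.

Lemma step_ge0 t : 0 <= step t.
Proof. by rewrite divr_ge0 ?flat1_ge0// ltW// step_den_gt0. Qed.

Lemma step_le1 t : step t <= 1.
Proof. by rewrite ler_pdivrMr ?step_den_gt0// mul1r lerDl flat1_ge0. Qed.

Lemma step_eq0 t : t <= 0 -> step t = 0.
Proof. by move=> t0; rewrite /step flat_le0// mul0r. Qed.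

Lemma step_eq1 t : 1 <= t -> step t = 1.
Proof.
move=> t1; rewrite /step (@flat_le0 _ _ (1 - t)) ?addr0; last lra.
by rewrite divff// gt_eqF// flat1_gt0//; lra.
Qed.

Lemma smooth_step (f : V -> R) : smooth f -> smooth (fun x => step (f x)).
Proof.
move=> sf; apply/smooth_expr_smooth/se_mul.
  exact/se_flat/se_smooth.
apply: se_inv => [x|]; first by rewrite gt_eqF// step_den_gt0.
apply: se_add; apply: se_flat; first exact: se_smooth.
apply: se_add; first exact: se_cst.
rewrite (_ : (fun x => - f x) = (fun x => -1 * f x)).
  by apply: se_mul; [exact: se_cst|exact: se_smooth].
by apply/funext => x; rewrite mulN1r.
Qed.

End smooth.

(** * Cubes, supports and cutoff functions *)

Section cubes.
Context {R : realType} {d : nat}.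
Local Notation V := 'rV[R]_d.

Definition ocube (c : V) (r : R) : set V :=
  [set x | forall i, `|x 0 i - c 0 i| < r].

Definition ccube (c : V) (r : R) : set V :=
  [set x | forall i, `|x 0 i - c 0 i| <= r].

Lemma continuous_open_lt (T : topologicalType) (f : T -> R) c :
  continuous f -> open [set x | f x < c].
Proof. by move=> cf; apply: (@open_comp _ _ f [set y | y < c]) => //; exact: open_lt. Qed.

Lemma continuous_closed_le (T : topologicalType) (f : T -> R) c :
  continuous f -> closed [set x | f x <= c].
Proof. by move=> cf; apply: (@preimage_closed _ _ f [set y | y <= c]) => //; exact: closed_le. Qed.

Lemma continuous_open_gt (T : topologicalType) (f : T -> R) c :
  continuous f -> open [set x | c < f x].
Proof. by move=> cf; apply: (@open_comp _ _ f [set y | c < y]) => //; exact: open_gt. Qed.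

Lemma continuous_closed_ge (T : topologicalType) (f : T -> R) c :
  continuous f -> closed [set x | c <= f x].
Proof. by move=> cf; apply: (@preimage_closed _ _ f [set y | c <= y]) => //; exact: closed_ge. Qed.

Lemma continuous_coord_dist (c : V) i :
  continuous (fun x : V => `|x 0 i - c 0 i|).
Proof.
move=> x; apply: (@continuous_comp _ _ _ (fun x : V => x 0 i - c 0 i) Num.norm).
  by apply: continuousB; [exact: coord_continuous|exact: cst_continuous].
exact: norm_continuous.
Qed.

Lemma open_ocube c r : open (ocube c r).
Proof.
rewrite openE => x h.
apply: (@filter_forall V _ (fun i y => `|y 0 i - c 0 i| < r) (nbhs x)) => i.
have /(_ x) := @continuous_open_lt V (fun x => `|x 0 i - c 0 i|) r
  (@continuous_coord_dist c i).
by apply; exact: h.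
Qed.

Lemma compact_ccube c r : compact (ccube c r).
Proof.
have := @rV_compact R d (fun i => `[c 0 i - r, c 0 i + r]%classic).
move=> /(_ (fun i => @segment_compact R _ _)); congr compact.
apply/seteqP; split => x /= h i; have := h i; rewrite /= in_itv/=.
  by rewrite ler_distl.
by rewrite ler_distl.
Qed.

Lemma closed_ccube c r : closed (ccube c r).
Proof.
rewrite (_ : ccube c r = \bigcap_(i in setT) [set x : V | `|x 0 i - c 0 i| <= r]).
  apply: closed_bigI => i _.
  exact: (@continuous_closed_le V (fun x => `|x 0 i - c 0 i|) r
    (@continuous_coord_dist c i)).
by apply/seteqP; split => x /= h i; [move=> _; exact: h|exact: (h i Logic.I)].
Qed.

Lemma ocube_ccube c r : ocube c r `<=` ccube c r.
Proof. by move=> x h i; exact/ltW/h. Qed.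

Lemma ccube_ocube c r r' : r < r' -> ccube c r `<=` ocube c r'.
Proof. by move=> rr x h i; exact: le_lt_trans (h i) rr. Qed.

Lemma nbhs_ccube (x : V) A : nbhs x A -> exists2 r, 0 < r & ccube x r `<=` A.
Proof.
move=> /nbhs_ballP[e /= e0 eA]; exists (e / 2); first by rewrite divr_gt0.
move=> y h; apply: eA; split => // i j; rewrite ord1 /ball/= distrC.
by apply: (le_lt_trans (h j)); rewrite ltr_pdivrMr//; lra.
Qed.

Lemma coord_le_norm (x : V) i : `|x 0 i| <= `|x|.
Proof.
rewrite [leRHS]/Num.norm/= mx_normrE; apply/bigmax_geP; right.
by exists (0, i).
Qed.

Lemma compact_sub_ccube (K : set V) : compact K ->
  exists2 r, 0 < r & K `<=` ccube 0 r.
Proof.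
move=> /compact_bounded[M [_ KM]]; exists (`|M| + 1); first by rewrite ltr_wpDl.
move=> x Kx i; rewrite mxE subr0.
apply: le_trans (coord_le_norm x i) _; apply: (KM (`|M| + 1) _ _ Kx).
by rewrite (le_lt_trans (ler_norm _))// ltrDl.
Qed.

Lemma closed_bounded_compact (A : set V) c r :
  closed A -> A `<=` ccube c r -> compact A.
Proof. by move=> cA; exact: subclosed_compact cA (@compact_ccube c r). Qed.

Lemma compact_is_closed (K : set V) : compact K -> closed K.
Proof. by move=> cK; apply: (@compact_closed V) => //; exact: norm_hausdorff. Qed.

Definition supp (f : V -> R) : set V := closure [set x | f x != 0].

Lemma supp_closed (f : V -> R) A : closed A ->
  (forall x, f x != 0 -> A x) -> supp f `<=` A.
Proof. by move=> cA fA; rewrite (iffLR (closure_id A) cA); exact: closureS. Qed.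

Lemma notin_supp (f : V -> R) x : ~ supp f x -> f x = 0.
Proof.
move=> nx; apply: contrapT => /eqP fx; apply: nx; exact: subset_closure.
Qed.

Lemma test_sub U U' (f : V -> R) :
  test_function U f -> supp f `<=` U' -> test_function U' f.
Proof. by move=> [? ? ?] ?; split. Qed.

Lemma test0 (U : set V) : test_function U (fun=> 0).
Proof.
split; first exact: smooth_cst.
  rewrite (_ : [set x | _] = set0) ?closure0; first exact: compact0.
  by apply/seteqP; split => x //=; rewrite eqxx.
rewrite (_ : [set x | _] = set0) ?closure0//.
by apply/seteqP; split => x //=; rewrite eqxx.
Qed.

Lemma test_mull U (h f : V -> R) :
  smooth h -> test_function U f -> test_function U (fun x => h x * f x).
Proof.
move=> sh [sf cf fU].
have sub : supp (fun x => h x * f x) `<=` supp f.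
  by apply: closureS => x /=; rewrite mulf_eq0 negb_or => /andP[].
split; first exact: smooth_mul.
- by apply: subclosed_compact cf sub; exact: closed_closure.
- exact: subset_trans fU.
Qed.

Lemma test_add U (f g : V -> R) :
  test_function U f -> test_function U g -> test_function U (fun x => f x + g x).
Proof.
move=> [sf cf fU] [sg cg gU].
have sub : supp (fun x => f x + g x) `<=` supp f `|` supp g.
  rewrite /supp -closureU; apply: closureS => x /= fg.
  have [f0|] := eqVneq (f x) 0; last by left.
  by right; move: fg; rewrite f0 add0r.
split; first exact: smooth_add.
- by apply: subclosed_compact (compactU cf cg) sub; exact: closed_closure.
- by apply: subset_trans sub _; rewrite subUset.
Qed.

Lemma test_scale U c (f : V -> R) :
  test_function U f -> test_function U (fun x => c * f x).
Proof. exact/test_mull/smooth_cst. Qed.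

Lemma supp_partial i (f : V -> R) : supp (partial i f) `<=` supp f.
Proof.
apply: supp_closed; first exact: closed_closure.
move=> x; apply: contra_neqP => nx.
rewrite /partial (@near_eq_derive _ _ _ _ (cst 0)) ?derive_cst//.
have : open (~` supp f) by rewrite openC; exact: closed_closure.
by rewrite openE => /(_ _ nx); apply: filterS => y; exact: notin_supp.
Qed.

Lemma test_partial U i (f : V -> R) :
  test_function U f -> test_function U (partial i f).
Proof.
move=> [sf cf fU]; have sub := @supp_partial i f.
split; first exact: smooth_partial.
- by apply: subclosed_compact cf sub; exact: closed_closure.
- exact: subset_trans fU.
Qed.

Lemma test_bounded U (f : V -> R) : test_function U f ->
  exists2 M, 0 < M & forall x, `|f x| <= M.
Proof.
move=> [sf cf _].
have [M [_ Mf]] : bounded_set (f @` supp f).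
  apply/compact_bounded/continuous_compact => //.
  exact/continuous_subspaceT/smooth_continuous.
exists (`|M| + 1) => [|x]; first by rewrite ltr_wpDl.
have [xf|/notin_supp ->] := pselect (supp f x); last by rewrite normr0 addr_ge0.
apply: (Mf (`|M| + 1)); last by exists x.
by rewrite (le_lt_trans (ler_norm _))// ltrDl.
Qed.

(** Positive exactly on the open Euclidean ball of centre [q.1] and squared radius [q.2]; the
    squared distance keeps the argument of [flat] polynomial. *)
Definition bump (q : V * R) (x : V) : R :=
  flat 1 (q.2 + - 1 * \sum_i (x 0 i - q.1 0 i) ^+ 2).

Lemma smooth_expr_sum n (F : 'I_n -> V -> R) :
  (forall i, smooth_expr (F i)) -> smooth_expr (fun x => \sum_i F i x).
Proof.
elim: n F => [F _|n ih F sF].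
  under eq_fun do rewrite big_ord0; exact: se_cst.
under eq_fun do rewrite big_ord_recl.
by apply: se_add => //; exact: ih.
Qed.

Lemma smooth_bump q : smooth_expr (bump q).
Proof.
apply/se_flat/se_add; first exact: se_cst.
apply: se_mul; first exact: se_cst.
apply: smooth_expr_sum => i.
have s1 : smooth_expr (fun x : V => x 0 i - q.1 0 i).
  by apply: se_add; [exact: se_coord|exact: se_cst].
by under eq_fun do rewrite expr2; exact: se_mul.
Qed.

Lemma bump_support q x r : 0 < r -> q.2 = r ^+ 2 -> bump q x != 0 ->
  ccube q.1 r x.
Proof.
move=> r0 qr bx i.
rewrite leNgt; apply: contra_neqN bx => ri.
rewrite /bump flat_le0// qr mulN1r subr_le0.
rewrite (bigD1 i)//= ler_wpDr//; first by apply: sumr_ge0 => j _; exact: sqr_ge0.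
by rewrite -[leRHS]real_normK ?num_real// lerXn2r ?nnegrE ?(ltW r0)// ltW.
Qed.

Lemma bump_ge0 q x : 0 <= bump q x.
Proof. exact: flat1_ge0. Qed.

Lemma bump_gt0 q : 0 < q.2 -> 0 < bump q q.1.
Proof.
move=> q0; rewrite /bump big1 ?mulr0 ?addr0 ?flat1_gt0// => i _.
by rewrite subrr expr0n.
Qed.

(* Finitely many bumps add up to a smooth A >= 0 with A > 0 on K; the cutoff
   is a step function of A between 0 and min_K A. *)
Lemma cutoff (K U : set V) : compact K -> open U -> K `<=` U ->
  exists chi : V -> R, exists W : set V, [/\ test_function U chi,
    (forall x, 0 <= chi x <= 1), open W, K `<=` W &
    forall x, W x -> chi x = 1].
Proof.
move=> cK oU KU.
pose D := [set q : V * R | 0 < q.2 /\ ccube q.1 (Num.sqrt q.2) `<=` U].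
pose f (q : V * R) := [set x | 0 < bump q x].
have : K `<=` cover D f.
  move=> x Kx; have /nbhs_ccube[r r0 rU] : nbhs x U.
    by move: oU; rewrite openE; apply; exact: KU.
  exists (x, r ^+ 2); last exact/bump_gt0/exprn_gt0.
  by split; rewrite /= ?exprn_gt0// sqrtr_sqr gtr0_norm.
move: (cK) => cK0; move: cK; rewrite {1}compact_cover => cK /cK.
case=> [q [q0 _]|D' D'D KD'].
  apply: (@continuous_open_gt V (bump q) 0); exact/smooth_expr_continuous/smooth_bump.
pose L : seq (V * R) := finmap.enum_fset D'.
pose A x := \sum_(q <- L) bump q x.
have sA : smooth A.
  apply/smooth_expr_smooth; rewrite /A; elim: (L) => [|q l ih].
    by under eq_fun do rewrite big_nil; exact: se_cst.
  by under eq_fun do rewrite big_cons; apply: se_add => //; exact: smooth_bump.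
have cA := smooth_continuous sA.
have A0 x : 0 <= A x by apply: sumr_ge0 => q _; exact: bump_ge0.
have Agt0 x : K x -> 0 < A x.
  move=> /KD'[q qD' bqx]; rewrite /A (big_rem q)//= ltr_pwDl//.
  by apply: sumr_ge0 => p _; exact: bump_ge0.
have LD q : q \in L -> D q by move=> qL; exact/set_mem/D'D.
have supA x : A x != 0 -> exists2 q, q \in L & ccube q.1 (Num.sqrt q.2) x.
  move=> Ax; have [q qL bqx] : exists2 q, q \in L & bump q x != 0.
    apply: contrapT => h; move/eqP: Ax; apply; rewrite /A big_seq big1// => q qL.
    by apply: contrapT => /eqP bq; apply: h; exists q.
  have Dq := LD _ qL.
  exists q => //; apply: bump_support bqx; first by rewrite sqrtr_gt0; case: Dq.
  by rewrite sqr_sqrtr//; case: Dq => /ltW.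
have [K0|/set0P K0] := eqVneq K set0.
  exists (fun=> 0), set0; split; [exact: test0| |exact: open0|by rewrite K0|by []].
  by move=> x; rewrite lexx ler01.
have [|c /set_mem Kc Kmin] := compact_EVT_min K0 cK0 (f := A).
  exact: continuous_subspaceT.
set m := A c in Kmin; have m0 : 0 < m by exact: Agt0.
(* This vanishes where A <= m / 4 and equals 1 where A >= m / 2, while A >= m on K. *)
pose chi x := step (4 / m * A x + - 1).
have schi : smooth chi.
  apply/smooth_step/smooth_add; last exact: smooth_cst.
  by apply: smooth_mul => //; exact: smooth_cst.
have chiS : supp chi `<=` [set x | m / 4 <= A x].
  apply: supp_closed; first exact: continuous_closed_ge.
  move=> x; apply: contra_neqT; rewrite -ltNge => Am; apply: step_eq0.
  rewrite mulrC mulrA subr_le0 ler_pdivrMr// mul1r.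
  by rewrite ltW// -ltr_pdivlMr.
have chiA x : supp chi x -> exists2 q, q \in L & ccube q.1 (Num.sqrt q.2) x.
  move=> /chiS/= mA; apply: supA; rewrite gt_eqF// (lt_le_trans _ mA)//.
  by rewrite divr_gt0.
exists chi, [set x | m / 2 < A x]; split.
- split => //; last by move=> x /chiA[q /LD[_ qU]] /qU.
  apply: (@closed_bounded_compact _ 0 (\sum_(q <- L) (`|q.1| + Num.sqrt q.2))).
    exact: closed_closure.
  move=> x /chiA[q qL xq] i; rewrite mxE subr0.
  rewrite (big_rem q)//= ler_wpDr//.
    by apply: sumr_ge0 => p _; rewrite addr_ge0// sqrtr_ge0.
  rewrite -[x 0 i](subrK (q.1 0 i)) (le_trans (ler_normD _ _))// addrC lerD//.
  exact: coord_le_norm.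
- by move=> x; rewrite step_ge0 step_le1.
- exact: continuous_open_gt.
- move=> x Kx /=; apply: (@lt_le_trans _ _ m); first by rewrite ltr_pdivrMr//; lra.
  exact/Kmin/mem_set.
- move=> x /= mA; apply: step_eq1.
  rewrite lerBrDr mulrC mulrA ler_pdivlMr//.
  by move: mA; rewrite ltr_pdivrMr//; lra.
Qed.

End cubes.

(** * Lebesgue measure of cubes and shells *)

Section lebesgue_theory.
Context {R : realType} {d : nat}.
Local Notation V := 'rV[R]_d.
Local Notation leb := (@lebesgue_Rd R d).
Local Open Scope ereal_scope.

(** Covers are sets of boxes, so boxes with the same image under [e] are merged. A section [s] of
    [e] counts each image once. *)
Lemma esum_image_le (T T' : choiceType) (P : set T) (e : T -> T')
    (a : T' -> \bar R) : (forall i, 0 <= a i) ->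
  \esum_(j in e @` P) a j <= \esum_(i in P) a (e i).
Proof.
move=> a0.
have [->|/set0P[x0 Px0]] := eqVneq P set0; first by rewrite image_set0 !esum_set0.
have /choice[s sP] : forall y, exists x, (e @` P) y -> P x /\ e x = y.
  move=> y; have [[x Px xy]|ny] := pselect ((e @` P) y); first by exists x.
  by exists x0.
have sI : set_inj (e @` P) s.
  move=> y z /set_mem/sP[_ y1] /set_mem/sP[_ z1] yz.
  by rewrite -y1 -z1 yz.
rewrite (eq_esum (b := fun y => a (e (s y)))); last by move=> y /sP[_ ->].
rewrite -(esum_image _ _ (fun x => a (e x)) sI).
apply: ereal_sup_le => _ [X [fX XP] <-]; exists X => //; split => // x /XP[y /sP[Py _] <-] //.
Qed.

Lemma lebesgue_Rd_le_cover (A : set V) (C : set (V * V)) (g : V * V -> V * V) :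
  countable C -> A `<=` \bigcup_(q in C) box (g q) ->
  leb A <= \esum_(q in C) (box_volume (g q))%:E.
Proof.
move=> cC AC.
apply: le_trans (@esum_image_le _ _ C g (fun q => (box_volume q)%:E) (@box_volume_ge0 _ _)).
apply: ereal_inf_lbound; exists (g @` C) => //; split.
  exact: sub_countable (card_image_le _ _) cC.
by move=> x /AC[q Cq xq]; exists (g q) => //; exists q.
Qed.

Lemma lebesgue_Rd_box (q : V * V) : leb (box q) <= (box_volume q)%:E.
Proof.
have := @lebesgue_Rd_le_cover (box q) [set q] id.
rewrite esum_set1 ?box_volume_ge0//; apply; first exact: countable1.
by move=> x xq; exists q.
Qed.

Lemma lebesgue_setU2 (A B : set V) : leb (A `|` B) <= leb A + leb B.
Proof. exact: outer_measureU2. Qed.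

Lemma lebesgue_bigsetU n (F : 'I_n -> set V) :
  leb (\big[setU/set0]_(i < n) F i) <= \sum_(i < n) leb (F i).
Proof.
elim/big_ind2: _ => [|A a B b Aa Bb|//]; first by rewrite lebesgue_Rd0.
exact: le_trans (lebesgue_setU2 _ _) (leeD Aa Bb).
Qed.

Definition halfspace (i : 'I_d) (c : R) : set V := [set x | (x 0 i <= c)%R].

Definition cut_upper (i : 'I_d) (c : R) (v : V) : V :=
  \row_j (if j == i then Num.min (v 0 j) c else v 0 j)%R.

Definition cut_lower (i : 'I_d) (c : R) (v : V) : V :=
  \row_j (if j == i then Num.max (v 0 j) c else v 0 j)%R.

Lemma box_volume_cut i c (q : V * V) :
  (box_volume (q.1, cut_upper i c q.2) + box_volume (cut_lower i c q.1, q.2)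
    <= box_volume q)%R.
Proof.
rewrite /box_volume (bigD1 i)//= [X in (_ + X <= _)%R](bigD1 i)//=.
rewrite [X in (_ <= X)%R](bigD1 i)//= !mxE eqxx.
set P := (\prod_(j < d | j != i) Num.max 0 (q.2 0 j - q.1 0 j))%R.
rewrite (eq_bigr (fun j => Num.max 0 (q.2 0 j - q.1 0 j))%R); last first.
  by move=> j ji; rewrite mxE (negbTE ji).
rewrite [X in (_ + _ * X <= _)%R](eq_bigr
    (fun j => Num.max 0 (q.2 0 j - q.1 0 j))%R); last first.
  by move=> j ji; rewrite mxE (negbTE ji).
rewrite -mulrDl ler_wpM2r//.
  by apply: prodr_ge0 => j _; rewrite le_max lexx.
rewrite /Num.max /Num.min; do !case: ifPn; rewrite -?leNgt; lra.
Qed.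

(** The hyperplane cuts every box of a cover into two boxes whose volumes add up to at most the
    original one. The two halves cover the two parts of A, which is the criterion of
    Caratheodory. *)
Lemma lebesgue_set_halfspace i c : lebesgue_set (halfspace i c).
Proof.
apply: le_caratheodory_measurable => A /=.
apply: le_ereal_inf_tmp => _ [C [cC AC] <-].
apply: (@le_trans _ _ (\esum_(q in C) ((box_volume (q.1, cut_upper i c q.2))%:E +
    (box_volume (cut_lower i c q.1, q.2))%:E))); last first.
  by apply: le_esum => q _; rewrite -EFinD lee_fin box_volume_cut.
rewrite esumD; [|by move=> *; exact: box_volume_ge0..].
apply: leeD.
- apply: (lebesgue_Rd_le_cover (g := fun q => (q.1, cut_upper i c q.2))) => //.
  move=> x [/AC[q Cq xq] xc]; exists q => // j /=; rewrite mxE.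
  have [->|ji] := eqVneq j i; last exact: xq.
  by have /andP[-> x2] := xq i; rewrite le_min x2.
- apply: (lebesgue_Rd_le_cover (g := fun q => (cut_lower i c q.1, q.2))) => //.
  move=> x [/AC[q Cq xq] /negP xc]; exists q => // j /=; rewrite mxE.
  have [->|ji] := eqVneq j i; last exact: xq.
  by have /andP[x1 ->] := xq i; rewrite andbT gt_max x1/= ltNge xc.
Qed.

Lemma lebesgue_setC (A : set V) : lebesgue_set A -> lebesgue_set (~` A).
Proof. exact: measurableC. Qed.
Lemma lebesgue_setU (A B : set V) :
  lebesgue_set A -> lebesgue_set B -> lebesgue_set (A `|` B).
Proof. exact: measurableU. Qed.
Lemma lebesgue_setI (A B : set V) :
  lebesgue_set A -> lebesgue_set B -> lebesgue_set (A `&` B).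
Proof. exact: measurableI. Qed.
Lemma lebesgue_setD (A B : set V) :
  lebesgue_set A -> lebesgue_set B -> lebesgue_set (A `\` B).
Proof. exact: measurableD. Qed.
Lemma lebesgue_set0 : lebesgue_set (set0 : set V).
Proof. exact: measurable0. Qed.
Lemma lebesgue_setT : lebesgue_set (setT : set V).
Proof. exact: measurableT. Qed.

Lemma lebesgue_set_box (q : V * V) : lebesgue_set (box q).
Proof.
rewrite (_ : box q = \bigcap_(i in [set: 'I_d])
  (~` halfspace i (q.1 0%R i) `&` halfspace i (q.2 0%R i))); last first.
  apply/seteqP; split => x /= h i; last first.
    by have [/negP] := h i Logic.I; rewrite -ltNge => -> ->.
  by move=> _; have /andP[h1 h2] := h i; split => //; apply/negP; rewrite -ltNge.
apply: fin_bigcap_measurable => // i _; apply: measurableI.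
  by apply: measurableC; exact: lebesgue_set_halfspace.
exact: lebesgue_set_halfspace.
Qed.

Lemma lebesgue_set_open (O : set V) : open O -> lebesgue_set O.
Proof.
move=> oO.
pose c (p : 'rV[rat]_d * 'rV[rat]_d) : V * V :=
  (map_mx ratr p.1, map_mx ratr p.2).
pose F p := if `[< box (c p) `<=` O >] then box (c p) else set0.
rewrite (_ : O = \bigcup_p F p).
  apply: countable_bigcupT_measurable => [|p]; first exact: countableP.
  by rewrite /F; case: ifP => _; [exact: lebesgue_set_box|exact: measurable0].
apply/seteqP; split=> [x Ox|x [p _]]; last first.
  by rewrite /F; case: ifPn => // /asboolP; exact.
have /nbhs_ccube[r r0 rO] : nbhs x O by move: oO; rewrite openE; apply.
have /choice[a ha] : forall i, exists a : rat, ratr a \in `](x 0 i - r)%R, x 0%R i[.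
  by move=> i; apply: rat_in_itvoo; rewrite gtrBl.
have /choice[b hb] : forall i, exists b : rat, ratr b \in `]x 0%R i, (x 0 i + r)%R[.
  by move=> i; apply: rat_in_itvoo; rewrite ltrDl.
have sub : box (c (\row_i a i, \row_i b i)) `<=` O.
  apply: subset_trans rO => y yab i; rewrite ler_distl.
  have := yab i; rewrite /c/= !mxE => /andP[y1 y2].
  have := ha i; rewrite in_itv/= => /andP[a1 a2].
  have := hb i; rewrite in_itv/= => /andP[b1 b2].
  by rewrite (ltW (lt_trans a1 y1)) (le_trans y2 (ltW b2)).
exists (\row_i a i, \row_i b i) => //; rewrite /F ifT; last exact/asboolP.
move=> i; rewrite /c/= !mxE.
have := ha i; rewrite in_itv/= => /andP[a1 ->].
by have := hb i; rewrite in_itv/= => /andP[/ltW -> b2].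
Qed.

Lemma lebesgue_set_closed (A : set V) : closed A -> lebesgue_set A.
Proof.
move=> cA; rewrite -(setCK A); apply: measurableC.
by apply: lebesgue_set_open; rewrite openC.
Qed.

Lemma lebesgue_ccube_lty c r : leb (ccube c r) < +oo.
Proof.
pose q : V * V := (\row_i (c 0 i - r - 1)%R, \row_i (c 0 i + r)%R).
apply: (@le_lt_trans _ _ (leb (box q))).
  apply: le_lebesgue_Rd => x xc i; have := xc i; rewrite ler_distl !mxE.
  by move=> /andP[h ->]; rewrite andbT (lt_le_trans _ h)// ltrBlDr ltrDl.
by rewrite (le_lt_trans (lebesgue_Rd_box q))// ltry.
Qed.

Lemma lebesgue_compact_lty (K : set V) : compact K -> leb K < +oo.
Proof.
move=> /compact_sub_ccube[r _ Kr].
exact: le_lt_trans (le_lebesgue_Rd Kr) (lebesgue_ccube_lty _ _).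
Qed.

Lemma lebesgue_shift_le (h : V) (A : set V) :
  leb [set x | A (x + h)%R] <= leb A.
Proof.
apply: le_ereal_inf_tmp => _ [C [cC AC] <-].
have -> : \esum_(q in C) (box_volume q)%:E =
    \esum_(q in C) (box_volume (q.1 - h, q.2 - h)%R)%:E.
  apply: eq_esum => q _; congr EFin; apply: eq_bigr => i _ /=.
  by rewrite !mxE; congr Num.max; ring.
apply: (lebesgue_Rd_le_cover (g := fun q => (q.1 - h, q.2 - h)%R)) => //.
move=> x /AC[q Cq xq]; exists q => // i; have := xq i.
by rewrite /= !mxE ltrBlDr lerBrDr.
Qed.

Lemma lebesgue_shift (h : V) (A : set V) :
  leb [set x | A (x + h)%R] = leb A.
Proof.
apply/eqP; rewrite eq_le lebesgue_shift_le/=.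
have {1}-> : A = [set x | [set x | A (x + h)%R] (x - h)%R].
  by apply/seteqP; split => x /=; rewrite subrK.
exact: lebesgue_shift_le.
Qed.

Lemma lebesgue_set_shift (h : V) (A : set V) :
  lebesgue_set A -> lebesgue_set [set x | A (x + h)%R].
Proof.
move=> mA; have {}mA X : leb X = leb (X `&` A) + leb (X `&` ~` A) := mA X.
apply: le_caratheodory_measurable => X.
have -> : lebesgue_outer X = leb [set x | X (x - h)%R].
  by rewrite lebesgue_shift.
rewrite mA /lebesgue_outer/=.
rewrite -[X in _ <= X + _](lebesgue_shift h) -[X in _ <= _ + X](lebesgue_shift h).
rewrite le_eqVlt; apply/orP; left; apply/eqP.
by congr (leb _ + leb _); apply/seteqP; split => x /=; rewrite addrK.
Qed.

(* The shell is covered by 2 d boxes, of thickness e or 2 e. *)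
Lemma lebesgue_shell c (r e : R) : (0 <= r)%R -> (0 < e)%R ->
  leb (ocube c r `\` ocube c (r - e)) <=
  ((3 * d%:R * e) * (2 * r) ^+ d.-1)%:E.
Proof.
move=> r0 e0.
pose up i : V * V := (\row_j (if j == i then c 0 j + r - 2 * e else c 0 j - r)%R,
                      \row_j (c 0 j + r)%R).
pose lo i : V * V := (\row_j (c 0 j - r)%R,
   \row_j (if j == i then c 0 j - r + e else c 0 j + r)%R).
have vol (q : V * V) i s : (0 <= s)%R -> (q.2 0 i - q.1 0 i = s)%R ->
    (forall j, j != i -> q.2 0 j - q.1 0 j = 2 * r)%R ->
    box_volume q = (s * (2 * r) ^+ d.-1)%R.
  move=> s0 qi qj; rewrite /box_volume (bigD1 i)//= qi max_r//; congr (_ * _)%R.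
  rewrite (eq_bigr (fun=> 2 * r)%R).
    by rewrite prodr_const cardC1 card_ord.
  by move=> j ji; rewrite qj// max_r// mulr_ge0.
apply: (@le_trans _ _ (\sum_(i < d) (leb (box (up i)) + leb (box (lo i))))%E).
  apply: (@le_trans _ _ (leb (\big[setU/set0]_(i < d) (box (up i) `|` box (lo i))))).
    apply: le_lebesgue_Rd => x [xr /existsNP[i /negP]]; rewrite -leNgt => xi.
    rewrite (bigD1 i)//=; left; have := xr i; rewrite ltr_norml => /andP[x1 x2].
    have xj j : (c 0 j - r < x 0 j <= c 0 j + r)%R.
      have := xr j; rewrite ltr_norml => /andP[y1 y2].
      by apply/andP; split; lra.
    move: xi; rewrite ler_normr => /orP[] xi.
      left => j; rewrite !mxE; have [->|ji] := eqVneq j i; last exact: xj.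
      by apply/andP; split; lra.
    right => j; rewrite !mxE; have [->|ji] := eqVneq j i; last exact: xj.
    by apply/andP; split; lra.
  apply: le_trans (lebesgue_bigsetU _) _; apply: lee_sum => i _.
  exact: lebesgue_setU2.
apply: (@le_trans _ _ (\sum_(i < d) (3 * e * (2 * r) ^+ d.-1)%:E)%E).
  apply: lee_sum => i _.
  apply: (@le_trans _ _ ((2 * e * (2 * r) ^+ d.-1)%:E + (e * (2 * r) ^+ d.-1)%:E)).
    apply: leeD; apply: le_trans (lebesgue_Rd_box _) _; rewrite lee_fin.
    - rewrite (@vol (up i) i (2 * e)%R); [by []|by rewrite mulr_ge0// ltW| |].
        by rewrite !mxE eqxx; ring.
      by move=> j ji; rewrite !mxE (negbTE ji); ring.
    - rewrite (@vol (lo i) i e); [by []|exact: ltW| |].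
        by rewrite !mxE eqxx; ring.
      by move=> j ji; rewrite !mxE (negbTE ji); ring.
  by rewrite -EFinD lee_fin le_eqVlt; apply/orP; left; apply/eqP; ring.
rewrite sumEFin lee_fin big_const_ord iter_addr addr0 -mulr_natl.
by rewrite le_eqVlt; apply/orP; left; apply/eqP; ring.
Qed.

Definition cube_volume (A : set V) (c : V) (t : R) : R :=
  fine (leb (A `&` ocube c t)).

Lemma lebesgue_ocube_lty c r : leb (ocube c r) < +oo.
Proof.
by apply: le_lt_trans (lebesgue_ccube_lty c r); apply/le_lebesgue_Rd/ocube_ccube.
Qed.

Lemma cube_volumeE A c t : leb (A `&` ocube c t) = (cube_volume A c t)%:E.
Proof.
rewrite fineK// ge0_fin_numE ?lebesgue_Rd_ge0//.
by apply: le_lt_trans (lebesgue_ocube_lty c t); apply: le_lebesgue_Rd => x [].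
Qed.

Lemma ocubeS (c : V) r r' : (r <= r')%R -> ocube c r `<=` ocube c r'.
Proof. by move=> rr x h i; exact: lt_le_trans (h i) rr. Qed.

Lemma cube_volume_le A c s t : (s <= t)%R ->
  (cube_volume A c s <= cube_volume A c t)%R.
Proof.
move=> st; rewrite -lee_fin -!cube_volumeE; apply: le_lebesgue_Rd.
by apply: setIS; exact: ocubeS.
Qed.

Lemma cube_volume_lipschitz A c s t : (0 <= t)%R -> (s < t)%R ->
  (cube_volume A c t - cube_volume A c s <=
    3 * d%:R * (2 * t) ^+ d.-1 * (t - s))%R.
Proof.
move=> t0 st; rewrite lerBlDr -lee_fin -cube_volumeE EFinD -cube_volumeE addeC.
apply: (@le_trans _ _ (leb ((A `&` ocube c s) `|` (ocube c t `\` ocube c s)))).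
  apply: le_lebesgue_Rd => x [Ax xt].
  by have [xs|xs] := pselect (ocube c s x); [left|right].
apply: le_trans (lebesgue_setU2 _ _) _; apply: leeD => //.
have := @lebesgue_shell c t (t - s) t0; rewrite subKr subr_gt0 => /(_ st).
by move=> /le_trans; apply; rewrite lee_fin le_eqVlt; apply/orP; left;
  apply/eqP; ring.
Qed.

Lemma lipschitz_continuous (f : R -> R) (K a b : R) : (0 <= K)%R ->
  (forall s t, a <= s -> s < t -> t <= b -> `|f t - f s| <= K * (t - s))%R ->
  {within `[a, b], continuous f}.
Proof.
move=> K0 fK; have [ba|ab] := ltP b a.
  by rewrite set_itv_ge ?bnd_simp -?ltNge//; exact: continuous_subspace0.
(* Freezing f outside of [a, b] gives a function that is Lipschitz on the whole line. *)
pose g t := f (Num.max a (Num.min t b)).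
have gK s t : (s <= t)%R -> (`|g t - g s| <= K * (t - s))%R.
  rewrite le_eqVlt => /predU1P[->|st]; first by rewrite !subrr normr0 mulr0.
  rewrite /g; set u := Num.max a (Num.min s b); set v := Num.max a (Num.min t b).
  have uv : (u <= v /\ v - u <= t - s /\ a <= u /\ v <= b)%R.
    rewrite /u /v /Num.max /Num.min; repeat case: ifPn; rewrite -?leNgt; lra.
  have [uv1 [uv2 [au vb]]] := uv.
  have [->|uv3] := eqVneq u v.
    by rewrite subrr normr0 mulr_ge0// subr_ge0 ltW.
  apply: le_trans (fK u v au _ vb) _; first by rewrite lt_neqAle uv3.
  by rewrite ler_wpM2l.
apply: (@subspace_eq_continuous _ _ _ g).
  move=> t /set_mem/=; rewrite in_itv/= => /andP[at_ tb].
  by rewrite /g min_l// max_r.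
apply: continuous_subspaceT => x; apply/cvgrPdist_le => /= e e0.
near=> t.
have xt : (`|x - t| < e / (K + 1))%R.
  by near: t; exists (e / (K + 1))%R => //=; rewrite divr_gt0// ltr_wpDl.
have : (`|g x - g t| <= K * `|x - t|)%R.
  have [tx|xt'] := leP t x.
    by rewrite (ger0_norm (_ : 0 <= x - t)%R) ?subr_ge0//; exact: gK.
  by rewrite distrC [X in (_ <= _ * X)%R]distrC [X in (_ <= _ * X)%R]gtr0_norm ?subr_gt0//;
    apply: gK; exact: ltW.
move=> /le_trans; apply; move: xt; rewrite ltr_pdivlMr ?ltr_wpDl// => xt.
by rewrite mulrC (le_trans _ (ltW xt))// ler_wpM2l// lerDl.
Unshelve. all: by end_near. Qed.

Lemma cube_volume_continuous A c a b : (0 <= a)%R ->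
  {within `[a, b], continuous (cube_volume A c)}.
Proof.
move=> a0; have [ba|ab] := ltP b a.
  by rewrite set_itv_ge ?bnd_simp -?ltNge//; exact: continuous_subspace0.
have b0 : (0 <= b)%R := le_trans a0 ab.
apply: (@lipschitz_continuous _ (3 * d%:R * (2 * b) ^+ d.-1)%R) => [|s t as_ st tb].
  by rewrite !mulr_ge0// exprn_ge0// mulr_ge0.
have t0 : (0 <= t)%R := le_trans a0 (le_trans as_ (ltW st)).
rewrite ger0_norm; last by rewrite subr_ge0 cube_volume_le// ltW.
apply: le_trans (cube_volume_lipschitz _ _ t0 st) _.
rewrite ler_wpM2r ?subr_ge0 ?(ltW st)//.
rewrite ler_wpM2l ?mulr_ge0//.
by rewrite lerXn2r ?nnegrE ?mulr_ge0// ler_wpM2l.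
Qed.

Lemma cube_volume_ivt A c a b v : (0 <= a)%R -> (a <= b)%R ->
  (cube_volume A c a <= v <= cube_volume A c b)%R ->
  exists2 t, (a <= t <= b)%R & cube_volume A c t = v.
Proof.
move=> a0 ab vab; have := @IVT R (cube_volume A c) a b v ab.
move=> /(_ (@cube_volume_continuous _ _ _ _ a0)).
rewrite min_l ?max_r ?cube_volume_le// => /(_ vab)[t].
by rewrite in_itv/= => tab <-; exists t.
Qed.

Lemma cube_volume0 A c : (0 < d)%N -> cube_volume A c 0 = 0%R.
Proof.
move=> d0; rewrite /cube_volume (_ : _ `&` _ = set0) ?lebesgue_Rd0//.
apply/seteqP; split => x //= -[_ /(_ (Ordinal d0))].
by rewrite ltNge normr_ge0.
Qed.

End lebesgue_theory.

Lemma measurable_fun_superlevel (R : realType) disp (T : measurableType disp)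
    (f : T -> R) :
  (forall c, measurable [set x | c < f x]) -> measurable_fun setT f.
Proof.
move=> fm; apply: (measurability _ (RGenOInfty.measurableE R)).
move=> _ [_ [c ->] <-]; rewrite setTI.
rewrite (_ : f @^-1` _ = [set x | c < f x]) //.
by apply/seteqP; split => x /=; rewrite in_itv/= andbT.
Qed.

(** The suprema being nonnegative, neither set is empty; the members being finite, they can be moved
    across the inequality. *)
Lemma ereal_sup_addl (R : realType) (A B : set (\bar R)) (c : \bar R) :
  (forall a, A a -> a \is a fin_num) -> (forall b, B b -> b \is a fin_num) ->
  (0 <= ereal_sup A)%E -> (0 <= ereal_sup B)%E ->
  (forall a b, A a -> B b -> (a + b <= c)%E) ->
  (ereal_sup A + ereal_sup B <= c)%E.
Proof.
move=> fA fB A0 B0 ABc.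
have aB a : A a -> (a + ereal_sup B <= c)%E.
  move=> Aa; rewrite addeC -leeBrDr; last exact: fA.
  apply: ge_ereal_sup => b Bb; rewrite leeBrDr; last exact: fA.
  by rewrite addeC; exact: ABc.
have [Boo|Boo] := eqVneq (ereal_sup B) +oo%E.
  have [A00|/set0P[a Aa]] := eqVneq A set0.
    by move: A0; rewrite A00 ereal_sup0.
  have := aB a Aa; rewrite Boo addey; last first.
    by have := fA a Aa; rewrite fin_numE => /andP[].
  by rewrite leye_eq => /eqP ->; rewrite leey.
have fB' : ereal_sup B \is a fin_num by rewrite ge0_fin_numE// ltey.
rewrite -leeBrDr//; apply: ge_ereal_sup => a Aa; rewrite leeBrDr//; exact: aB.
Qed.

Lemma compact_bigcup_ord (T : topologicalType) n (F : 'I_n -> set T) :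
  (forall i, compact (F i)) -> compact (\bigcup_i F i).
Proof.
elim: n F => [F _|n ih F cF].
  rewrite (_ : \bigcup_i _ = set0); first exact: compact0.
  by apply/seteqP; split => x // -[[]].
rewrite (_ : \bigcup_i _ = F ord0 `|` \bigcup_i F (lift ord0 i)).
  by apply: compactU => //; exact: ih.
apply/seteqP; split => x.
  move=> [i _]; case: (unliftP ord0 i) => [j ->|->] Fx; last by left.
  by right; exists j.
by move=> [F0|[j _ Fj]]; [exists ord0|exists (lift ord0 j)].
Qed.

(** * Fluxes *)

Section lebesgue_integral_test.
Context {R : realType} {d : nat}.
Local Notation V := 'rV[R]_d.
Local Notation leb := (@lebesgue_Rd R d).
Local Notation mu := (@lebesgue_measure_Rd R d).
Local Notation U := (caratheodory_type (@lebesgue_outer R d)).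

Lemma continuous_lebesgue_measurable (f : V -> R) (D : set U) : continuous f ->
  measurable_fun D (f : U -> R).
Proof.
move=> cf; apply: measurable_funTS; apply: measurable_fun_superlevel => c.
by apply: lebesgue_set_open; exact: continuous_open_gt.
Qed.

Lemma test_integrable W (f : V -> R) (E : set V) : lebesgue_set E ->
  test_function W f -> mu.-integrable (E : set U) (EFin \o f).
Proof.
move=> mE tf; have [sf cf _] := tf; have [M M0 fM] := test_bounded tf.
apply: (@integrableS _ _ _ _ setT) => //.
have mS : measurable (supp f : set U).
  by apply: lebesgue_set_closed; exact: closed_closure.
have : mu.-integrable (supp f : set U) (EFin \o f).
  apply: measurable_bounded_integrable => //.
  - exact: (lebesgue_compact_lty cf).
  - exact/continuous_lebesgue_measurable/smooth_continuous.
  - exists M; split; first exact: num_real.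
    by move=> N MN x _ /=; exact: le_trans (fM x) (ltW MN).
rewrite (integrable_mkcond _ mS); congr (integrable _ _ _).
apply/funext => x; rewrite patchE; case: ifPn => //.
by rewrite notin_setE => /notin_supp; rewrite /= => ->.
Qed.

Definition Intg (E : set V) (f : V -> R) : R :=
  \int[mu]_(x in (E : set U)) f x.

Lemma IntgD W W' (f g : V -> R) (E : set V) : lebesgue_set E ->
  test_function W f -> test_function W' g ->
  Intg E (fun x => f x + g x) = Intg E f + Intg E g.
Proof.
by move=> mE tf tg; apply: RintegralD => //; apply: test_integrable; eassumption.
Qed.

Lemma IntgZ W c (f : V -> R) (E : set V) : lebesgue_set E ->
  test_function W f -> Intg E (fun x => c * f x) = c * Intg E f.
Proof.
by move=> mE tf; apply: RintegralZl => //; apply: test_integrable; eassumption.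
Qed.

Lemma Intg_bound W (f : V -> R) (A S : set V) M c : lebesgue_set A ->
  lebesgue_set S -> test_function W f -> (forall x, `|f x| <= M) ->
  (forall x, A x -> f x != 0 -> S x) ->
  (leb (A `&` S) <= c%:E)%E -> `|Intg A f| <= M * c.
Proof.
move=> mA mS tf fM fS ASc.
have M0 : 0 <= M by apply: le_trans (fM 0).
have mAS : lebesgue_set (A `&` S) by exact: lebesgue_setI.
have mAS' : lebesgue_set (A `\` S) by exact: lebesgue_setD.
have iA := test_integrable mA tf.
have -> : Intg A f = Intg (A `&` S) f.
  rewrite {1}/Intg -{1}(setUIDK A S) Rintegral_setU//; last 2 first.
  - by rewrite setUIDK.
  - by apply/disj_setPLR => x [_ Sx] [].
  rewrite [X in _ + X](_ : _ = 0) ?addr0//.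
  rewrite (@eq_Rintegral _ _ _ _ _ (fun=> 0)); last first.
    move=> x /set_mem[Ax nSx]; apply: contrapT => /eqP fx; apply: nSx.
    exact: fS.
  by rewrite Rintegral_cst// mul0r.
have iAS := test_integrable mAS tf.
apply: le_trans (le_normr_Rintegral mAS iAS) _.
have fin : (leb (A `&` S) < +oo)%E by rewrite (le_lt_trans ASc)// ltry.
apply: (@le_trans _ _ (\int[mu]_(x in (A `&` S : set U)) M)).
  apply: le_Rintegral => //.
  - exact: (integrable_norm iAS).
  - apply: measurable_bounded_integrable => //.
    exists M; split; first exact: num_real.
    by move=> N MN x _ /=; rewrite ger0_norm// ltW.
rewrite Rintegral_cst// ler_wpM2l// -lee_fin fineK//.
by rewrite ge0_fin_numE ?lebesgue_Rd_ge0.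
Qed.

(** Hence the flux of a fixed field is continuous for the L^1_loc convergence of sets and ignores
    null sets. *)
Lemma Intg_dist W (f : V -> R) (E E' S : set V) M c : lebesgue_set E ->
  lebesgue_set E' -> lebesgue_set S -> test_function W f ->
  (forall x, `|f x| <= M) -> (forall x, f x != 0 -> S x) ->
  (leb ((E `+` E') `&` S) <= c%:E)%E -> `|Intg E f - Intg E' f| <= M * c.
Proof.
move=> mE mE' mS tf fM fS ESc.
have mEE' : lebesgue_set (E `\` E') by exact: lebesgue_setD.
have mE'E : lebesgue_set (E' `\` E) by exact: lebesgue_setD.
have split_ (A B : set V) : lebesgue_set A -> lebesgue_set B ->
    Intg A f = Intg (A `&` B) f + Intg (A `\` B) f.
  move=> mA mB; rewrite {1}/Intg -{1}(setUIDK A B) Rintegral_setU//.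
  - exact: lebesgue_setI.
  - exact: lebesgue_setD.
  - by rewrite setUIDK; exact: test_integrable tf.
  - by apply/disj_setPLR => x [_ Sx] [].
rewrite (split_ E E')// (split_ E' E)// (setIC E') opprD addrACA subrr add0r.
have fin (A : set V) : (leb (A `&` (S `&` supp f)) < +oo)%E.
  apply: le_lt_trans (lebesgue_compact_lty (_ : compact (supp f))).
    by apply: le_lebesgue_Rd => x [_ []].
  by case: tf.
have mSf : lebesgue_set (S `&` supp f).
  by apply: lebesgue_setI => //; apply: lebesgue_set_closed; exact: closed_closure.
have bnd (A : set V) : lebesgue_set A ->
    `|Intg A f| <= M * fine (leb (A `&` (S `&` supp f))).
  move=> mA; apply: (Intg_bound mA mSf tf fM).
    by move=> x _ fx; split; [exact: fS|exact: subset_closure].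
  by rewrite fineK// ge0_fin_numE ?lebesgue_Rd_ge0.
apply: le_trans (ler_normB _ _) _.
apply: le_trans (lerD (bnd _ mEE') (bnd _ mE'E)) _.
rewrite -mulrDr ler_wpM2l//; first exact: le_trans (fM 0).
rewrite -lee_fin EFinD !fineK ?ge0_fin_numE ?lebesgue_Rd_ge0//.
apply: le_trans ESc; rewrite -[leLHS](@measureU _ _ _ mu) //; last 3 first.
- exact: lebesgue_setI.
- exact: lebesgue_setI.
- by apply/seteqP; split => x //= [[[? ?] _] [[? ?] _]].
apply: le_lebesgue_Rd => x [[EE' [Sx _]]|[EE' [Sx _]]]; split => //.
  by left.
by right.
Qed.

End lebesgue_integral_test.

Section flux.
Context {R : realType} {d : nat}.
Local Notation V := 'rV[R]_d.
Implicit Types (C : set ('I_d -> R)) (W : set V) (phi psi : 'I_d -> V -> R).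

(** The constraint C on the values of fields is kept general: the unit ball leads to the total
    variation, and the segments [seg] to the positive and negative parts of each component.
    Multiplication by a cutoff preserves a constraint that is starshaped about 0. *)
Definition starshaped C :=
  C (fun=> 0) /\ forall (t : R) v, 0 <= t <= 1 -> C v -> C (fun i => t * v i).

Definition field C W phi :=
  (forall i, test_function W (phi i)) /\ forall x, C (fun i => phi i x).

Definition div phi : V -> R := fun x => \sum_i partial i (phi i) x.

Lemma test_sum W n (F : 'I_n -> V -> R) :
  (forall i, test_function W (F i)) -> test_function W (fun x => \sum_i F i x).
Proof.
elim: n F => [F _|n ih F tF].
  rewrite (_ : (fun x => _) = fun=> 0); first exact: test0.
  by apply/funext => x; rewrite big_ord0.
rewrite (_ : (fun x => _) = fun x => F ord0 x + \sum_i F (lift ord0 i) x).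
  by apply: test_add => //; exact: ih.
by apply/funext => x; rewrite big_ord_recl.
Qed.

Lemma test_div W phi : (forall i, test_function W (phi i)) ->
  test_function W (div phi).
Proof. by move=> tphi; apply: test_sum => i; exact: test_partial. Qed.

Lemma partialD i (f g : V -> R) : smooth f -> smooth g ->
  partial i (fun x => f x + g x) = (fun x => partial i f x + partial i g x).
Proof.
move=> sf sg; apply/funext => x; rewrite /partial.
have D := is_deriveD (derivableP (smooth_derivable (i:=i) (x:=x) sf))
  (derivableP (smooth_derivable (i:=i) (x:=x) sg)).
exact: (@derive_val _ _ _ _ _ _ _ D).
Qed.

Lemma partialM i (f g : V -> R) : smooth f -> smooth g ->
  partial i (fun x => f x * g x) =
  (fun x => f x * partial i g x + g x * partial i f x).
Proof.
move=> sf sg; apply/funext => x; rewrite /partial.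
have D := is_deriveM (derivableP (smooth_derivable (i:=i) (x:=x) sf))
  (derivableP (smooth_derivable (i:=i) (x:=x) sg)).
exact: (@derive_val _ _ _ _ _ _ _ D).
Qed.

Lemma partial_cst i c : partial i (fun _ : V => c) = (fun=> 0).
Proof. by apply/funext => x; rewrite /partial derive_cst. Qed.

Lemma partialZ i c (f : V -> R) : smooth f ->
  partial i (fun x => c * f x) = (fun x => c * partial i f x).
Proof.
move=> sf; rewrite partialM//; last exact: smooth_cst.
by apply/funext => x; rewrite partial_cst mulr0 addr0.
Qed.

Lemma divD phi psi : (forall i, smooth (phi i)) -> (forall i, smooth (psi i)) ->
  div (fun i x => phi i x + psi i x) = (fun x => div phi x + div psi x).
Proof.
move=> sp sq; apply/funext => x; rewrite /div -big_split/=.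
by apply: eq_bigr => i _; rewrite partialD.
Qed.

Lemma Intg_divD W W' phi psi E : lebesgue_set E ->
  (forall i, test_function W (phi i)) -> (forall i, test_function W' (psi i)) ->
  Intg E (div (fun i x => phi i x + psi i x)) =
  Intg E (div phi) + Intg E (div psi).
Proof.
move=> mE tp tq; rewrite divD; [|by move=> i; case: (tp i)|by move=> i; case: (tq i)].
by apply: IntgD => //; apply: test_div; eassumption.
Qed.

Definition flux_set C (E W : set V) : set (\bar R) :=
  [set (Intg E (div phi))%:E | phi in field C W].

Definition flux C (E W : set V) : \bar R := ereal_sup (flux_set C E W).

Lemma flux_ub C E W phi : field C W phi ->
  ((Intg E (div phi))%:E <= flux C E W)%E.
Proof. by move=> fp; apply: ereal_sup_ubound; exists phi. Qed.

Lemma flux_le C E W c :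
  (forall phi, field C W phi -> ((Intg E (div phi))%:E <= c)%E) ->
  (flux C E W <= c)%E.
Proof. by move=> h; apply: ge_ereal_sup => _ [phi fp <-]; exact: h. Qed.

Lemma field_sub C W W' phi : field C W phi ->
  (forall i, supp (phi i) `<=` W') -> field C W' phi.
Proof. by move=> [t c] s; split => // i; exact: test_sub (t i) (s i). Qed.

Lemma field_subset C W W' phi : W `<=` W' -> field C W phi -> field C W' phi.
Proof.
move=> WW fp; apply: (field_sub fp) => i.
by have [/(_ i)[_ _ +] _] := fp; move=> /subset_trans; exact.
Qed.

Lemma flux_mono C E W W' : W `<=` W' -> (flux C E W <= flux C E W')%E.
Proof. by move=> WW; apply: flux_le => phi /(field_subset WW); exact: flux_ub. Qed.

Section starshaped_flux.
Variables (C : set ('I_d -> R)) (E : set V).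
Hypotheses (sC : starshaped C) (mE : lebesgue_set E).

Lemma field0 W : field C W (fun _ _ => 0).
Proof. by split => [i|x]; [exact: test0|case: sC]. Qed.

Lemma flux_ge0 W : (0 <= flux C E W)%E.
Proof.
apply: le_trans (flux_ub E (field0 W)); rewrite lee_fin.
rewrite (_ : div _ = fun=> 0); last first.
  by apply/funext => x; rewrite /div big1// => i _; rewrite partial_cst.
by rewrite /Intg Rintegral_cst ?mul0r.
Qed.

Lemma flux_set0 : flux C E set0 = 0%E.
Proof.
apply/eqP; rewrite eq_le flux_ge0 andbT; apply: flux_le => phi [tp _].
rewrite (_ : div phi = fun=> 0) /Intg ?Rintegral_cst ?mul0r//.
apply/funext => x; apply: notin_supp.
by have [_ _ +] := test_div tp; move=> s /s.
Qed.

Lemma field_mull W (chi : V -> R) phi : smooth chi ->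
  (forall x, 0 <= chi x <= 1) -> field C W phi ->
  field C W (fun i x => chi x * phi i x).
Proof.
move=> sc c01 [tp Cp]; split => [i|x]; first exact: test_mull.
by case: sC => _; exact.
Qed.

(* phi = chi phi + (1 - chi) phi, with chi a cutoff for supp phi \ W2 in W1 *)
Lemma flux_subadditive W1 W2 : open W1 -> open W2 ->
  (flux C E (W1 `|` W2) <= flux C E W1 + flux C E W2)%E.
Proof.
move=> o1 o2; apply: flux_le => phi fp; have [tp Cp] := fp.
pose K := \bigcup_(i in [set: 'I_d]) supp (phi i).
have cK : compact K by apply: compact_bigcup_ord => i; case: (tp i).
have cK2 : compact (K `&` ~` W2).
  by apply: compact_closedI => //; rewrite closedC.
have [|chi [Q [[sc cc cW1] c01 oO KO chi1]]] := cutoff cK2 o1.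
  by move=> x [[i _ ix] nx]; have [_ _ /(_ x ix)[]] := tp i.
have sc' : smooth (fun x => 1 + -1 * chi x).
  by apply: smooth_add; [|apply: smooth_mul => //]; exact: smooth_cst.
have f1 : field C W1 (fun i x => chi x * phi i x).
  apply: field_sub (field_mull sc c01 fp) _ => i.
  apply: subset_trans cW1; apply: closureS => x /=.
  by rewrite mulf_eq0 negb_or => /andP[].
have f2 : field C W2 (fun i x => (1 + -1 * chi x) * phi i x).
  apply: field_sub (field_mull sc' _ fp) _ => [x|i].
    by have := c01 x; lra.
  have : closed (supp (phi i) `&` ~` Q).
    by apply: closedI; [exact: closed_closure|rewrite closedC].
  move=> /supp_closed sub x /sub[].
    move=> y; rewrite mulf_eq0 negb_or => /andP[y1 y2].
    split; first exact: subset_closure.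
    by move=> /chi1 c1; move: y1; rewrite c1 mulr1 subrr eqxx.
  move=> px nO; apply: contrapT => nW2; apply: nO; apply: KO; split => //.
  by exists i.
have -> : Intg E (div phi) = Intg E (div (fun i x => chi x * phi i x)) +
    Intg E (div (fun i x => (1 + -1 * chi x) * phi i x)).
  rewrite -(Intg_divD mE f1.1 f2.1); congr (Intg _ (div _)).
  by apply/funext => i; apply/funext => x; ring.
by rewrite EFinD leeD// flux_ub.
Qed.

(** At every point one of two fields supported in disjoint sets vanishes, so their sum still takes
    its values in C. *)
Lemma flux_superadditive W1 W2 : W1 `&` W2 = set0 ->
  (flux C E W1 + flux C E W2 <= flux C E (W1 `|` W2))%E.
Proof.
move=> W120.
suff h phi psi : field C W1 phi -> field C W2 psi ->
   ((Intg E (div phi))%:E + (Intg E (div psi))%:E <= flux C E (W1 `|` W2))%E.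
  apply: ereal_sup_addl => [_ [phi fp <-]|_ [psi fp <-]|||_ _ [phi f1 <-] [psi f2 <-]].
  - by [].
  - by [].
  - exact: flux_ge0.
  - exact: flux_ge0.
  - exact: h.
move=> f1 f2; have f12 : field C (W1 `|` W2) (fun i x => phi i x + psi i x).
  split => [i|x].
    apply: test_add; [apply: (field_subset _ f1).1|apply: (field_subset _ f2).1].
      exact: subsetUl.
    exact: subsetUr.
  have [xW1|xW1] := pselect (W1 x).
    rewrite (_ : (fun i => _) = (fun i => phi i x)); first exact: f1.2.
    apply/funext => i; rewrite [psi i x]notin_supp ?addr0// => xs.
    have : (W1 `&` W2) x by split => //; have [_ _] := f2.1 i; apply.
    by rewrite W120.
  rewrite (_ : (fun i => _) = (fun i => psi i x)); first exact: f2.2.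
  apply/funext => i; rewrite [phi i x]notin_supp ?add0r// => xs.
  by apply: xW1; have [_ _] := f1.1 i; apply.
rewrite -EFinD -(Intg_divD mE f1.1 f2.1); exact: flux_ub f12.
Qed.

(** A field whose integral exceeds c has compact support, hence is admissible for a relatively
    compact neighbourhood of this support. *)
Lemma flux_inner W c : open W -> (c < flux C E W)%E ->
  exists W', [/\ open W', compact (closure W'), closure W' `<=` W &
    (c < flux C E W')%E].
Proof.
move=> oW /ereal_sup_gt[_ [phi fp <-] cphi].
pose K := \bigcup_(i in [set: 'I_d]) supp (phi i).
have cK : compact K by apply: compact_bigcup_ord => i; case: (fp.1 i).
have [x [i _ /(_ _)]|] := cutoff cK oW; first by have [_ _ /(_ x)] := fp.1 i.
move=> chi [Q [[sc cc cW] c01 oO KO chi1]].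
exists Q; have sub : closure Q `<=` supp chi.
  by apply: closureS => x /chi1/= ->; rewrite oner_eq0.
split => //.
- by apply: subclosed_compact cc sub; exact: closed_closure.
- exact: subset_trans cW.
- apply: lt_le_trans cphi _; apply: flux_ub; apply: (field_sub fp) => i.
  by apply: subset_trans KO => x ix; exists i.
Qed.

End starshaped_flux.
End flux.

(** * Measures generated by fluxes *)

Section content.
Context {R : realType} {d : nat}.
Local Notation V := 'rV[R]_d.
Local Notation borel := (g_sigma_algebraType (@open V)).
Variable m0 : set V -> \bar R.
Local Open Scope ereal_scope.

(** The hypotheses of the De Giorgi-Letta criterion. [content_inner] is used twice: its relatively
    compact sets reduce countable unions to finite ones, and they separate an open set from the
    complement of a larger one. *)
Record is_content : Prop := IsContent {
  content0 : m0 set0 = 0 ;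
  content_ge0 : forall W, 0 <= m0 W ;
  le_content : forall W W', W `<=` W' -> m0 W <= m0 W' ;
  content_subadd : forall W W', open W -> open W' ->
    m0 (W `|` W') <= m0 W + m0 W' ;
  content_superadd : forall W W', W `&` W' = set0 ->
    m0 W + m0 W' <= m0 (W `|` W') ;
  content_inner : forall W c, open W -> c < m0 W ->
    exists W', [/\ open W', compact (closure W'), closure W' `<=` W &
      c < m0 W'] }.

Definition outer (A : set V) : \bar R :=
  ereal_inf [set m0 W | W in [set W | open W /\ A `<=` W]].

Hypothesis cm : is_content.

Lemma outer_le A W : open W -> A `<=` W -> outer A <= m0 W.
Proof. by move=> oW AW; apply: ereal_inf_lbound; exists W. Qed.

Lemma outer_open W : open W -> outer W = m0 W.
Proof.
move=> oW; apply/eqP; rewrite eq_le outer_le//=.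
by apply: le_ereal_inf_tmp => _ [W' [_ WW'] <-]; exact: (le_content cm).
Qed.

Lemma outer_ge0 A : 0 <= outer A.
Proof. by apply: le_ereal_inf_tmp => _ [W _ <-]; exact: (content_ge0 cm). Qed.

Lemma outer_set0 : outer set0 = 0.
Proof. by rewrite outer_open ?(content0 cm)//; exact: open0. Qed.

Lemma le_outer : {homo outer : A B / A `<=` B >-> A <= B}.
Proof.
move=> A B AB; apply: le_ereal_inf_tmp => _ [W [oW BW] <-].
by apply: outer_le => //; exact: subset_trans BW.
Qed.

Lemma content_bigcup (W : (set V)^nat) : (forall n, open (W n)) ->
  m0 (\bigcup_n W n) <= \sum_(n <oo) m0 (W n).
Proof.
move=> oW; rewrite leNgt; apply/negP => /(content_inner cm).
have oU : open (\bigcup_n W n) by exact: bigcup_open.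
move=> /(_ oU)[W' [oW' cW' W'W]]; apply/negP; rewrite -leNgt.
move: (cW'); rewrite compact_cover => /(_ nat setT W (fun n _ => oW n) W'W).
move=> [D _ DW'].
pose N := (\max_(n <- finmap.enum_fset D) n).+1.
have W'N : W' `<=` \big[setU/set0]_(n < N) W n.
  move=> x /subset_closure /DW'[n nD Wx].
  rewrite -(bigcup_mkord N W); exists n => //=.
  by rewrite /N ltnS; apply: leq_bigmax_seq.
apply: (@le_trans _ _ (\sum_(n < N) m0 (W n))); last first.
  rewrite -(big_mkord xpredT (fun n => m0 (W n))).
  by apply: nneseries_lim_ge => *; exact: (content_ge0 cm).
apply: le_trans (le_content cm W'N) _.
elim: (N) => [|n ih]; first by rewrite !big_ord0 (content0 cm).
rewrite !big_ord_recr/= (le_trans (content_subadd cm _ _))//.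
- by rewrite -(bigcup_mkord n W); exact: bigcup_open.
- by rewrite leeD2r.
Qed.

Lemma outer_sigma_subadditive : sigma_subadditive outer.
Proof.
move=> A; have [[i ioo]|] := pselect (exists i, outer (A i) = +oo).
  rewrite (eseries_pinfty _ _ ioo) ?leey// => n _.
  by rewrite -ltNye (lt_le_trans _ (outer_ge0 _)).
rewrite -forallNE => Aoo.
suff add2e (e : {posnum R}) :
    outer (\bigcup_n A n) <= \sum_(i <oo) outer (A i) + e%:num%:E.
  by apply/lee_addgt0Pr => _/posnumP[].
rewrite (le_trans _ (epsilon_trick _ _ _))//; last by move=> n; exact: outer_ge0.
have /choice[G PG] : forall n, exists W, [/\ open W, A n `<=` W &
    m0 W <= outer (A n) + (e%:num / (2 ^ n.+1)%:R)%:E].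
  move=> n; have en1 : (0 < e%:num / (2 ^ n.+1)%:R)%R by [].
  have fA : outer (A n) \is a fin_num.
    by rewrite ge0_fin_numE ?outer_ge0// lt_neqAle leey andbT; apply/eqP.
  have [_ [W [oW AW] <-] We] := lb_ereal_inf_adherent en1 fA.
  by exists W; split => //; exact: ltW.
have oG n : open (G n) by case: (PG n).
apply: (@le_trans _ _ (m0 (\bigcup_n G n))).
  apply: outer_le; first exact: bigcup_open.
  by move=> x [n _ Ax]; exists n => //; have [_ + _] := PG n; apply.
apply: le_trans (content_bigcup oG) _.
apply: lee_nneseries => [n _ _|n _]; first exact: (content_ge0 cm).
by case: (PG n).
Qed.

Definition content_outer : {outer_measure set V -> \bar R} :=
  HB.pack outer (isOuterMeasure.Build R V outer
    outer_set0 outer_ge0 le_outer outer_sigma_subadditive).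

(** Let W' approximate W [&] Q from inside. The open set W minus the closure of W' contains X minus
    Q and is disjoint from W', so superadditivity applies to these two. *)
Lemma content_caratheodory (Q : set V) : open Q ->
  caratheodory_measurable content_outer Q.
Proof.
move=> oQ; apply: le_caratheodory_measurable => X /=.
apply: le_ereal_inf_tmp => _ [W [oW XW] <-].
have XQ : outer (X `&` Q) <= m0 (W `&` Q).
  by apply: outer_le; [exact: openI|exact: setSI].
apply: le_trans (leeD2r _ XQ) _.
have XnQ : outer (X `&` ~` Q) <= m0 W.
  by apply: outer_le => // x [/XW].
have [too|too] := eqVneq (outer (X `&` ~` Q)) +oo.
  by move: XnQ; rewrite too leye_eq => /eqP ->; rewrite leey.
have tfin : outer (X `&` ~` Q) \is a fin_num.
  by rewrite ge0_fin_numE ?outer_ge0// ltey.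
rewrite -leeBrDr// leNgt; apply/negP => /(content_inner cm (openI oW oQ)).
move=> [W' [oW' _ W'WQ]]; apply/negP; rewrite -leNgt leeBrDr//.
have oWK : open (W `&` ~` closure W').
  by apply: openI => //; rewrite openC; exact: closed_closure.
apply: (@le_trans _ _ (m0 W' + m0 (W `&` ~` closure W'))).
  apply: leeD2l; apply: outer_le => // x [Xx nQx]; split; first exact: XW.
  by move=> /W'WQ[].
apply: le_trans (content_superadd cm _) _.
  by apply/seteqP; split => x //= [W'x [_ nx]]; apply: nx; exact: subset_closure.
apply: (le_content cm) => // x [|[]//].
by move=> /subset_closure /W'WQ[].
Qed.

Lemma borel_caratheodory (A : set V) : measurable (A : set borel) ->
  caratheodory_measurable content_outer A.
Proof.
move: A; apply: smallest_sub; last exact: content_caratheodory.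
exact: (@sigma_algebra_measurable _ (caratheodory_type content_outer)).
Qed.

Lemma outer_semi_sigma_additive :
  semi_sigma_additive (outer : set borel -> \bar R).
Proof.
move=> F mF tF mUF.
exact: (@caratheodory_measure_sigma_additive _ _ content_outer F
  (fun n => borel_caratheodory (mF n)) tF (borel_caratheodory mUF)).
Qed.

Definition content_measure : {measure set borel -> \bar R} :=
  HB.pack (outer : set borel -> \bar R)
    (isMeasure.Build _ borel R (outer : set borel -> \bar R)
      outer_set0 outer_ge0 outer_semi_sigma_additive).

Lemma content_measureE A : content_measure A = outer A. Proof. by []. Qed.

End content.

Lemma flux_content (R : realType) (d : nat) (C : set ('I_d -> R))
  (E : set 'rV[R]_d) : starshaped C -> lebesgue_set E ->
  is_content (flux C E).
Proof.
move=> sC mE; split.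
- exact: flux_set0.
- exact: flux_ge0.
- exact: flux_mono.
- exact: flux_subadditive.
- exact: flux_superadditive.
- exact: flux_inner.
Qed.

Lemma sum_shift (R : numDomainType) (a : nat -> R) c k :
  (forall j, 0 <= a j <= c) ->
  \sum_(j < k) a j <= c + \sum_(j < k) a j.+1.
Proof.
move=> ac; have [a0 a0c] := andP (ac 0%N).
case: k => [|k]; first by rewrite !big_ord0 addr0 (le_trans a0).
rewrite big_ord_recl lerD// big_ord_recr/= lerDl.
by have /andP[] := ac k.+1.
Qed.

Lemma unit_interval_sub (R : realFieldType) (g h : R) : 0 <= g <= 1 ->
  0 <= h <= 1 -> (g = 0 \/ h = 1) -> 0 <= h + -1 * g <= 1.
Proof. by move=> /andP[? ?] /andP[? ?] [] ->; apply/andP; split; lra. Qed.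

(** Bookkeeping for [riesz_layers]: Lf, LS, Lr are values of L; Is and Is' are the integrals of f
    for [P s] and [P (- s)]; Sj and Tj are the sums of the measures of the levels shifted by j, for
    [P s] and [P (- s)]; p and p' are the masses of [W0]. Each shift costs one mass. *)
Lemma riesz_arith (R : realFieldType) (n s Lf LS Lr Is Is' S0 S1 T0 T1 T2 p p' : R) :
  Lr = 2^-1 * (n * Lf - LS) -> s * Lr <= p -> s * LS <= S0 - T2 ->
  S1 <= n * Is -> n * Is' <= T0 -> S0 <= p + S1 -> T0 <= p' + T1 ->
  T1 <= p' + T2 -> n * (s * Lf - (Is - Is')) <= 3 * p + 2 * p'.
Proof.
move=> Lr_def h1 h2 h3 h4 h5 h6 h7.
have : n * (s * Lf) = 2 * (s * Lr) + s * LS by rewrite Lr_def; field.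
rewrite mulrBr (mulrBr n); lra.
Qed.

Lemma subr_common (R : comPzRingType) (a b c e : R) :
  a + b - (c + e) - (b - e) = a - c.
Proof. ring. Qed.

(** * Staircases and layer-cake sums *)

Section borel_integral.
Context {R : realType} {d : nat}.
Local Notation V := 'rV[R]_d.
Local Notation borel := (g_sigma_algebraType (@open V)).

Lemma borel_open (W : set V) : open W -> measurable (W : set borel).
Proof. by move=> oW; exact: sub_sigma_algebra. Qed.

Lemma borel_closed (W : set V) : closed W -> measurable (W : set borel).
Proof.
move=> cW; rewrite -(setCK W); apply: measurableC.
by apply: borel_open; rewrite openC.
Qed.

Lemma continuous_borel_measurable (f : V -> R) (D : set borel) : continuous f ->
  measurable_fun D (f : borel -> R).
Proof.
move=> cf; apply: measurable_funTS; apply: measurable_fun_superlevel => c.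
by apply: borel_open; exact: continuous_open_gt.
Qed.

Lemma test_integrable_borel (m : {measure set borel -> \bar R}) W (f : V -> R) :
  test_function W f -> (m (supp f) < +oo)%E ->
  m.-integrable setT (EFin \o (f : borel -> R)).
Proof.
move=> tf moo; have [sf cf _] := tf; have [M M0 fM] := test_bounded tf.
have mS : measurable (supp f : set borel).
  by apply: borel_closed; exact: closed_closure.
have : m.-integrable (supp f : set borel) (EFin \o f).
  apply: measurable_bounded_integrable => //.
  - by apply: continuous_borel_measurable; exact: smooth_continuous.
  - exists M; split; first exact: num_real.
    by move=> N MN x _ /=; exact: le_trans (fM x) (ltW MN).
rewrite (integrable_mkcond _ mS); congr (integrable _ _ _).
apply/funext => x; rewrite patchE; case: ifPn => //.
by rewrite notin_setE => /notin_supp; rewrite /= => ->.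
Qed.

Lemma staircase_ge (N : nat) (t : R) : t <= N%:R ->
  t <= \sum_(j < N) ((j%:R < t)%R)%:R.
Proof.
elim: N t => [|N ih] t tN; first by rewrite big_ord0.
rewrite big_ord_recr/=; have [tN'|tN'] := leP t N%:R.
  by rewrite ler_wpDr// ih.
rewrite (eq_bigr (fun=> 1)); last first.
  by move=> j _; rewrite (lt_trans _ tN')// ltr_nat.
by rewrite sumr_const card_ord natr1.
Qed.

Lemma staircase_le (N : nat) (t : R) : 0 <= t ->
  \sum_(j < N) ((j.+1%:R < t)%R)%:R <= t.
Proof.
move=> t0; elim: N => [|N ih]; first by rewrite big_ord0.
rewrite big_ord_recr/=; have [tN|tN] := ltP N.+1%:R t; last by rewrite addr0.
apply: le_trans (ltW tN); rewrite -natr1 lerD2r.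
rewrite -[leRHS]mulr1 mulr_natl -[X in _ <= _ *+ X]card_ord -sumr_const.
by apply: ler_sum => j _; case: ltP.
Qed.

(** The staircase lies between t - 2 and t; the factor 1/2 brings the remainder into [0, 1], the
    range of the functions tested by [seg_ub]. *)
Lemma staircase_step (N : nat) (t : R) : 0 <= t -> t <= N%:R ->
  0 <= 2^-1 * (t + -1 * \sum_(j < N) step (t + - j.+1%:R)) <= 1.
Proof.
move=> t0 tN.
have le_ub : \sum_(j < N) step (t - j.+1%:R) <= t.
  apply: le_trans (staircase_le N t0); apply: ler_sum => j _.
  by case: ltP => tj; [exact: step_le1|rewrite step_eq0// subr_le0].
have le_lb : t - 2 <= \sum_(j < N) step (t - j.+1%:R).
  apply: (@le_trans _ _ (\sum_(j < N) ((j%:R < t - 2)%R)%:R)).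
    by apply: staircase_ge; rewrite (le_trans _ tN)// gerBl.
  apply: ler_sum => j _; case: ltP => tj; last exact: step_ge0.
  by rewrite step_eq1// lerBrDr -natr1; lra.
by apply/andP; split; lra.
Qed.

Definition level (f : V -> R) (n : nat) (j : nat) : set V :=
  [set x | j%:R < n%:R * f x].

Lemma open_level f n j : continuous f -> open (level f n j).
Proof.
move=> cf; apply: (@continuous_open_gt _ V (fun x => n%:R * f x)).
by move=> x; apply: (@continuousM _ _ (cst n%:R)); [exact: cst_continuous|exact: cf].
Qed.

Lemma le_level f n j k : (j <= k)%N -> level f n k `<=` level f n j.
Proof. by move=> jk x; apply: le_lt_trans; rewrite ler_nat. Qed.

Lemma level_supp f n j : level f n j `<=` supp f.
Proof.
move=> x /= nf; apply: subset_closure => /=; apply: contraTneq nf => ->.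
by rewrite mulr0 -leNgt.
Qed.

Lemma layer_cake (m : {measure set borel -> \bar R}) W (f : V -> R) n N :
  test_function W f -> (m (supp f) < +oo)%E -> (forall x, 0 <= f x) ->
  (forall x, n%:R * f x <= N%:R) ->
  \sum_(j < N) fine (m (level f n j.+1)) <= n%:R * \int[m]_x f x
    <= \sum_(j < N) fine (m (level f n j)).
Proof.
move=> tf moo f0 fN; have cf : continuous f by case: tf => /smooth_continuous.
have intf := test_integrable_borel tf moo.
have mL j : measurable (level f n j : set borel) by apply: borel_open; exact: open_level.
have mLfin j : m (level f n j) \is a fin_num.
  rewrite ge0_fin_numE//; apply: le_lt_trans moo; apply: le_measure.
  - by rewrite inE.
  - by rewrite inE; apply: borel_closed; exact: closed_closure.
  - exact: level_supp.
have nfE : (n%:R * \int[m]_x f x)%:E = (\int[m]_x (n%:R * f x)%:E)%E.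
  rewrite EFinM /Rintegral fineK; last exact: integrable_fin_num.
  by rewrite -integralZl.
have sumE k : (\sum_(j < N) m (level f n (j + k)) =
   \int[m]_x (\sum_(j < N) \1_(level f n (j + k)) x)%:E)%E.
  under eq_integral do rewrite -sumEFin.
  rewrite ge0_integral_sum//; last first.
    by move=> j; apply/measurable_EFinP; exact: measurable_indic.
  by apply: eq_bigr => j _; rewrite integral_indic// setIT.
have mnf : measurable_fun setT (fun x : borel => (n%:R * f x)%:E).
  apply/measurable_EFinP/measurable_funM => //.
  exact: continuous_borel_measurable.
have mind k : measurable_fun setT
    (fun x : borel => (\sum_(j < N) \1_(level f n (j + k)) x)%:E : \bar R).
  by apply/measurable_EFinP/measurable_sum => j; exact: measurable_indic.
have indE k x : \1_(level f n k) x = ((k%:R < n%:R * f x)%R)%:R :> R.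
  by rewrite indicE /level; congr (_%:R); congr nat_of_bool; apply/idP/idP;
    rewrite inE.
apply/andP; split; rewrite -lee_fin nfE -sumEFin.
- rewrite (eq_bigr (fun j : 'I_N => m (level f n (j + 1)))); last first.
    by move=> j _; rewrite fineK// addn1.
  rewrite sumE; apply: ge0_le_integral => //.
  + by move=> x _; rewrite lee_fin sumr_ge0.
  + move=> x _; rewrite lee_fin; under eq_bigr do rewrite indE addn1.
    by apply: staircase_le; rewrite mulr_ge0.
- rewrite (eq_bigr (fun j : 'I_N => m (level f n (j + 0)))); last first.
    by move=> j _; rewrite fineK// addn0.
  rewrite sumE; apply: ge0_le_integral => //.
  + by move=> x _; rewrite lee_fin mulr_ge0.
  + move=> x _; rewrite lee_fin; under eq_bigr do rewrite indE addn0.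
    exact: staircase_ge.
Qed.

End borel_integral.

(** * Riesz representation of one component of the derivative *)

Section riesz.
Context {R : realType} {d : nat}.
Local Notation V := 'rV[R]_d.
Local Notation borel := (g_sigma_algebraType (@open V)).

(** For s = 1 and s = -1, the flux under this constraint is the supremum over test functions 0 <= g
    <= 1 of the integral over E of the i-th partial derivative of g, respectively of its
    opposite. *)
Definition seg (s : R) (i : 'I_d) : set ('I_d -> R) :=
  [set v | exists2 t, 0 <= t <= 1 & v = fun j => if j == i then s * t else 0].

Lemma seg_starshaped s i : starshaped (seg s i).
Proof.
split=> [|t _ /andP[t0 t1] [u /andP[u0 u1] ->]].
  by exists 0; [rewrite lexx ler01|apply/funext => j; rewrite mulr0 if_same].
exists (t * u); first by rewrite mulr_ge0//= mulr_ile1.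
by apply/funext => j; case: ifP => _; rewrite ?mulr0// mulrCA.
Qed.

Variables (E : set V) (i : 'I_d).
Hypothesis mE : lebesgue_set E.
(** [L] is minus the distributional derivative of 1_E in the direction i. [P 1] and [P (- 1)] are
    its positive and negative parts, obtained as suprema over functions between 0 and 1. *)
Local Notation L g := (Intg E (partial i g)).
Local Notation P s := (content_measure (flux_content (seg_starshaped s i) mE)).

Lemma Intg_partialD W W' f g : test_function W f -> test_function W' g ->
  L (fun x => f x + g x) = L f + L g.
Proof.
move=> tf tg; rewrite (@partialD _ _ i f g); [|by case: tf|by case: tg].
exact: IntgD mE (test_partial i tf) (test_partial i tg).
Qed.

Lemma Intg_partialZ W c f : test_function W f ->
  L (fun x => c * f x) = c * L f.
Proof.
move=> tf; rewrite (@partialZ _ _ i c f); last by case: tf.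
exact: IntgZ mE (test_partial i tf).
Qed.

Lemma Intg_partial_sum W N (h : 'I_N -> V -> R) :
  (forall j, test_function W (h j)) ->
  L (fun x => \sum_(j < N) h j x) = \sum_(j < N) L (h j).
Proof.
elim: N h => [|N ih] h th.
  rewrite big_ord0 (_ : (fun x => _) = fun=> 0).
    by rewrite partial_cst /Intg Rintegral_cst ?mul0r.
  by apply/funext => x; rewrite big_ord0.
rewrite big_ord_recr/= -(ih (fun j => h (widen_ord (leqnSn N) j)))//.
have tS := test_sum (fun j => th (widen_ord (leqnSn N) j)).
apply: etrans (Intg_partialD tS (th ord_max)).
by congr (Intg _ (partial _ _)); apply/funext => x; rewrite big_ord_recr.
Qed.

Lemma seg_ub s W g : test_function W g -> (forall x, 0 <= g x <= 1) ->
  ((s * L g)%:E <= flux (seg s i) E W)%E.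
Proof.
move=> tg g01.
have fp : field (seg s i) W (fun j x => if j == i then s * g x else 0).
  split => [j|x]; last by exists (g x).
  by case: (j == i); [exact: test_scale|exact: test0].
apply: le_trans (flux_ub E fp); rewrite lee_fin.
rewrite -(IntgZ _ mE (test_partial i tg)) le_eqVlt; apply/orP; left; apply/eqP.
congr Intg; apply/funext => x; rewrite /div (bigD1 i)//= eqxx.
rewrite big1 ?addr0 => [|j /negbTE ->]; last by rewrite partial_cst.
by rewrite partialZ//; case: tg.
Qed.

Lemma seg_le s W c : s * s = 1 ->
  (forall g, test_function W g -> (forall x, 0 <= g x <= 1) ->
    ((s * L g)%:E <= c)%E) ->
  (flux (seg s i) E W <= c)%E.
Proof.
move=> s1 h; apply: flux_le => phi [tp Cp].
have tg := test_scale s (tp i).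
have := h _ tg; rewrite (Intg_partialZ _ (tp i)) mulrA s1 mul1r => h'.
apply: le_trans (h' _) => [|x]; last first.
  have [t t01 /(congr1 (fun f => f i))] := Cp x.
  by rewrite eqxx => ->; rewrite mulrA s1 mul1r.
rewrite lee_fin le_eqVlt; apply/orP; left; apply/eqP; congr Intg.
apply/funext => x; rewrite /div (bigD1 i)//= big1 ?addr0// => j ji.
rewrite (_ : phi j = fun=> 0) ?partial_cst//; apply/funext => y.
by have [t _ /(congr1 (fun f => f j))] := Cp y; rewrite (negbTE ji).
Qed.

(** If g is admissible in W', then h - g is admissible in W, and s L g = s L h + (- s) L (h - g). *)
Lemma seg_sandwich s W W' h : s * s = 1 -> test_function W h ->
  (forall x, 0 <= h x <= 1) -> W' `<=` W -> (forall x, W' x -> h x = 1) ->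
  (flux (seg s i) E W' <= (s * L h)%:E + flux (seg (- s) i) E W)%E.
Proof.
move=> s1 th h01 W'W h1; apply: seg_le => // g tg g01.
have tg' : test_function W g.
  by apply: (test_sub tg); have [_ _ gW'] := tg; exact: subset_trans W'W.
have thg := test_add th (test_scale (-1) tg').
have Lhg : L (fun x => h x + -1 * g x) = L h - L g.
  rewrite (Intg_partialD th (test_scale (-1) tg')) (Intg_partialZ _ tg').
  by rewrite mulN1r.
have := @seg_ub (- s) _ _ thg.
rewrite Lhg => H.
apply: (@le_trans _ _ ((s * L h)%:E + (- s * (L h - L g))%:E)%E).
  by rewrite -EFinD lee_fin mulNr mulrBr opprB addrC subrK.
apply: leeD2l; apply: H => x.
apply: unit_interval_sub => //.
have [g0|g0] := eqVneq (g x) 0; [by left|right; apply: h1].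
by have [_ _] := tg; apply; exact: subset_closure.
Qed.

Lemma archi_le0 (x c : R) : (forall n : nat, n%:R * x <= c) -> x <= 0.
Proof.
move=> h; rewrite leNgt; apply/negP => x0.
have c0 : 0 <= c by have := h 0%N; rewrite mul0r.
have := h (Num.Def.archi_bound (c / x)).
have := archi_boundP (_ : 0 <= c / x); rewrite divr_ge0 ?(ltW x0)// => /(_ isT).
by rewrite ltr_pdivrMr// => /lt_le_trans /[apply]; rewrite ltxx.
Qed.

Section bounded.
Variable W0 : set V.
Hypothesis (oW0 : open W0) (fin : forall s, s * s = 1 -> (flux (seg s i) E W0 < +oo)%E).

Lemma seg_measure_open s W : open W -> P s W = flux (seg s i) E W.
Proof.
move=> oW; rewrite content_measureE outer_open//.
exact: (flux_content (seg_starshaped s i) mE).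
Qed.

(** Write n f = S + 2 r, where S sums functions h_j supported in the level j and equal to 1 on the
    level j + 2. By [seg_sandwich], s L h_j is at most the [P s] measure of the level j minus the
    [P (- s)] measure of the level j + 2. Compared with the layer-cake sums, this leaves an error
    independent of n, which dividing by n removes. *)
Lemma riesz_layers s f : s * s = 1 -> test_function W0 f ->
  (forall x, 0 <= f x) ->
  s * L f <= \int[P s]_x f x - \int[P (- s)]_x f x.
Proof.
move=> s1 tf f0; rewrite -subr_le0.
have [sf cf fW0] := tf; have cof := smooth_continuous sf.
have [M M0 fM] := test_bounded tf.
have Pfin t A : t * t = 1 -> A `<=` W0 -> (P t A < +oo)%E.
  move=> t1 AW; apply: le_lt_trans (fin t1).
  by rewrite -(seg_measure_open t oW0); exact: le_outer.
pose p t := fine (P t W0).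
have s1' : - s * - s = 1 by rewrite mulrNN.
have ple t A : t * t = 1 -> A `<=` W0 -> fine (P t A) <= p t.
  move=> t1 AW; rewrite /p fine_le//; last exact: le_outer.
  - by rewrite ge0_fin_numE// Pfin.
  - by rewrite ge0_fin_numE// Pfin.
apply: (@archi_le0 _ (3 * p s + 2 * p (- s))) => n.
pose N := Num.Def.archi_bound (n%:R * M).
have fN x : n%:R * f x <= N%:R.
  apply: (@le_trans _ _ (n%:R * M)).
    by rewrite ler_wpM2l// (le_trans (ler_norm _)).
  by apply/ltW/archi_boundP; rewrite mulr_ge0// ltW.
have lW0 j : level f n j `<=` W0.
  by apply: subset_trans fW0; exact: level_supp.
have cMf : continuous (fun x : V => n%:R * f x).
  move=> x; apply: (@continuousM _ _ (cst n%:R)); last exact: cof.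
  exact: cst_continuous.
pose h (j : nat) x := step (n%:R * f x + - j.+1%:R).
have th j : test_function (level f n j) (h j).
  have sub : supp (h j) `<=` [set x | j.+1%:R <= n%:R * f x].
    apply: supp_closed; first exact/continuous_closed_ge/cMf.
    move=> x /=; apply: contra_neqT; rewrite -ltNge => nf; apply: step_eq0.
    by rewrite subr_le0 ltW.
  split.
  - apply: smooth_step; apply: smooth_add; last exact: smooth_cst.
    by apply: smooth_mul => //; exact: smooth_cst.
  - apply: subclosed_compact cf _; first exact: closed_closure.
    move=> x /sub nf; apply: (@level_supp _ _ f n j).
    by rewrite /level/= (lt_le_trans _ nf)// ltr_nat.
  - by move=> x /sub nf; rewrite /level/= (lt_le_trans _ nf)// ltr_nat.
have h01 j x : 0 <= h j x <= 1 by rewrite step_ge0 step_le1.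
have hL (j : nat) : s * L (h j) <= fine (P s (level f n j))
    - fine (P (- s) (level f n j.+2)).
  have := seg_sandwich s1' (th j) (h01 j)
    (@le_level _ _ f n j j.+2 (leq_trans (leqnSn j) (leqnSn j.+1))).
  have h1 x : level f n j.+2 x -> h j x = 1.
    by move=> nf; apply: step_eq1; rewrite lerBrDr addrC natr1 ltW.
  move=> /(_ h1); rewrite -!seg_measure_open; [|exact: open_level..].
  rewrite opprK -[P s _]fineK; last by rewrite ge0_fin_numE// Pfin.
  rewrite -[P (- s) _]fineK; last by rewrite ge0_fin_numE// Pfin.
  by rewrite -EFinD lee_fin mulNr addrC lerBrDr lerBrDl.
pose S x := \sum_(j < N) h j x.
have tS : test_function W0 S.
  apply: test_sum => j; apply: test_sub (th j) _.
  by have [_ _ +] := th j; move=> /subset_trans; apply.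
pose r x := 2^-1 * (n%:R * f x + -1 * S x).
have tr : test_function W0 r.
  by apply/test_scale/test_add; exact: test_scale.
have r01 x : 0 <= r x <= 1.
  exact: (staircase_step (mulr_ge0 (ler0n _ n) (f0 x)) (fN x)).
have Lr : s * L r <= p s.
  have := seg_ub s tr r01; rewrite -seg_measure_open//.
  by rewrite -[P s _]fineK ?lee_fin// ge0_fin_numE// Pfin.
have LS : L S = \sum_(j < N) L (h j).
  apply: (@Intg_partial_sum W0) => j; apply: test_sub (th j) _.
  by have [_ _ +] := th j; move=> /subset_trans; apply.
have LrE : L r = 2^-1 * (n%:R * L f - L S).
  have t1 := test_scale n%:R tf; have t2 := test_scale (-1) tS.
  rewrite (Intg_partialZ _ (test_add t1 t2)) (Intg_partialD t1 t2).
  by rewrite (Intg_partialZ _ tf) (Intg_partialZ _ tS) mulN1r.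
have /andP[ps _] : _ <= n%:R * \int[P s]_x f x <= _ :=
  layer_cake tf (Pfin s _ s1 fW0) f0 fN.
have /andP[_ pNs] : _ <= n%:R * \int[P (- s)]_x f x <= _ :=
  layer_cake tf (Pfin (- s) _ s1' fW0) f0 fN.
have Sle : s * L S <= \sum_(j < N) fine (P s (level f n j)) -
    \sum_(j < N) fine (P (- s) (level f n j.+2)).
  by rewrite LS mulr_sumr -sumrB; apply: ler_sum => j _; exact: hL.
have a01 t j : t * t = 1 -> 0 <= fine (P t (level f n j)) <= p t.
  by move=> t1; apply/andP; split; [exact: fine_ge0|exact: ple].
apply: (@riesz_arith _ _ _ _ _ _ _ _ _ _ _
  (\sum_(j < N) fine (P (- s) (level f n j.+1))) _ _ _ LrE Lr Sle ps pNs).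
- exact: (sum_shift _ (fun j => a01 s j s1)).
- exact: (sum_shift _ (fun j => a01 (- s) j s1')).
- exact: (@sum_shift _ (fun j => fine (P (- s) (level f n j.+1))) _ N
    (fun j => a01 (- s) j.+1 s1')).
Qed.

Lemma riesz_ge0 f : test_function W0 f -> (forall x, 0 <= f x) ->
  L f = \int[P 1]_x f x - \int[P (- 1)]_x f x.
Proof.
move=> tf f0; apply/eqP; rewrite eq_le; apply/andP; split.
  by have := riesz_layers (mulr1 1) tf f0; rewrite mul1r.
have := riesz_layers (_ : (-1) * (-1) = 1) tf f0; rewrite mulrNN mulr1.
by move=> /(_ erefl); rewrite opprK mulN1r lerNl opprB.
Qed.

Lemma riesz f : test_function W0 f ->
  L f = \int[P 1]_x f x - \int[P (- 1)]_x f x.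
Proof.
move=> tf; have [sf cf fW0] := tf; have [M M0 fM] := test_bounded tf.
(* As chi = 1 on the support of f, adding M chi makes f nonnegative; the contribution of chi is
   subtracted at the end. *)
have [chi [Q [tchi c01 oQ fQ chi1]]] := cutoff cf oW0 fW0.
have tMc := test_scale M tchi.
have fM0 x : 0 <= f x + M * chi x.
  have [xf|/notin_supp ->] := pselect (supp f x).
    rewrite chi1 ?mulr1; last exact: fQ.
    by rewrite -lerBlDr sub0r; have := fM x; rewrite ler_norml => /andP[].
  by rewrite add0r mulr_ge0 ?(ltW M0)//; have /andP[] := c01 x.
have c0 x : 0 <= chi x by have /andP[] := c01 x.
have supp_fin t g : t * t = 1 -> test_function W0 g -> (P t (supp g) < +oo)%E.
  move=> t1 [_ _ gW]; apply: le_lt_trans (fin t1).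
  by rewrite -(seg_measure_open t oW0); exact: le_outer.
have lin t : t * t = 1 -> \int[P t]_x (f x + M * chi x) =
    \int[P t]_x f x + M * \int[P t]_x chi x.
  move=> t1; rewrite RintegralD//.
  - rewrite RintegralZl//; exact: (test_integrable_borel tchi (supp_fin _ _ t1 tchi)).
  - exact: (test_integrable_borel tf (supp_fin _ _ t1 tf)).
  - exact: (test_integrable_borel tMc (supp_fin _ _ t1 tMc)).
have := riesz_ge0 (test_add tf tMc) fM0.
rewrite (Intg_partialD tf tMc) (Intg_partialZ _ tchi) (riesz_ge0 tchi c0).
rewrite !lin ?mulrNN ?mulr1// mulrBr => /(canRL (addrK _)) ->.
exact: subr_common.
Qed.

End bounded.
End riesz.

(** * Locally finite flux implies locally finite perimeter *)

Section existence.
Context {R : realType} {d : nat}.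
Local Notation V := 'rV[R]_d.
Local Notation borel := (g_sigma_algebraType (@open V)).

Definition unit_ball : set ('I_d -> R) := [set v | \sum_i v i ^+ 2 <= 1].

Lemma unit_ball_starshaped : starshaped unit_ball.
Proof.
split=> [|t v /andP[t0 t1] v1]; rewrite /unit_ball/=.
  by rewrite big1 ?ler01// => i _; rewrite expr0n.
under eq_bigr do rewrite exprMn.
by rewrite -mulr_sumr mulr_ile1 ?exprn_ile1 ?exprn_ge0 ?sumr_ge0// => i _;
  exact: sqr_ge0.
Qed.

Lemma seg_unit_ball s i : s * s = 1 -> seg s i `<=` unit_ball.
Proof.
move=> s1 _ [t /andP[t0 t1] ->]; rewrite /unit_ball/= (bigD1 i)//= eqxx.
rewrite big1 => [|j /negbTE ->]; last by rewrite expr0n.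
by rewrite addr0 exprMn [s ^+ 2]expr2 s1 mul1r exprn_ile1.
Qed.

Lemma flux_le_constraint (C C' : set ('I_d -> R)) (E W : set V) : C `<=` C' ->
  (flux C E W <= flux C' E W)%E.
Proof.
move=> CC'; apply: flux_le => phi [tp Cp]; apply: flux_ub.
by split => // x; exact: CC'.
Qed.

Lemma compact_nbhd (K U : set V) : compact K -> open U -> K `<=` U ->
  exists W, [/\ open W, K `<=` W, compact (closure W) & closure W `<=` U].
Proof.
move=> cK oU KU; have [chi [W [[_ cc cU] _ oW KW chi1]]] := cutoff cK oU KU.
have sub : closure W `<=` supp chi.
  by apply: closureS => x /chi1/= ->; rewrite oner_eq0.
exists W; split => //; last exact: subset_trans cU.
by apply: subclosed_compact cc sub; exact: closed_closure.
Qed.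

(** The total variation of D 1_E as a Borel measure, built from E alone; [perimeterE] identifies it
    with the perimeter on compact sets. *)
Definition variation (E A : set V) : \bar R := outer (flux unit_ball E) A.

Definition locally_finite_flux (U E : set V) := forall W, open W ->
  compact (closure W) -> closure W `<=` U -> (flux unit_ball E W < +oo)%E.

Lemma flux_locally_finite_perimeter (U E : set V) : open U -> lebesgue_set E ->
  locally_finite_flux U E -> locally_finite_perimeter U E.
Proof.
move=> oU mE fE.
pose P s i := content_measure (flux_content (seg_starshaped s i) mE).
have Pfin W i s : open W -> compact (closure W) -> closure W `<=` U ->
    s * s = 1 -> (flux (seg s i) E W < +oo)%E.
  move=> oW cW WU s1; apply: le_lt_trans (fE W oW cW WU).
  exact/flux_le_constraint/seg_unit_ball.
(* D 1_E is minus the functional represented by [P 1 - P (- 1)], hence the exchange of the two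
   parts. *)
exists (VMeasure (P (-1)) (P 1)); split.
  move=> i K cK KU; have [W [oW KW cW WU]] := compact_nbhd cK oU KU.
  have h s : s * s = 1 -> (P s i K < +oo)%E.
    by move=> s1; apply: le_lt_trans (Pfin W i s oW cW WU s1); exact: outer_le.
  by split; apply: h; rewrite ?mulrNN mulr1.
move=> f [sf cf fU] i; have [W [oW fW cW WU]] := compact_nbhd cf oU fU.
have tf : test_function W f by [].
rewrite -[LHS]/(Intg E (partial i f)).
rewrite (riesz mE oW (fun s => @Pfin W i s oW cW WU) tf).
by rewrite /vintegral/= opprB.
Qed.

End existence.

(** * Fluxes and total variations *)

Section regularity.
Context {R : realType} {d : nat}.
Local Notation V := 'rV[R]_d.
Local Notation borel := (g_sigma_algebraType (@open V)).
Variable nu : {measure set borel -> \bar R}.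
Hypothesis nu_fin : (nu setT < +oo)%E.
Local Open Scope ereal_scope.

Lemma le_borel_measure (A B : set V) : measurable (A : set borel) ->
  measurable (B : set borel) -> A `<=` B -> nu A <= nu B.
Proof. by move=> mA mB AB; apply: le_measure; rewrite ?inE. Qed.

Lemma decreasing_measure_lt (F : (set V)^nat) (Z : set V) (e : \bar R) :
  (forall n, measurable (F n : set borel)) -> measurable (Z : set borel) ->
  (forall n, F n.+1 `<=` F n) -> \bigcap_n F n `<=` Z -> nu Z < e ->
  exists n, nu (F n) < e.
Proof.
move=> mF mZ decF FZ Ze.
have F0 : nu (F 0%N) < +oo.
  by apply: le_lt_trans nu_fin; apply: le_borel_measure.
have mI : measurable (\bigcap_n F n : set borel) by exact: bigcap_measurable.
have decF' : nonincreasing_seq (F : nat -> set borel).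
  by apply/nonincreasing_seqP => n; apply/subsetPset; exact: decF.
have /(_ [set x | x < e]) := @nonincreasing_cvg_mu _ _ _ nu _ F0 mF mI decF'.
have : nbhs (nu (\bigcap_n F n)) [set x | x < e].
  apply: open_nbhs_nbhs; split; first exact: open_ereal_lt_ereal.
  by apply: le_lt_trans Ze; exact: le_borel_measure.
move=> /[swap] /[apply] -[n _ /(_ n (leqnn n))] h; by exists n.
Qed.

Definition regular_set (A : set V) : Prop := forall e : R, (0 < e)%R ->
  exists C Q, [/\ closed C, open Q, C `<=` A, A `<=` Q & nu (Q `\` C) < e%:E].

Lemma regular_open (W : set V) : open W -> regular_set W.
Proof.
move=> oW e e0.
pose r n : R := (n.+1%:R^-1)%R.
(* The points at sup distance at least 1 / (n + 1) from the complement of W: closed sets that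
   increase to W. *)
pose F n := [set x | ocube x (r n) `<=` W].
have cF n : closed (F n).
  rewrite -(setCK (F n)) closedC.
  rewrite (_ : ~` F n = \bigcup_(y in ~` W) ocube y (r n)).
    by apply: bigcup_open => y _; exact: open_ocube.
  apply/seteqP; split => [x /existsNP[y /not_implyP[xy Wy]]|x [y Wy xy] h].
    by exists y => // i; rewrite distrC; exact: xy.
  by apply: Wy; apply: h => i; rewrite distrC; exact: xy.
have rS n : (r n.+1 <= r n)%R by rewrite /r lef_pV2 ?posrE// ler_nat.
suff [n nF] : exists n, nu (W `\` F n) < e%:E.
  exists (F n), W; split => //.
  by move=> x; apply => i; rewrite subrr normr0 /r invr_gt0.
apply: (@decreasing_measure_lt (fun n => W `\` F n) set0).
- move=> n; apply: measurableD; first exact: borel_open.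
  exact: borel_closed.
- exact: measurable0.
- move=> n x [Wx nF]; split => // Fx; apply: nF.
  by apply: subset_trans Fx; exact: ocubeS.
- move=> x h; have [Wx _] := h 0%N Logic.I.
  have /nbhs_ccube[s s0 sW] : nbhs x W by move: oW; rewrite openE; apply.
  have [n] : exists n, (r n < s)%R.
    exists (Num.truncn s^-1); rewrite /r invf_plt ?posrE//.
    exact: truncnS_gt.
  move=> rs; have [_ []] := h n Logic.I.
  apply: subset_trans sW; apply: subset_trans (@ocube_ccube _ _ _ _).
  by apply: ocubeS; exact: ltW.
- by rewrite measure0 lte_fin.
Qed.

Lemma regular_setC (A : set V) : regular_set A -> regular_set (~` A).
Proof.
move=> rA e e0; have [C [Q [cC oQ CA AQ QC]]] := rA e e0.
exists (~` Q), (~` C); split.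
- by rewrite closedC.
- by rewrite openC.
- exact: subsetC.
- exact: subsetC.
- by rewrite setDE setCK setIC -setDE.
Qed.

Lemma regular_bigcup (A : (set V)^nat) : (forall n, regular_set (A n)) ->
  regular_set (\bigcup_n A n).
Proof.
move=> rA e e0.
have /choice[C] : forall n, exists C, exists Q, [/\ closed C, open Q, C `<=` A n,
    A n `<=` Q & nu (Q `\` C) < (e / 2 / (2 ^ n.+1)%:R)%:E].
  by move=> n; apply: rA; rewrite !divr_gt0// ltr0n expn_gt0.
move=> /choice[Q /all_and5[cC oQ CA AQ QC]].
have mC n : measurable (C n : set borel) by exact: borel_closed.
have mQ n : measurable (Q n : set borel) by exact: borel_open.
pose K N := \big[setU/set0]_(n < N) C n.
have cK N : closed (K N).
  by rewrite /K; elim/big_ind: _ => //; [exact: closed0|exact: closedU].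
pose W := \bigcup_n Q n.
have oW : open W by exact: bigcup_open.
have small : nu (\bigcup_n (Q n `\` C n)) < e%:E.
  apply: (@le_lt_trans _ _ (\sum_(n <oo) nu (Q n `\` C n))).
    apply: measure_sigma_subadditive => //.
    - by move=> n; exact: measurableD.
    - by apply: bigcupT_measurable => n; exact: measurableD.
  apply: (@le_lt_trans _ _ (\sum_(n <oo) (e / 2 / (2 ^ n.+1)%:R)%:E)).
    by apply: lee_nneseries => // n _; exact: ltW.
  apply: le_lt_trans (epsilon_trick0 xpredT _) _.
    by rewrite divr_ge0// ltW.
  by rewrite lte_fin ltr_pdivrMr// ltr_pMr// ltr1n.
suff [n nK] : exists n, nu (W `\` K n) < e%:E.
  exists (K n), W; split => //.
    move=> x; rewrite /K -(bigcup_mkord n C) => -[k _ Cx].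
    by exists k => //; exact: CA.
  by move=> x [k _ Ax]; exists k => //; exact: AQ.
apply: (@decreasing_measure_lt (fun n => W `\` K n) (\bigcup_n (Q n `\` C n))).
- by move=> n; apply: measurableD; [exact: borel_open|exact: borel_closed].
- by apply: bigcupT_measurable => n; exact: measurableD.
- move=> n x [Wx nK]; split => // Kx; apply: nK.
  by rewrite /K big_ord_recr/=; left.
- move=> x h; have [[n _ Qx] _] := h 0%N Logic.I.
  exists n => //; split => // Cx; have [_] := h n.+1 Logic.I; apply.
  by rewrite /K big_ord_recr/=; right.
- exact: small.
Qed.

Lemma borel_regular (A : set V) : measurable (A : set borel) -> regular_set A.
Proof.
move: A; apply: smallest_sub; last exact: regular_open.
split; first exact/regular_open/open0.
- by move=> A rA; rewrite setTD; exact: regular_setC.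
- exact: regular_bigcup.
Qed.

End regularity.

Section derivative_measure.
Context {R : realType} {d : nat}.
Local Notation V := 'rV[R]_d.
Local Notation borel := (g_sigma_algebraType (@open V)).

(** [msum] expects a sequence indexed by [nat]; indices from d on give the zero measure. *)
Definition nth_measure (P : 'I_d -> {measure set borel -> \bar R}) (k : nat) :
    {measure set borel -> \bar R} :=
  if insub k is Some i then P i else mzero.

Definition total (m : @vmeasure R d) : {measure set borel -> \bar R} :=
  measure_add (msum (nth_measure (pos_part m)) d)
              (msum (nth_measure (neg_part m)) d).

Lemma totalE m A :
  (total m A = \sum_(i < d) pos_part m i A + \sum_(i < d) neg_part m i A)%E.
Proof.
apply: etrans (measure_addE _ _ _) _.
rewrite /msum/=; congr (_ + _)%E; apply: eq_bigr => i _;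
  by rewrite /nth_measure valK.
Qed.

Lemma pos_total m i A : (pos_part m i A <= total m A)%E.
Proof.
rewrite totalE (bigD1 i)//= -addeA leeDl// adde_ge0// sume_ge0//.
Qed.

Lemma neg_total m i A : (neg_part m i A <= total m A)%E.
Proof.
rewrite totalE addeC (bigD1 i)//= -addeA leeDl// adde_ge0// sume_ge0//.
Qed.

Lemma total_fin U m K : radon_on U m -> compact K -> K `<=` U ->
  (total m K < +oo)%E.
Proof.
move=> rm cK KU; rewrite totalE lte_add_pinfty//; apply: lte_sum_pinfty => i _;
  by have [] := rm i K cK KU.
Qed.

End derivative_measure.

Lemma sum_cst_ord (R : realType) n (e : R) :
  \sum_(i < n) (2 * e) = 2 * n%:R * e.
Proof. by rewrite sumr_const card_ord -mulr_natl; ring. Qed.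

(** Cauchy-Schwarz: sum over i the Young inequality for a_i b_i with weight s, the norm of b. *)
Lemma unit_vector_le (R : rcfType) n (a b : 'I_n -> R) : \sum_i a i ^+ 2 <= 1 ->
  \sum_i a i * b i <= Num.sqrt (\sum_i b i ^+ 2).
Proof.
move=> a1; set s := Num.sqrt _; have b0 : 0 <= \sum_i b i ^+ 2.
  by apply: sumr_ge0 => i _; exact: sqr_ge0.
have s2 : s ^+ 2 = \sum_i b i ^+ 2 by rewrite sqr_sqrtr.
have [s0|s0] := eqVneq s 0.
  rewrite s0 big1// => i _; suff -> : b i = 0 by rewrite mulr0.
  move/eqP: s2; rewrite s0 expr0n/= eq_sym psumr_eq0 => [|j _]; last exact: sqr_ge0.
  by move=> /allP/(_ i (mem_index_enum i)); rewrite sqrf_eq0 => /eqP.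
have s_gt0 : 0 < s by rewrite lt_neqAle eq_sym s0 sqrtr_ge0.
have h i : a i * b i <= 2^-1 * s * a i ^+ 2 + 2^-1 * s^-1 * b i ^+ 2.
  have := sqr_ge0 (s * a i - b i); rewrite sqrrB => h.
  rewrite -(ler_pM2r s_gt0).
  have -> : (2^-1 * s * a i ^+ 2 + 2^-1 * s^-1 * b i ^+ 2) * s =
    2^-1 * ((s * a i) ^+ 2 + b i ^+ 2) by field.
  by move: h; rewrite mulrAC -mulrA; lra.
apply: le_trans (ler_sum _ (fun i _ => h i)) _.
rewrite big_split/= -!mulr_sumr -s2.
have -> : 2^-1 * s^-1 * s ^+ 2 = 2^-1 * s by field.
have : 2^-1 * s * (\sum_i a i ^+ 2) <= 2^-1 * s * 1.
  by rewrite ler_wpM2l// mulr_ge0// ltW.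
lra.
Qed.

Lemma unit_ball_le1 (R : realType) d (v : 'I_d -> R) i :
  unit_ball v -> `|v i| <= 1.
Proof.
move=> v1; rewrite -(@ler_pXn2r _ 2)// ?nnegrE// expr1n real_normK ?num_real//.
apply: le_trans v1; rewrite (bigD1 i)//= lerDl.
by apply: sumr_ge0 => j _; exact: sqr_ge0.
Qed.

Lemma dist_between (R : realFieldType) (c q a t e : R) : c <= a <= q ->
  c <= t <= q -> q <= c + e -> `|a - t| <= e.
Proof.
by move=> /andP[? ?] /andP[? ?] ?; rewrite ler_norml; apply/andP; split; lra.
Qed.

Lemma dist_signed_difference (R : realFieldType) (e p q s t eps : R) :
  `|e| <= 1 -> `|p - s| <= eps -> `|q - t| <= eps ->
  e * (p - q) <= e * (s - t) + 2 * eps.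
Proof.
move=> e1 ps qt; rewrite -lerBlDl -mulrBr.
apply: le_trans (ler_norm _) _; rewrite normrM.
have h : `|p - q - (s - t)| <= 2 * eps.
  move: ps qt; rewrite !ler_norml => /andP[? ?] /andP[? ?].
  by apply/andP; split; lra.
by rewrite -[leRHS]mul1r ler_pM.
Qed.

Lemma dist_sub_le (R : realFieldType) (p q sp sq ep eq ep' eq' e : R) :
  `|q - sq| <= eq + e * eq' -> `|p - sp| <= ep + e * ep' ->
  - (p - q) <= sq - sp + (ep + eq + e * (ep' + eq')).
Proof.
by rewrite !ler_norml => /andP[? ?] /andP[? ?]; rewrite mulrDr; lra.
Qed.

(** * Agreement of the flux variation with the variation of the derivative *)

Section variation_derivative.
Context {R : realType} {d : nat}.
Local Notation V := 'rV[R]_d.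
Local Notation borel := (g_sigma_algebraType (@open V)).

Lemma Intg_sum W n (f : 'I_n -> V -> R) (E : set V) : lebesgue_set E ->
  (forall i, test_function W (f i)) ->
  Intg E (fun x => \sum_i f i x) = \sum_i Intg E (f i).
Proof.
move=> mE; elim: n f => [f _|n ih f tf].
  rewrite big_ord0 (_ : (fun x => _) = fun=> 0).
    by rewrite /Intg Rintegral_cst ?mul0r.
  by apply/funext => x; rewrite big_ord0.
rewrite big_ord_recl -(ih (fun i => f (lift ord0 i)))//.
apply: etrans (IntgD mE (tf ord0) (test_sum (fun j => tf (lift ord0 j)))).
by congr Intg; apply/funext => x; rewrite big_ord_recl.
Qed.

Lemma Intg_div W (phi : 'I_d -> V -> R) (E : set V) : lebesgue_set E ->
  (forall i, test_function W (phi i)) ->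
  Intg E (div phi) = \sum_i Intg E (partial i (phi i)).
Proof. by move=> mE tp; apply: (Intg_sum mE) => i; exact: test_partial (tp i). Qed.

Lemma Rintegral_sum disp (T : measurableType disp)
    (nu : {measure set T -> \bar R}) n (f : 'I_n -> T -> R) :
  (forall i, nu.-integrable setT (EFin \o f i)) ->
  nu.-integrable setT (EFin \o (fun x => \sum_i f i x)) /\
  \int[nu]_x (\sum_i f i x) = \sum_i \int[nu]_x f i x.
Proof.
elim: n f => [f _|n ih f intf].
  rewrite big_ord0 (_ : (fun x => _) = fun=> 0); last first.
    by apply/funext => x; rewrite big_ord0.
  by split; [exact: integrable0|rewrite Rintegral_cst ?mul0r].
rewrite (_ : (fun x => _) = (fun x => f ord0 x + \sum_i f (lift ord0 i) x)).
  have [i1 e1] := ih (fun i => f (lift ord0 i)) (fun i => intf _).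
  split; last by rewrite RintegralD// e1 big_ord_recl.
  rewrite (_ : EFin \o _ = ((EFin \o f ord0) \+
    (EFin \o (fun x => (\sum_i f (lift ord0 i) x)%R)))%E)//.
  exact: integrableD.
by apply/funext => x; rewrite big_ord_recl.
Qed.

Lemma integrable_indic_fin disp (T : measurableType disp)
    (nu : {measure set T -> \bar R}) (A : set T) : measurable A ->
  (nu A < +oo)%E -> nu.-integrable setT (EFin \o (\1_A : T -> R)).
Proof.
move=> mA Aoo; apply/integrableP; split.
  by apply/measurable_EFinP; exact: measurable_indic.
rewrite (eq_integral (fun x => (\1_A x)%:E)); last first.
  by move=> x _; rewrite gee0_abs// lee_fin.
by rewrite integral_indic// setIT.
Qed.

Lemma Rintegral_indic disp (T : measurableType disp)
    (nu : {measure set T -> \bar R}) (A : set T) : measurable A ->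
  \int[nu]_x (\1_A x : R) = fine (nu A).
Proof. by move=> mA; rewrite /Rintegral integral_indic// setIT. Qed.

(** On B, g is within eps of the step function with value [c n] on [A n]; on the rest of W the step
    function vanishes and |g| <= 1. *)
Lemma test_simple_approx (nu : {measure set borel -> \bar R}) W g (B : set V)
    M (A : 'I_M -> set V) (c : 'I_M -> R) (eps : R) :
  test_function W g -> open W -> (nu W < +oo)%E -> (forall x, `|g x| <= 1) ->
  measurable (B : set borel) -> (forall n, measurable (A n : set borel)) ->
  (forall n k x, A n x -> A k x -> n = k) -> B = \bigcup_n A n -> B `<=` W ->
  (forall n x, A n x -> `|g x - c n| <= eps) ->
  `|\int[nu]_x g x - \sum_n c n * fine (nu (A n))|
    <= fine (nu (W `\` B)) + eps * fine (nu B).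
Proof.
move=> tg oW Woo g1 mB mA tA BA BW gc.
have mW := borel_open oW.
have fin (X : set V) : measurable (X : set borel) -> X `<=` W -> (nu X < +oo)%E.
  by move=> mX XW; apply: le_lt_trans Woo; exact: le_borel_measure.
have AW n : A n `<=` W by apply: subset_trans BW; rewrite BA => x Ax; exists n.
have ig : nu.-integrable setT (EFin \o (g : borel -> R)).
  apply: (test_integrable_borel tg); apply: fin; last by case: tg.
  by apply: borel_closed; exact: closed_closure.
have iA n : nu.-integrable setT (EFin \o (fun x : borel => c n * \1_(A n) x)).
  rewrite (_ : EFin \o _ = (fun x => (c n)%:E * (\1_(A n) x)%:E)%E)//.
  by apply: integrableZl => //; apply: integrable_indic_fin => //; exact: fin.
have [iS Se] := Rintegral_sum iA.
have -> : \sum_n c n * fine (nu (A n)) =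
    \int[nu]_x (\sum_n c n * \1_(A n) x).
  rewrite Se; apply: eq_bigr => n _.
  rewrite RintegralZl//; first by rewrite Rintegral_indic.
  by apply: integrable_indic_fin => //; exact: fin.
rewrite -RintegralB//.
have iB : nu.-integrable setT (EFin \o (fun x : borel => eps * \1_B x)).
  rewrite (_ : EFin \o _ = (fun x => eps%:E * (\1_B x)%:E)%E)//.
  by apply: integrableZl => //; apply: integrable_indic_fin => //; exact: fin.
have mWB : measurable (W `\` B : set borel) by exact: measurableD.
have iWB : nu.-integrable setT (EFin \o (\1_(W `\` B) : borel -> R)).
  by apply: integrable_indic_fin => //; apply: fin => // x [].
have iD : nu.-integrable setT
    (EFin \o (fun x : borel => g x - \sum_n c n * \1_(A n) x)).
  rewrite (_ : EFin \o _ = ((EFin \o g) \-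
    (EFin \o (fun x : borel => (\sum_n c n * \1_(A n) x)%R)))%E)//.
  exact: integrableB.
apply: le_trans (le_normr_Rintegral measurableT iD) _.
rewrite -(Rintegral_indic nu mWB) -(Rintegral_indic nu mB).
rewrite -RintegralZl//; last by apply: integrable_indic_fin => //; exact: fin.
rewrite -RintegralD//; apply: le_Rintegral => //.
- exact: (integrable_norm iD).
- rewrite (_ : EFin \o _ = ((EFin \o (\1_(W `\` B) : borel -> R)) \+
    (EFin \o (fun x : borel => (eps * \1_B x)%R)))%E)//.
  exact: integrableD.
move=> x _; have [Bx|nBx] := pselect (B x).
  have [n _ Ax] : (\bigcup_n A n) x by rewrite -BA.
  rewrite (bigD1 n)//= big1 => [|k kn]; last first.
    rewrite indicE memNset ?mulr0// => Akx; move/eqP: kn; apply.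
    exact: tA Akx Ax.
  rewrite addr0 !indicE (mem_set Ax) (mem_set Bx) memNset; last by case.
  by rewrite !mulr1 add0r; exact: gc.
rewrite big1 => [|k _]; last first.
  by rewrite indicE memNset ?mulr0// => Akx; apply: nBx; rewrite BA; exists k.
rewrite subr0 !indicE [x \in B]memNset// mulr0 addr0.
have [Wx|nWx] := pselect (W x); first by rewrite mem_set.
rewrite [g x]notin_supp ?normr0//; last by have [_ _ gW] := tg; move=> /gW.
Qed.

Lemma test_between (nu : {measure set borel -> \bar R}) chi (C Q : set V) :
  test_function Q chi -> (forall x, 0 <= chi x <= 1) ->
  (forall x, C x -> chi x = 1) -> measurable (C : set borel) -> open Q ->
  (nu Q < +oo)%E -> (nu C <= (\int[nu]_x chi x)%:E <= nu Q)%E.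
Proof.
move=> tchi c01 chi1 mC oQ Qoo.
have mQ := borel_open oQ.
have suppQ : (nu (supp chi) < +oo)%E.
  apply: le_lt_trans Qoo; apply: le_borel_measure => //; last by case: tchi.
  by apply: borel_closed; exact: closed_closure.
have ichi := test_integrable_borel tchi suppQ.
rewrite /Rintegral fineK; last exact: integrable_fin_num.
have mchi : measurable_fun setT (fun x : borel => (chi x)%:E).
  apply/measurable_EFinP; apply: continuous_borel_measurable.
  by apply: smooth_continuous; case: tchi.
have mind (A : set borel) : measurable A ->
    measurable_fun setT (fun x : borel => (\1_A x : R)%:E).
  by move=> mA; apply/measurable_EFinP; exact: measurable_indic.
have chi0 x : 0 <= chi x by have /andP[] := c01 x.
apply/andP; split.
- rewrite -[X in (nu X <= _)%E](setIT C) -(integral_indic nu measurableT mC).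
  apply: ge0_le_integral => //.
  + exact: mind.
  + move=> x _; rewrite lee_fin indicE.
    have [Cx|nCx] := pselect (C x); first by rewrite mem_set// chi1.
    by rewrite memNset.
- rewrite -[X in (_ <= nu X)%E](setIT Q) -(integral_indic nu measurableT mQ).
  apply: ge0_le_integral => //.
  + by move=> x _; rewrite lee_fin.
  + exact: mind.
  + move=> x _; rewrite lee_fin indicE.
    have [Qx|nQx] := pselect (Q x); first by rewrite mem_set//; have /andP[] := c01 x.
    by rewrite [chi x]notin_supp//; have [_ _ h] := tchi; move=> /h.
Qed.

Variables (U E : set V) (m : @vmeasure R d).
Hypotheses (oU : open U) (mE : lebesgue_set E) (dm : is_derivative U E m).

Lemma Intg_vintegral f i : test_function U f ->
  Intg E (partial i f) = - vintegral m f i.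
Proof. by move=> tf; rewrite /Intg dm.2. Qed.

Lemma flux_fin W : open W -> compact (closure W) -> closure W `<=` U ->
  (flux unit_ball E W < +oo)%E.
Proof.
move=> oW cW WU.
have tW : (total m W < +oo)%E.
  apply: le_lt_trans (total_fin dm.1 cW WU); apply: le_borel_measure.
  - exact: borel_open.
  - by apply: borel_closed; exact: closed_closure.
  - exact: subset_closure.
apply: (@le_lt_trans _ _ (\sum_i (fine (pos_part m i W) + fine (neg_part m i W)))%:E);
  last exact: ltry.
apply: flux_le => phi fp; rewrite lee_fin (Intg_div mE fp.1).
apply: ler_sum => i _; have tU : test_function U (phi i).
  apply: (test_sub (fp.1 i)); have [_ _ h] := fp.1 i.
  by apply: subset_trans h _; apply: subset_trans WU; exact: subset_closure.
rewrite (Intg_vintegral _ tU) /vintegral opprB addrC.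
have phi1 x : `|phi i x| <= 1.
  exact: (unit_ball_le1 i (fp.2 x)).
have bnd (nu : {measure set borel -> \bar R}) : (nu W < +oo)%E ->
    `|\int[nu]_x phi i x| <= fine (nu W).
  (* With no pieces, B empty and eps = 0, the approximation bounds the integral by the mass of W. *)
  move=> Woo; have := @test_simple_approx nu W (phi i) set0 0 (fun=> set0) (fun=> 0) 0
    (fp.1 i) oW Woo phi1.
  rewrite big_ord0 subr0 mul0r addr0 setD0; apply => //.
  by apply/seteqP; split => x // -[].
have b1 := bnd _ (le_lt_trans (pos_total m i W) tW).
have b2 := bnd _ (le_lt_trans (neg_total m i W) tW).
rewrite lerD//; last exact: le_trans (ler_norm _) b2.
by rewrite (le_trans _ b1)// -normrN ler_norm.
Qed.

(** Let v be the value of the derivative on A. The field - (v / |v|) chi, where chi is a cutoff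
    close to 1_A by regularity, is admissible near A, and its flux is close to |v|. The sign
    compensates that of the definition of the derivative. *)
Lemma vvalue_le_variation (A : set V) : measurable (A : set borel) ->
  compact (closure A) -> closure A `<=` U ->
  ((euclidean_norm (vvalue m A))%:E <= variation E A)%E.
Proof.
move=> mA cA AU; have [W0 [oW0 AW0 cW0 W0U]] := compact_nbhd cA oU AU.
have tW0 : (total m W0 < +oo)%E.
  apply: le_lt_trans (total_fin dm.1 cW0 W0U); apply: le_borel_measure.
  - exact: borel_open.
  - by apply: borel_closed; exact: closed_closure.
  - exact: subset_closure.
set v := vvalue m A; set N := euclidean_norm v.
have [N0|N0] := eqVneq N 0.
  by rewrite N0; apply: outer_ge0; exact: flux_content unit_ball_starshaped mE.
pose e i := N^-1 * v 0 i.
have N2 : \sum_i v 0 i ^+ 2 = N ^+ 2.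
  by rewrite sqr_sqrtr// sumr_ge0// => i _; exact: sqr_ge0.
have e1 : \sum_i e i ^+ 2 = 1.
  under eq_bigr do rewrite exprMn.
  by rewrite -mulr_sumr N2 -exprMn mulVf// expr1n.
have eN : \sum_i e i * v 0 i = N.
  under eq_bigr do rewrite -mulrA -expr2.
  by rewrite -mulr_sumr N2 expr2 mulrA mulVf// mul1r.
have [Voo|Voo] := eqVneq (variation E A) +oo%E; first by rewrite Voo leey.
apply/lee_addgt0Pr => eps eps0.
(* One eps' is lost in the choice of [W1], and 2 eps' in each of the d components. *)
pose eps' := eps / (1 + 2 * d%:R).
have eps'0 : 0 < eps' by rewrite divr_gt0// ltr_wpDr// mulr_ge0.
have Vfin : variation E A \is a fin_num.
  rewrite ge0_fin_numE ?ltey// ; apply: outer_ge0.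
  exact: flux_content unit_ball_starshaped mE.
have [_ [W1 [oW1 AW1] <-] W1e] := lb_ereal_inf_adherent eps'0 Vfin.
(* Regularity is proved for finite measures, hence the restriction to the relatively compact
   [W0]. *)
have nu_fin : (mrestr (total m) (borel_open oW0) setT < +oo)%E.
  by rewrite /mrestr setTI.
have [C [Q [cC oQ CA AQ QC]]] := borel_regular nu_fin mA eps'0.
pose Q' := Q `&` (W0 `&` W1).
have oQ' : open Q' by do 2!apply: openI => //.
have AQ' : A `<=` Q'.
  by move=> x Ax; split; [exact: AQ|split; [exact/AW0/subset_closure|exact: AW1]].
have cC' : compact C.
  by apply: subclosed_compact cC cA _; apply: subset_trans CA _; exact: subset_closure.
have [chi [X [tchi c01 oX CX chi1]]] := cutoff cC' oQ' (subset_trans CA AQ').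
have mC : measurable (C : set borel) := borel_closed cC.
have mQ' : measurable (Q' : set borel) := borel_open oQ'.
have close (nu : {measure set borel -> \bar R}) : (forall B, nu B <= total m B)%E ->
    `|fine (nu A) - \int[nu]_x chi x| <= eps'.
  move=> nu_le.
  have Q'oo : (nu Q' < +oo)%E.
    apply: le_lt_trans tW0; apply: le_trans (nu_le _) _.
    by apply: le_borel_measure => //; [exact: borel_open|move=> x [_ []]].
  have fin Y : measurable (Y : set borel) -> Y `<=` Q' -> nu Y \is a fin_num.
    move=> mX XQ; rewrite ge0_fin_numE//; apply: le_lt_trans Q'oo.
    exact: le_borel_measure.
  have := test_between tchi c01 (fun x Cx => chi1 x (CX x Cx)) mC oQ' Q'oo.
  rewrite -{1}(fineK (fin _ mC (subset_trans CA AQ'))) -(fineK (fin _ mQ' _))//.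
  rewrite !lee_fin => between.
  apply: (@dist_between _ (fine (nu C)) (fine (nu Q'))) between _.
    by apply/andP; split; apply: fine_le; rewrite ?fin//;
      [exact: subset_trans AQ'|exact: le_borel_measure|exact: le_borel_measure].
  rewrite -lee_fin EFinD !fineK ?fin//; last exact: subset_trans AQ'.
  have mD : measurable (Q' `\` C : set borel) by exact: measurableD.
  have <- : C `|` (Q' `\` C) = Q'.
    apply/seteqP; split => [x [/CA/AQ'//|[]//]|x Q'x].
    by have [Cx|nCx] := pselect (C x); [left|right].
  rewrite measureU//; last by rewrite setDIK.
  rewrite leeD2l//; apply: le_trans (nu_le _) _; apply: le_trans (ltW QC).
  rewrite /mrestr; apply: le_borel_measure => //.
    apply: measurableI; last exact: borel_open.
    by apply: measurableD => //; exact: borel_open.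
  by move=> x [[Qx [W0x _]] nC].
have fp : field unit_ball Q' (fun i x => - e i * chi x).
  split => [i|x]; first exact: test_scale.
  rewrite /unit_ball/=; under eq_bigr do rewrite exprMn sqrrN.
  have /andP[c0 c1] := c01 x.
  by rewrite -mulr_suml e1 mul1r exprn_ile1.
have := flux_ub E fp; rewrite (Intg_div mE fp.1).
rewrite (eq_bigr (fun i => e i * vintegral m chi i)); last first.
  move=> i _; rewrite (Intg_partialZ _ mE (- e i) tchi) Intg_vintegral ?mulrNN//.
  apply: (test_sub tchi); have [_ _ h] := tchi; apply: subset_trans h _.
  by apply: subset_trans W0U => x [_ [W0x _]]; exact: subset_closure.
move=> fluxQ'.
have NQ : (N%:E <= flux unit_ball E Q' + (2 * d%:R * eps')%:E)%E.
  apply: le_trans (leeD2r _ fluxQ'); rewrite -EFinD lee_fin -eN.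
  have -> : 2 * d%:R * eps' = \sum_(i < d) (2 * eps').
    by rewrite sum_cst_ord.
  rewrite -big_split/=; apply: ler_sum => i _; rewrite /v /vvalue mxE.
  apply: dist_signed_difference; first by apply: unit_ball_le1; rewrite /unit_ball/= e1.
  - exact/close/pos_total.
  - exact/close/neg_total.
apply: le_trans NQ _.
have : (flux unit_ball E Q' <= variation E A + eps'%:E)%E.
  by apply: le_trans (ltW W1e); apply: flux_mono => x [_ []].
move=> /(leeD2r (2 * d%:R * eps')%:E) /le_trans; apply.
rewrite -addeA leeD2l// -EFinD lee_fin /eps' le_eqVlt; apply/orP; left; apply/eqP.
by field; rewrite gt_eqF// ltr_wpDr// mulr_ge0.
Qed.


Lemma sum_fine_total X : total m X \is a fin_num ->
  \sum_i (fine (pos_part m i X) + fine (neg_part m i X)) = fine (total m X).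
Proof.
move=> tX; apply: EFin_inj; rewrite fineK// totalE big_split/= EFinD -!sumEFin.
have tX' : (total m X < +oo)%E by rewrite -ge0_fin_numE.
by congr (_ + _)%E; apply: eq_bigr => i _; rewrite fineK// ge0_fin_numE//;
  apply: le_lt_trans tX'; [exact: pos_total|exact: neg_total].
Qed.

(** Take a field on a neighbourhood W of B with W minus B of small mass, and cut B into finitely
    many Borel pieces on which the field is nearly constant. On each piece Cauchy-Schwarz bounds the
    contribution by the norm of the value of m. *)
Lemma variation_le_vmeasure (B : set V) : compact B -> B `<=` U ->
  (variation E B <= vmeasure_variation U m B)%E.
Proof.
move=> cB BU; have clB : closed B by exact: compact_is_closed.
have mB : measurable (B : set borel) by exact: borel_closed.
have [W0 [oW0 BW0 cW0 W0U]] := compact_nbhd cB oU BU.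
have tW0 : (total m W0 < +oo)%E.
  apply: le_lt_trans (total_fin dm.1 cW0 W0U); apply: le_borel_measure.
  - exact: borel_open.
  - by apply: borel_closed; exact: closed_closure.
  - exact: subset_closure.
have tfin X : measurable (X : set borel) -> X `<=` W0 -> total m X \is a fin_num.
  move=> mX XW; rewrite ge0_fin_numE//; apply: le_lt_trans tW0.
  by apply: le_borel_measure => //; exact: borel_open.
apply/lee_addgt0Pr => eps eps0.
pose tB := fine (total m B).
have tB0 : 0 <= tB by exact: fine_ge0.
(* One eps' comes from W minus B, and eps' times the mass of B from the oscillation of the field on
   the pieces. *)
pose eps' := eps / (1 + tB).
have eps'0 : 0 < eps' by rewrite divr_gt0// ltr_wpDr.
have nu_fin : (mrestr (total m) (borel_open oW0) setT < +oo)%E.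
  by rewrite /mrestr setTI.
have [C [Q [cC oQ CB BQ QC]]] := borel_regular nu_fin mB eps'0.
pose W := Q `&` W0.
have oW : open W by exact: openI.
have BW : B `<=` W by move=> x Bx; split; [exact: BQ|exact: BW0].
have WW0 : W `<=` W0 by move=> x [].
have mWB : measurable (W `\` B : set borel) by apply: measurableD => //; exact: borel_open.
have tWB : fine (total m (W `\` B)) <= eps'.
  rewrite -lee_fin fineK; last by apply: tfin => // x [[]].
  apply: le_trans (ltW QC); rewrite /mrestr; apply: le_borel_measure => //.
    apply: measurableI; last exact: borel_open.
    by apply: measurableD; [exact: borel_open|exact: borel_closed].
  by move=> x [[Qx W0x] nB]; split => //; split => // /CB.
apply: le_trans (@outer_le _ _ (flux unit_ball E) _ _ oW BW) _.
apply: flux_le => phi fp; rewrite (Intg_div mE fp.1).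
have tU i : test_function U (phi i).
  apply: (test_sub (fp.1 i)); have [_ _ h] := fp.1 i.
  apply: subset_trans h _; apply: subset_trans W0U => x [_ W0x].
  exact: subset_closure.
pose near_ x := [set y | forall i, `|phi i y - phi i x| < eps'].
have o_near x : open (near_ x).
  rewrite openE => y h.
  apply: (@filter_forall V _ (fun i z => `|phi i z - phi i x| < eps') (nbhs y)) => i.
  have cf : continuous (fun z : V => `|phi i z - phi i x|).
    have cp : continuous (phi i) by apply: smooth_continuous; case: (fp.1 i).
    move=> z; apply: (@continuous_comp _ _ _ (fun z => phi i z - phi i x) Num.norm).
      by apply: continuousB; [exact: cp|exact: cst_continuous].
    exact: norm_continuous.
  have /(_ y) := @continuous_open_lt R V (fun z => `|phi i z - phi i x|) eps' cf.
  by apply; exact: h.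
move: (cB); rewrite compact_cover => /(_ V B near_ (fun x _ => o_near x)).
case=> [x Bx|D DB BD]; first by exists x => // i; rewrite subrr normr0.
pose l : seq V := finmap.enum_fset D.
pose M := size l.
(* Empty sets complete the finite cover into the sequence that [borel_partition] requires; [seqDU]
   makes it disjoint. *)
pose F n := if (n < M)%N then B `&` near_ (nth 0 l n) else set0.
pose A := seqDU F.
have mF n : measurable (F n : set borel).
  rewrite /F; case: ifP => _; last exact: measurable0.
  by apply: measurableI => //; exact: borel_open.
have mA n : measurable (A n : set borel) by exact: seqDU_measurable.
have AF n : A n `<=` F n by exact: subset_seqDU.
have FB n : F n `<=` B by rewrite /F; case: ifP => // _ x [].
have BA : \bigcup_n A n = B.
  rewrite -seqDU_bigcup_eq; apply/seteqP; split => [x [n _ /FB]//|x Bx].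
  have [y yD xy] := BD x Bx; exists (index y l) => //; rewrite /F.
  by rewrite index_mem (_ : y \in l)// nth_index.
have Abp : borel_partition U B A.
  split => //; first exact: trivIset_seqDU.
  move=> n; have clA : closure (A n) `<=` B.
    by rewrite (iffLR (closure_id B) clB); apply: closureS; exact: subset_trans (FB n).
  split => //; last exact: subset_trans BU.
  by apply: subclosed_compact cB clA; exact: closed_closure.
have le_sum : (\sum_(n < M) (euclidean_norm (vvalue m (A n)))%:E <=
    vmeasure_variation U m B)%E.
  apply: (@le_trans _ _ (\sum_(n <oo) (euclidean_norm (vvalue m (A n)))%:E)%E).
    rewrite -(big_mkord xpredT (fun n => (euclidean_norm (vvalue m (A n)))%:E)).
    by apply: nneseries_lim_ge => n _ _; rewrite lee_fin sqrtr_ge0.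
  by apply: ereal_sup_ubound; exists A.
apply: le_trans (leeD2r _ le_sum).
rewrite [X in (_ <= X + _)%E]sumEFin -EFinD lee_fin.
pose c (i : 'I_d) (n : 'I_M) := phi i (nth 0 l n).
have approx (nu : {measure set borel -> \bar R}) i :
    (forall X, nu X <= total m X)%E ->
  `|\int[nu]_x phi i x - \sum_n c i n * fine (nu (A n))|
    <= fine (nu (W `\` B)) + eps' * fine (nu B).
  move=> nu_le; have Woo : (nu W < +oo)%E.
    apply: le_lt_trans tW0; apply: le_trans (nu_le _) _.
    by apply: le_borel_measure => //; exact: borel_open.
  apply: (test_simple_approx (A := fun n : 'I_M => A n)) (fp.1 i) oW Woo _ _ _ _ _ BW _ => //.
  - by move=> x; exact: (unit_ball_le1 i (fp.2 x)).
  - move=> n k x An Ak; apply/val_inj.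
    by apply: (@trivIset_seqDU _ F n k) => //; exists x.
  - rewrite -BA; apply/seteqP; split => x [n _ Ax]; last by exists n.
    have := AF n _ Ax; rewrite /F; case: ifPn => // nM _.
    by exists (Ordinal nM).
  - move=> n x /AF; rewrite /F ltn_ord => -[_ /(_ i)]; exact: ltW.
have bound i : Intg E (partial i (phi i)) <=
    \sum_n - c i n * vvalue m (A n) 0 i +
    ((fine (pos_part m i (W `\` B)) + fine (neg_part m i (W `\` B))) +
     eps' * (fine (pos_part m i B) + fine (neg_part m i B))).
  rewrite (Intg_vintegral i (tU i)) /vintegral.
  have -> : \sum_n - c i n * vvalue m (A n) 0 i =
      \sum_n c i n * fine (neg_part m i (A n)) -
      \sum_n c i n * fine (pos_part m i (A n)).
    by rewrite -sumrB; apply: eq_bigr => n _; rewrite mxE mulNr mulrBr opprB.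
  have := approx _ i (pos_total m i); have := approx _ i (neg_total m i).
  exact: dist_sub_le.
apply: le_trans (ler_sum _ (fun i _ => bound i)) _.
rewrite big_split/= exchange_big/= lerD//.
  apply: ler_sum => n _; apply: unit_vector_le.
  under eq_bigr do rewrite sqrrN.
  exact: (fp.2 (nth 0 l n)).
rewrite big_split/= -mulr_sumr !sum_fine_total; last 2 first.
- exact: tfin.
- by apply: tfin => // x [[]].
apply: (@le_trans _ _ (eps' + eps' * tB)); first exact: lerD.
rewrite /eps' le_eqVlt; apply/orP; left; apply/eqP.
by field; rewrite gt_eqF// ltr_wpDr.
Qed.

Lemma vmeasure_le_variation (B : set V) : compact B -> B `<=` U ->
  (vmeasure_variation U m B <= variation E B)%E.
Proof.
move=> cB BU; apply: ge_ereal_sup => _ [A [tA AB mA] <-].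
rewrite /variation -AB.
rewrite (_ : outer _ _ = \sum_(n <oo) variation E (A n))%E; last first.
  have := measure_semi_bigcup (content_measure (flux_content unit_ball_starshaped mE)) _ tA.
  rewrite content_measureE => -> //.
  - by move=> n; have [] := mA n.
  - by apply: bigcupT_measurable => n; have [] := mA n.
apply: lee_nneseries => [n _ _|n _]; first by rewrite lee_fin sqrtr_ge0.
by have [? ? ?] := mA n; exact: vvalue_le_variation.
Qed.

End variation_derivative.

Lemma perimeterE (R : realType) (d : nat) (U E B : set 'rV[R]_d) : open U ->
  lebesgue_set E -> locally_finite_perimeter U E -> compact B -> B `<=` U ->
  perimeter U E B = variation E B.
Proof.
move=> oU mE [m0 dm0] cB BU.
have varE m : is_derivative U E m -> vmeasure_variation U m B = variation E B.
  move=> dm; apply/eqP; rewrite eq_le vmeasure_le_variation//=.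
  exact: variation_le_vmeasure.
rewrite /perimeter (_ : [set _ | _ in _] = [set variation E B]).
  exact: ereal_inf1.
apply/seteqP; split=> [_ [m dm <-]|_ ->]; first exact: varE.
by exists m0 => //; exact: varE.
Qed.

(** * Replacing a set inside a cube *)

Section translation.
Context {R : realType} {d : nat}.
Local Notation V := 'rV[R]_d.
Local Notation leb := (@lebesgue_Rd R d).
Local Notation mu := (@lebesgue_measure_Rd R d).
Local Notation U := (caratheodory_type (@lebesgue_outer R d)).

Definition shift_fun (h : V) (f : V -> R) : V -> R := fun x => f (x + h).

Lemma partial_shift h i (f : V -> R) :
  partial i (shift_fun h f) = shift_fun h (partial i f).
Proof.
apply/funext => x; rewrite /partial /shift_fun /derive.
set u := fun _ => _; set w := fun _ => _; suff -> : u = w by [].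
by apply/funext => t; rewrite /u /w /= addrA.
Qed.

Lemma smooth_shift h (f : V -> R) : smooth f -> smooth (shift_fun h f).
Proof.
move=> sf s.
have -> : foldr partial (shift_fun h f) s = shift_fun h (foldr partial f s).
  by elim: s => //= i s ->; rewrite partial_shift.
have [cf df] := sf s; split => [x|i x].
  apply: (@continuous_comp _ _ _ (fun x : V => x + h)); last exact: cf.
  by apply: continuousD; [exact: cvg_id|exact: cst_continuous].
have := df i (x + h); rewrite /derivable.
set u := fun _ => _; set w := fun _ => _; suff -> : u = w by [].
by apply/funext => t; rewrite /u /w /shift_fun /= addrA.
Qed.

Lemma test_shift h W (f : V -> R) : test_function W f ->
  test_function setT (shift_fun h f).
Proof.
move=> [sf cf _]; split => //; first exact: smooth_shift.
have [r r0 fr] := compact_sub_ccube cf.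
apply: (@closed_bounded_compact _ _ _ (- h) r); first exact: closed_closure.
apply: supp_closed; first exact: closed_ccube.
move=> x fx i; have /fr/(_ i) : supp f (x + h) by exact: subset_closure.
by rewrite !mxE subr0 opprK.
Qed.

Lemma shift_measurable (h : V) : measurable_fun setT ((fun x => x + h) : U -> U).
Proof. by move=> _ A mA; rewrite setTI; exact: lebesgue_set_shift. Qed.

Lemma Intg_shift h W (f : V -> R) : test_function W f ->
  Intg setT (shift_fun h f) = Intg setT f.
Proof.
move=> tf; have mT : lebesgue_set (setT : set V) := lebesgue_setT.
congr fine.
have mf : measurable_fun [set: U] (EFin \o (f : U -> R)).
  apply/measurable_EFinP; apply: continuous_lebesgue_measurable.
  by apply: smooth_continuous; case: tf.
have ish : mu.-integrable ((fun x : U => x + h) @^-1` setT)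
    ((EFin \o (f : U -> R)) \o (fun x : U => x + h)).
  exact: (test_integrable mT (test_shift h tf)).
have := integral_pushforward (shift_measurable h) mf ish measurableT.
rewrite preimage_setT.
move=> <-.
refine (@eq_measure_integral _ _ _ _ _ _ _ _) => A mA _.
by rewrite -[RHS](lebesgue_shift h).
Unshelve. exact: shift_measurable.
Qed.

Lemma partial_mvt i (f : V -> R) x t : smooth f -> 0 <= t ->
  exists2 c, 0 <= c <= t & f (x + t *: delta_mx 0 i) - f x =
    t * partial i f (x + c *: delta_mx 0 i).
Proof.
move=> sf t0; pose e : V := delta_mx 0 i.
pose g (s : R) := f (s *: e + x).
have dg (s : R) : is_derive s 1 g (partial i f (s *: e + x)).
  have D : derivable f (s *: e + x) e by exact: smooth_derivable.
  have sE : (fun k : R => f (k *: e + (s *: e + x))) = g \o shift s.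
    by apply/funext => k; rewrite /g /= scalerDl addrA.
  split.
    move/derivable1P : D; rewrite sE => D; apply/derivable1P.
    move: D; rewrite (_ : g \o shift s = fun h => g (h *: 1 + s))//.
    by apply/funext => k /=; rewrite [_ *: 1]mulr1.
  rewrite /partial /derive; set u := fun _ => _; set w := fun _ => _.
  suff -> : u = w by [].
  apply/funext => k; rewrite /u /w /g /=.
  by rewrite scalerDl [k *: 1]mulr1 addrA.
have [|c] := @MVT_segment R g (fun s => partial i f (s *: e + x)) 0 t t0.
  apply: continuous_subspaceT => s.
  by apply/differentiable_continuous/derivable1_diffP; case: (dg s).
rewrite in_itv/= => ct; rewrite /g scale0r add0r subr0 => h.
by exists c => //; rewrite [x + _]addrC [x + _]addrC h mulrC.
Qed.

Lemma partial_lipschitz i (f : V -> R) M x t : smooth f ->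
  (forall y, `|partial i f y| <= M) -> 0 <= t ->
  `|f (x + t *: delta_mx 0 i) - f x| <= M * t.
Proof.
move=> sf fM t0; have [c _ ->] := partial_mvt i x sf t0.
by rewrite normrM ger0_norm// mulrC ler_wpM2r.
Qed.

Lemma ler_norm_shift (y x r : R) : `|y - x| <= 1 -> `|y| <= r -> `|x| <= r + 1.
Proof. by rewrite !ler_norml => /andP[? ?] /andP[? ?]; apply/andP; split; lra. Qed.

Lemma linear_bound_eq0 (x C : R) :
  (forall t, 0 < t -> t <= 1 -> `|x| <= C * t) -> x = 0.
Proof.
move=> h; apply/eqP; rewrite -normr_eq0; apply: contraT => x0.
have xp : 0 < `|x| by rewrite lt_neqAle eq_sym x0 /=.
have C0 : 0 < C by have := h 1 ltr01 (lexx _); rewrite mulr1; apply: lt_le_trans.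
pose t := Num.min 1 (`|x| / (2 * C)).
have t0 : 0 < t by rewrite lt_min ltr01 divr_gt0// mulr_gt0.
have t1 : t <= 1 by rewrite ge_min lexx.
have tx : t <= `|x| / (2 * C) by rewrite ge_min lexx orbT.
have := le_trans (h t t0 t1) (ler_wpM2l (ltW C0) tx).
rewrite (_ : C * _ = `|x| / 2); first by move=> ?; lra.
by field; rewrite gt_eqF.
Qed.

(** By translation invariance the difference quotient q of step t has integral 0. It differs from
    the partial derivative by at most M t, and both vanish outside a fixed cube, enlarged by 1
    because t <= 1. Then t tends to 0. *)
Lemma Intg_partial_setT i W (f : V -> R) : test_function W f ->
  Intg setT (partial i f) = 0.
Proof.
move=> tf; have [sf cf _] := tf.
have mT : lebesgue_set (setT : set V) := lebesgue_setT.
have [M M0 fM] := test_bounded (test_partial i (test_partial i tf)).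
have [r r0 fr] := compact_sub_ccube cf.
pose K : set V := ccube 0 (r + 1).
suff h t : 0 < t -> t <= 1 -> `|Intg setT (partial i f)| <= (M * fine (leb K)) * t.
  exact: linear_bound_eq0 h.
move=> t0 t1.
pose q x := t^-1 * (shift_fun (t *: delta_mx 0 i) f x + -1 * f x).
have tfT : test_function setT f by apply: test_sub tf _.
have tsh := test_shift (t *: delta_mx 0 i) tf.
have tq : test_function setT q by apply: test_scale; apply: test_add => //; exact: test_scale.
have q0 : Intg setT q = 0.
  rewrite (IntgZ _ mT (test_add tsh (test_scale (-1) tfT))).
  rewrite (IntgD mT tsh (test_scale (-1) tfT)) (IntgZ _ mT tfT) (Intg_shift _ tf).
  by rewrite mulN1r subrr mulr0.
have tp := test_partial i tfT.
have -> : Intg setT (partial i f) = Intg setT (fun x => partial i f x + -1 * q x).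
  by rewrite (IntgD mT tp (test_scale (-1) tq)) (IntgZ _ mT tq) q0 mulr0 addr0.
rewrite mulrAC.
have tD := test_add tp (test_scale (-1) tq).
apply: (Intg_bound (S := K) mT _ tD).
- exact/lebesgue_set_closed/closed_ccube.
- move=> x; have [c /andP[c0 ct] cE] := partial_mvt i x sf (ltW t0).
  rewrite /q /shift_fun mulN1r mulN1r cE mulrA mulVf ?gt_eqF// mul1r.
  rewrite distrC; apply: le_trans (partial_lipschitz _ _ fM c0) _.
    exact: smooth_partial.
  by rewrite ler_wpM2l// ltW.
- move=> x _; apply: contra_neqP => nKx.
  have nf (y : V) : (forall j, `|y 0 j - x 0 j| <= 1) -> ~ supp f y.
    move=> yx /fr ry; apply: nKx => j; have := ry j; have := yx j.
    by rewrite !mxE !subr0 => ? ?; apply: ler_norm_shift; eauto.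
  have nx : ~ supp f x by apply: nf => j; rewrite subrr normr0.
  have nxt : ~ supp f (x + t *: delta_mx 0 i).
    apply: nf => j; rewrite !mxE/= [x 0 j + _]addrC addrK.
    rewrite normrM (ger0_norm (ltW t0)) normr_nat mulr_ile1 ?ler0n //; first exact: ltW.
    by rewrite lern1 leq_b1.
  rewrite (notin_supp (contra_not (@supp_partial _ _ i f x) nx)).
  rewrite /q /shift_fun (notin_supp nx) (notin_supp nxt).
  by rewrite !(mulr0, addr0).
- by rewrite setTI fineK// ge0_fin_numE ?lebesgue_Rd_ge0// lebesgue_ccube_lty.
Qed.

Lemma flux_setT (C : set ('I_d -> R)) (W : set V) : starshaped C -> flux C setT W = 0%E.
Proof.
move=> sC; apply/eqP; rewrite eq_le flux_ge0//; last exact: lebesgue_setT.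
rewrite andbT; apply: flux_le => phi [tp _].
rewrite (Intg_div lebesgue_setT tp) big1// => i _.
exact: Intg_partial_setT (tp i).
Qed.

End translation.

Section cube_cutoff.
Context {R : realType} {d : nat}.
Local Notation V := 'rV[R]_d.

Lemma partial_norm_le i (f : V -> R) x K : smooth f ->
  (forall t, `|f (t *: delta_mx 0 i + x) - f x| <= K * `|t|) ->
  `|partial i f x| <= K.
Proof.
move=> sf fK; rewrite leNgt; apply/negP => Kp.
have df : derivable f x (delta_mx 0 i) by exact: smooth_derivable.
have near_gt := @cvgr_norm_gt _ _ _ _ _ _ _ df K Kp.
have [t [/= Kt t0]] := filter_ex (filterI (near_gt _) (nbhs_dnbhs_neq (0 : R))).
have nt : 0 < `|t| by rewrite normr_gt0.
move: Kt; rewrite normrM normfV ltNge => /negP; apply.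
by rewrite ler_pdivrMl// mulrC; exact: fK.
Qed.

Lemma smooth_prod n (F : 'I_n -> V -> R) : (forall i, smooth (F i)) ->
  smooth (fun x => \prod_i F i x).
Proof.
elim: n F => [|n IH] F sF.
  rewrite (_ : (fun x => _) = fun=> 1); first exact: smooth_cst.
  by apply/funext => x; rewrite big_ord0.
rewrite (_ : (fun x => _) = fun x => F ord0 x * \prod_i F (lift ord0 i) x).
  by apply: smooth_mul => //; exact: IH.
by apply/funext => x; rewrite big_ord_recl.
Qed.

End cube_cutoff.

Lemma ler_minl_dist (R : realDomainType) (s t m : R) :
  `|Num.min s m - Num.min t m| <= `|s - t|.
Proof.
have := ler_norm (s - t); have := ler_norm (t - s); rewrite (distrC t).
by rewrite /Num.min; case: ltP => sm; case: ltP => tm ? ?; rewrite ler_norml;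
  apply/andP; split; lra.
Qed.

Lemma splice_arith (R : realFieldType) (M D L e lambda : R) : 0 < e ->
  0 <= lambda ->
  (M + D * (L / e)) * (lambda * e) <= (M * e + (D * L + 1)) * lambda.
Proof.
move=> e0 l0.
have -> : (M + D * (L / e)) * (lambda * e) = (M * e + D * L) * lambda.
  by field; rewrite gt_eqF.
by rewrite ler_wpM2r// lerD2l lerDl.
Qed.

Lemma splice_arith2 (R : realFieldType) (M L e lambda delta h a b t : R) :
  0 < M * lambda + 1 -> 0 < delta -> e <= delta / (M * lambda + 1) ->
  0 < e -> h <= a + b + (M * e + L) * lambda ->
  h + t <= a + (b + t) + (L * lambda + delta).
Proof.
move=> den d0 ed e0 h1.
have : M * lambda * e <= delta.
  by move: ed; rewrite ler_pdivlMr// mulrDr mulr1 => ed; nra.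
by move=> ?; nra.
Qed.

(** * Lipschitz estimates for plateau functions *)

Section window.
Context {R : realType}.

Lemma step_lipschitz :
  exists2 K : R, 0 < K & forall s t, `|step s - step t| <= K * `|s - t|.
Proof.
(* [step] is not compactly supported, but on []-oo, 1]] it agrees with this test function, whose
   derivative is bounded. *)
pose f (x : 'rV[R]_1) := step (x 0 0) * step (2 + -1 * x 0 0).
have sf : smooth f.
  have sx : smooth (fun x : 'rV[R]_1 => x 0 0) by exact/smooth_expr_smooth/se_coord.
  apply: smooth_mul; first exact: smooth_step.
  apply/smooth_step/smooth_add; first exact: smooth_cst.
  by apply: smooth_mul => //; exact: smooth_cst.
have tf : test_function setT f.
  split => //; apply: (@closed_bounded_compact _ _ _ 0 2); first exact: closed_closure.
  apply: supp_closed; first exact: closed_ccube.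
  move=> x fx i; rewrite ord1 mxE subr0; apply: contraTT fx.
  rewrite -ltNge negbK ltr_normr => /orP[x2|x2].
    by rewrite /f (@step_eq0 _ (2 + _)) ?mulr0//; lra.
  by rewrite /f (@step_eq0 _ (x 0 0)) ?mul0r//; lra.
have [M M0 fM] := test_bounded (test_partial 0 tf).
exists M => //.
have mono s t : s <= t -> t <= 1 -> `|step s - step t| <= M * `|s - t|.
  move=> st t1; have := partial_lipschitz (const_mx s) sf fM (t := t - s).
  rewrite subr_ge0 => /(_ st).
  rewrite /f !mxE/= mulr1 addrC subrK.
  rewrite (@step_eq1 _ (2 + -1 * t)) ?(@step_eq1 _ (2 + -1 * s)) ?mulr1; try lra.
  by rewrite distrC => /le_trans; apply; rewrite ler_pM2l// distrC ler_norm.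
have stepE (s : R) : step s = step (Num.min s 1).
  by rewrite /Num.min; case: ltP => // s1; rewrite !step_eq1.
move=> s t; rewrite stepE (stepE t).
apply: (@le_trans _ _ (M * `|Num.min s 1 - Num.min t 1|)).
  have [st|ts] := leP (Num.min s 1) (Num.min t 1).
    by apply: mono => //; rewrite ge_min lexx orbT.
  rewrite distrC (distrC (Num.min s 1)); apply: mono; first exact: ltW.
  by rewrite ge_min lexx orbT.
by rewrite ler_pM2l//; exact: ler_minl_dist.
Qed.

(** The transition takes place for r - e <= |s| <= r - e / 2; the margin e / 2 keeps the supports
    inside the open cube of radius r. *)
Definition window (r e s : R) : R :=
  step (2 / e * (r + -1 * s) + -1) * step (2 / e * (r + s) + -1).

Lemma window01 r e s : 0 <= window r e s <= 1.
Proof.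
rewrite mulr_ge0 ?step_ge0//= mulr_ile1// ?step_ge0// step_le1//.
Qed.

Lemma window_eq1 r e s : 0 < e -> `|s| <= r - e -> window r e s = 1.
Proof.
move=> e0; rewrite ler_norml => /andP[s1 s2].
have aux u : e <= u -> 1 <= 2 / e * u + -1.
  by move=> eu; have : 2 <= 2 / e * u; [rewrite mulrAC ler_pdivlMr//; lra|lra].
by rewrite /window !step_eq1 ?mulr1//; apply: aux; lra.
Qed.

Lemma window_eq0 r e s : 0 < e -> r - e / 2 <= `|s| -> window r e s = 0.
Proof.
move=> e0.
have aux u : u <= e / 2 -> 2 / e * u + -1 <= 0.
  by move=> eu; rewrite subr_le0 mulrAC ler_pdivrMr//; lra.
rewrite ler_normr => /orP[s1|s1]; rewrite /window.
  by rewrite step_eq0 ?mul0r//; apply: aux; lra.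
by rewrite mulrC step_eq0 ?mul0r//; apply: aux; lra.
Qed.

Lemma prod01_dist (a b a' b' A B : R) : 0 <= a' <= 1 -> 0 <= b <= 1 ->
  `|a - a'| <= A -> `|b - b'| <= B -> `|a * b - a' * b'| <= A + B.
Proof.
move=> /andP[a0 a1] /andP[b0 b1] aA bB.
have -> : a * b - a' * b' = (a - a') * b + a' * (b - b') by ring.
apply: le_trans (ler_normD _ _) _; apply: lerD; rewrite normrM.
  by rewrite (ger0_norm b0); apply: le_trans aA; rewrite ler_piMr.
by rewrite (ger0_norm a0); apply: le_trans bB; rewrite ler_piMl.
Qed.

Lemma window_lipschitz : exists2 L : R, 0 < L &
  forall r e s t, 0 < e -> `|window r e s - window r e t| <= L / e * `|s - t|.
Proof.
have [K K0 hK] := step_lipschitz; exists (K * 4); first by rewrite mulr_gt0.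
move=> r e s t e0.
have -> : K * 4 / e * `|s - t| = K * (2 / e * `|s - t|) + K * (2 / e * `|s - t|).
  by field; rewrite gt_eqF.
have e2 : `|2 / e| = 2 / e by rewrite ger0_norm// divr_ge0// ltW.
apply: prod01_dist; rewrite ?step_ge0 ?step_le1//; apply: le_trans (hK _ _) _;
  rewrite ler_pM2l//.
  have -> : 2 / e * (r + -1 * s) + -1 - (2 / e * (r + -1 * t) + -1) =
    2 / e * (t - s) by ring.
  by rewrite normrM e2 distrC.
have -> : 2 / e * (r + s) + -1 - (2 / e * (r + t) + -1) =
    2 / e * (s - t) by ring.
by rewrite normrM e2.
Qed.
End window.

(** * Splicing two sets along the boundary of a cube *)

Section glue.
Context {R : realType} {d : nat}.
Local Notation V := 'rV[R]_d.
Local Notation leb := (@lebesgue_Rd R d).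

Definition cube_cut (c : V) (r e : R) (x : V) : R :=
  \prod_i window r e (x 0 i - c 0 i).

Lemma smooth_cube_cut c r e : smooth (cube_cut c r e).
Proof.
apply: smooth_prod => i.
have sx (a b g : R) : smooth (fun x : V => a * (b + g * (x 0 i + - c 0 i)) + -1).
  apply: smooth_add; last exact: smooth_cst.
  apply: smooth_mul; first exact: smooth_cst.
  apply: smooth_add; first exact: smooth_cst.
  apply: smooth_mul; first exact: smooth_cst.
  by apply: smooth_add; [exact/smooth_expr_smooth/se_coord|exact: smooth_cst].
apply: smooth_mul; first exact/smooth_step/sx.
apply/smooth_step; have := sx (2 / e) r 1.
by congr smooth; apply/funext => x; rewrite mul1r.
Qed.

Lemma cube_cut01 c r e x : 0 <= cube_cut c r e x <= 1.
Proof.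
rewrite /cube_cut numdomain.Num.Theory.prodr_ile1 ?andbT => [|i _]; last exact: window01.
by apply: prodr_ge0 => i _; case/andP: (window01 r e (x 0 i - c 0 i)).
Qed.

Lemma cube_cut_eq1 c r e x : 0 < e -> ccube c (r - e) x -> cube_cut c r e x = 1.
Proof. by move=> e0 cx; rewrite /cube_cut big1// => i _; exact: window_eq1. Qed.

Lemma cube_cut_neq0 c r e x : 0 < e -> cube_cut c r e x != 0 -> ccube c (r - e / 2) x.
Proof.
move=> e0 /prodf_neq0 h i; have := h i isT; apply: contraNT; rewrite -ltNge => /ltW re.
by rewrite window_eq0.
Qed.

Lemma cube_cut_partial : exists2 L : R, 0 < L & forall c r e i x, 0 < e ->
  `|partial i (cube_cut c r e) x| <= L / e.
Proof.
have [L L0 hL] := @window_lipschitz R; exists L => // c r e i x e0.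
apply: partial_norm_le; first exact: smooth_cube_cut.
move=> t; rewrite /cube_cut (bigD1 i)//= [X in _ - X](bigD1 i)//=.
set P := \prod_(j | _) _; set Q := \prod_(j | _) _.
have -> : P = Q.
  apply: eq_bigr => j ji; rewrite !mxE/= (negbTE ji) mulr0 add0r//.
rewrite -mulrBl normrM; apply: (@le_trans _ _ (L / e * `|t| * 1)); last by rewrite mulr1.
have Q0 : 0 <= Q.
  by apply: prodr_ge0 => j _; case/andP: (window01 r e (x 0 j - c 0 j)).
have Q1 : Q <= 1.
  by apply: numdomain.Num.Theory.prodr_ile1 => j _; exact: window01.
apply: ler_pM => //; last by rewrite ger0_norm.
apply: le_trans (hL _ _ _ _ e0) _; rewrite !mxE/= !eqxx/= mulr1.
by rewrite opprB addrA subrK addrK.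
Qed.

Lemma compact_ocube_shrink (K : set V) c r : compact K -> K `<=` ocube c r ->
  exists2 s, s < r & K `<=` ocube c s.
Proof.
move=> cK Kr.
have [K0|/set0P K0] := eqVneq K set0.
  by exists (r - 1); [lra|rewrite K0].
have m_ i : {m | m < r & forall x, K x -> `|x 0 i - c 0 i| <= m}.
  apply: cid2.
  have [|y /set_mem Ky ymax] := @compact_EVT_max _ _ (fun x : V => `|x 0 i - c 0 i|) K K0 cK.
    exact/continuous_subspaceT/continuous_coord_dist.
  exists `|y 0 i - c 0 i|; first exact: Kr.
  by move=> x Kx; apply: ymax; exact/mem_set.
have : \forall s \near r^'-, s < r /\ forall i, s2val (m_ i) < s.
  apply: filterI; first exact: nbhs_left_lt.
  have near_m i : \forall s \near r^'-, s2val (m_ i) < s.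
    exact: nbhs_left_gt (s2valP (m_ i)).
  exact: filter_forall near_m.
move=> /filter_ex[s [sr ms]]; exists s => // x Kx i.
by apply: le_lt_trans (ms i); exact: (s2valP' (m_ i)).
Qed.

Lemma field_ocube_shrink (C : set ('I_d -> R)) (c : V) (r : R) phi : field C (ocube c r) phi ->
  exists2 s, s < r & field C (ocube c s) phi.
Proof.
move=> fp.
have [||s sr hs] := @compact_ocube_shrink (\bigcup_i supp (phi i)) c r.
- by apply: compact_bigcup_ord => i; have [] := fp.1 i.
- by move=> x [i _]; have [_ _] := fp.1 i; apply.
by exists s => //; apply: field_sub fp _ => i x xi; apply: hs; exists i.
Qed.

Lemma divM (chi : V -> R) (phi : 'I_d -> V -> R) : smooth chi ->
  (forall i, smooth (phi i)) ->
  div (fun i x => chi x * phi i x) =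
  (fun x => chi x * div phi x + \sum_i phi i x * partial i chi x).
Proof.
move=> sc sp; apply/funext => x; rewrite /div mulr_sumr -big_split/=.
by apply: eq_bigr => i _; rewrite partialM.
Qed.

Definition splice (Q F G : set V) : set V := (F `&` Q) `|` (G `\` Q).

Lemma splice_in Q F G : splice Q F G `&` Q = F `&` Q.
Proof.
by apply/seteqP; split => x [] // => [[[]|[]]//|Fx Qx]; split => //; left.
Qed.

Lemma splice_out Q F G : splice Q F G `\` Q = G `\` Q.
Proof.
by apply/seteqP; split => x [] // => [[[]|[]]//|Gx Qx]; split => //; right.
Qed.

Lemma lebesgue_set_splice Q F G : lebesgue_set Q -> lebesgue_set F ->
  lebesgue_set G -> lebesgue_set (splice Q F G).
Proof.
by move=> mQ mF mG; apply: lebesgue_setU; [exact: lebesgue_setI|exact: lebesgue_setD].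
Qed.

Lemma div_supp (phi : 'I_d -> V -> R) (S : set V) :
  (forall i, supp (phi i) `<=` S) -> forall x, div phi x != 0 -> S x.
Proof.
move=> pS x; apply: contra_neqP => nS; rewrite /div big1// => i _.
by apply: notin_supp; apply: contra_not nS => /supp_partial; exact: pS.
Qed.

Lemma partial_1sub i (eta : V -> R) x : smooth eta ->
  partial i (fun y => 1 + -1 * eta y) x = -1 * partial i eta x.
Proof.
move=> sh.
have s1 : smooth (fun _ : V => 1 : R) by exact: smooth_cst.
have s2 : smooth (fun y => -1 * eta y) by exact: smooth_mul (smooth_cst _) sh.
by rewrite (partialD _ s1 s2) partial_cst (partialZ _ _ sh) add0r.
Qed.

(** Split phi into psi = eta phi and chi = (1 - eta) phi. On the cube, which contains the support of
    psi, the spliced set is F; off the smaller cube it differs from G only in the part of the shell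
    where F and G differ, of measure at most lambda e. There |div chi| <= M + d L / e, with L the
    constant of [cube_cut_partial]. M depends on phi, but its contribution vanishes with e; the
    constant that remains does not depend on phi. *)
Lemma splice_field : exists2 L : R, 0 < L &
  forall (F G U : set V) c r lambda e0 (phi : 'I_d -> V -> R),
  lebesgue_set F -> lebesgue_set G -> field unit_ball U phi ->
  (forall e, 0 < e -> e <= e0 ->
    (leb ((F `+` G) `&` (ocube c r `\` ocube c (r - e))) <= (lambda * e)%:E)%E) ->
  exists2 M, 0 < M & forall e, 0 < e -> e <= e0 ->
    exists psi chi : 'I_d -> V -> R,
    [/\ field unit_ball (ocube c r) psi, field unit_ball U chi,
      (forall i, supp (chi i) `<=` ~` ocube c (r - e)) &
      Intg (splice (ocube c r) F G) (div phi) <=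
      Intg F (div psi) + Intg G (div chi) + (M * e + L) * lambda].
Proof.
have [L L0 hL] := cube_cut_partial.
exists (d%:R * L + 1); first by rewrite ltr_wpDl// mulr_ge0// ltW.
move=> F G U c r lambda e0 phi mF mG fp hFG.
have sp i : smooth (phi i) by have [] := fp.1 i.
have [M M0 hM] := test_bounded (test_div fp.1).
exists M => // e e_gt0 ee0.
set Q := ocube c r; set H := splice Q F G.
have mQ : lebesgue_set Q by exact/lebesgue_set_open/open_ocube.
have mH : lebesgue_set H by exact: lebesgue_set_splice.
pose eta := cube_cut c r e; have seta : smooth eta by exact: smooth_cube_cut.
pose eta' x := 1 + -1 * eta x.
have seta' : smooth eta'.
  apply: smooth_add; first exact: smooth_cst.
  by apply: smooth_mul => //; exact: smooth_cst.
have eta01 x : 0 <= eta x <= 1 by exact: cube_cut01.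
have eta'01 x : 0 <= eta' x <= 1.
  by have := eta01 x; rewrite /eta' => /andP[? ?]; apply/andP; split; lra.
pose psi i x := eta x * phi i x.
pose chi i x := eta' x * phi i x.
have fpsi : field unit_ball U psi by exact: (field_mull unit_ball_starshaped).
have fchi : field unit_ball U chi by exact: (field_mull unit_ball_starshaped).
have spsi i : supp (psi i) `<=` Q.
  apply: subset_trans (ccube_ocube (r := r - e / 2) _); last by lra.
  apply: supp_closed; first exact: closed_ccube.
  by move=> x; rewrite /psi mulf_eq0 negb_or => /andP[/(cube_cut_neq0 e_gt0)].
have schi i : supp (chi i) `<=` ~` ocube c (r - e).
  apply: supp_closed; first by rewrite -openC setCK; exact: open_ocube.
  move=> x; apply: contra_neqP => /contrapT xr; rewrite /chi /eta' /eta.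
  by rewrite cube_cut_eq1//; [ring|exact: ocube_ccube].
exists psi, chi; split; [exact: field_sub fpsi _|exact: fchi|exact: schi|].
have -> : Intg H (div phi) = Intg H (div psi) + Intg H (div chi).
  rewrite -(Intg_divD mH fpsi.1 fchi.1); congr (Intg H (div _)).
  by apply/funext => i; apply/funext => x; rewrite /psi /chi /eta'; ring.
have psiE : Intg H (div psi) = Intg F (div psi).
  have [B B0 hB] := test_bounded (test_div fpsi.1).
  have := @Intg_dist _ _ _ (div psi) H F Q B 0 mH mF mQ (test_div fpsi.1) hB.
  rewrite mulr0 normr_le0 subr_eq0 => h; apply/eqP/h.
    exact: div_supp.
  have -> : (H `+` F) `&` Q = set0; last by rewrite lebesgue_Rd0.
  rewrite -subset0 => x [[[Hx nF]|[Fx nH]] Qx]; last by apply: nH; left.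
  by case: Hx => -[].
have chiE : `|Intg H (div chi) - Intg G (div chi)| <= (M + d%:R * (L / e)) * (lambda * e).
  apply: (@Intg_dist _ _ _ (div chi) H G (~` ocube c (r - e)) _ _ mH mG _ (test_div fchi.1)).
  - exact/lebesgue_setC/lebesgue_set_open/open_ocube.
  - move=> x; rewrite divM//; apply: le_trans (ler_normD _ _) _; apply: lerD.
      rewrite normrM; apply: le_trans (hM x).
      by have /andP[a0 a1] := eta'01 x; rewrite ger0_norm// ler_piMl.
    apply: le_trans (ler_norm_sum _ _ _) _.
    apply: (@le_trans _ _ (\sum_(i < d) (L / e))); last first.
      by rewrite sumr_const card_ord mulr_natl.
    apply: ler_sum => i _; rewrite normrM.
    rewrite partial_1sub// mulN1r normrN; apply: le_trans (hL c r e i x e_gt0).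
    by rewrite ler_piMl// (unit_ball_le1 i (fp.2 x)).
  - exact: div_supp.
  - apply: le_trans (hFG e e_gt0 ee0); apply: le_lebesgue_Rd => x [[[]|[]] hx nx xe].
      case: hx => -[Fx Qx]; last by [].
      by split => //; left.
    have Qx : Q x by apply: contrapT => nQ; apply: nx; right.
    split => //; right; split => // Fx; apply: nx; left; split => //.
rewrite psiE -addrA lerD2l -lerBlDl; apply: le_trans (ler_norm _) _.
apply: le_trans chiE _.
have lam0 : 0 <= lambda.
  have := hFG e e_gt0 ee0; move=> /(le_trans (lebesgue_Rd_ge0 _)).
  by rewrite lee_fin pmulr_lge0.
exact: splice_arith.
Qed.

Lemma flux_setU_field (G U : set V) c s (chi psi : 'I_d -> V -> R) :
  lebesgue_set G -> ocube c s `<=` U -> field unit_ball U chi ->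
  (forall i, supp (chi i) `<=` ~` ocube c s) ->
  field unit_ball (ocube c s) psi ->
  ((Intg G (div chi) + Intg G (div psi))%:E <= flux unit_ball G U)%E.
Proof.
move=> mG sU fchi schi fpsi; rewrite EFinD.
have WU : (U `\` ocube c s) `|` ocube c s `<=` U by move=> x [[]//|/sU].
apply: le_trans (flux_mono _ _ WU).
apply: le_trans (flux_superadditive unit_ball_starshaped mG _); last first.
  by rewrite setDKI.
apply: leeD; last exact: flux_ub.
apply: flux_ub; apply: (field_sub fchi) => i x xi; split; last exact: schi xi.
by have [_ _] := fchi.1 i; apply.
Qed.

(* The cost of splicing along the boundary of the cube is the integral of
   |grad eta| over the symmetric difference of F and G, for a cutoff eta of
   gradient O(1 / e) in the shell of thickness e. *)
Lemma flux_splice : exists2 L : R, 0 < L &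
  forall (F G U : set V) c r lambda e0,
  lebesgue_set F -> lebesgue_set G -> ocube c r `<=` U -> 0 < e0 ->
  (forall e, 0 < e -> e <= e0 ->
    (leb ((F `+` G) `&` (ocube c r `\` ocube c (r - e))) <= (lambda * e)%:E)%E) ->
  (flux unit_ball (splice (ocube c r) F G) U + flux unit_ball G (ocube c r) <=
   flux unit_ball F (ocube c r) + flux unit_ball G U + (L * lambda)%:E)%E.
Proof.
have [L L0 hL] := splice_field; exists L => //.
move=> F G U c r lambda e0 mF mG QU e0_gt0 hFG.
have mH := lebesgue_set_splice (lebesgue_set_open (@open_ocube _ _ c r)) mF mG.
have lam0 : 0 <= lambda.
  have := hFG e0 e0_gt0 (lexx _); move=> /(le_trans (lebesgue_Rd_ge0 _)).
  by rewrite lee_fin pmulr_lge0.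
apply: ereal_sup_addl.
- by move=> _ [phi _ <-].
- by move=> _ [phi _ <-].
- exact: (flux_ge0 unit_ball_starshaped).
- exact: (flux_ge0 unit_ball_starshaped).
move=> _ _ [phi fphi <-] [tau ftau <-].
have [s sr fs] := field_ocube_shrink ftau.
have [M M0 hM] := hL F G U c r lambda e0 phi mF mG fphi hFG.
apply/lee_addgt0Pr => delta delta0.
(* The bound r - s keeps the support of chi off that of tau, so that both are tested on G at once;
   the last bound makes M e lambda at most delta. *)
pose e := Num.min e0 (Num.min (r - s) (delta / (M * lambda + 1))).
have den : 0 < M * lambda + 1 by rewrite ltr_wpDl// mulr_ge0// ltW.
have e_gt0 : 0 < e by rewrite !lt_min e0_gt0 subr_gt0 sr divr_gt0.
have ee0 : e <= e0 by rewrite ge_min lexx.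
have ers : e <= r - s by rewrite /e !ge_min lexx orbT.
have ed : e <= delta / (M * lambda + 1) by rewrite /e !ge_min lexx !orbT.
have [psi [chi [fpsi fchi schi hH]]] := hM e e_gt0 ee0.
have sre : ocube c s `<=` ocube c (r - e).
  by apply: ocubeS; rewrite lerBrDl -lerBrDr.
have GU : ((Intg G (div chi) + Intg G (div tau))%:E <= flux unit_ball G U)%E.
  apply: (flux_setU_field mG _ fchi _ fs).
    by apply: subset_trans QU; apply: ocubeS; exact: ltW.
  by move=> i; apply: subset_trans (schi i) _; exact: subsetC.
rewrite -[X in (_ <= X)%E]addeA -EFinD.
apply: le_trans (leeD2r _ (leeD (flux_ub F fpsi) GU)).
rewrite -!EFinD lee_fin.
exact: splice_arith2 den delta0 ed e_gt0 hH.
Qed.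

End glue.

(** * Volumes and null sets *)

Section volumes.
Context {R : realType} {d : nat}.
Local Notation V := 'rV[R]_d.
Local Notation leb := (@lebesgue_Rd R d).

Lemma lebesgue_split (A Q : set V) : lebesgue_set Q ->
  leb A = (leb (A `&` Q) + leb (A `\` Q))%E.
Proof. by move=> mQ; rewrite setDE; exact: mQ. Qed.

Lemma lebesgue_le_ae (A B : set V) : leb (A `\` B) = 0%E ->
  (leb A <= leb B)%E.
Proof.
move=> AB; rewrite -[leRHS]adde0 -AB; apply: le_trans (lebesgue_setU2 _ _).
by apply: le_lebesgue_Rd => x Ax; have [Bx|nBx] := pselect (B x); [left|right].
Qed.

Lemma lebesgue_eq0_sub (A B : set V) : A `<=` B -> leb B = 0%E -> leb A = 0%E.
Proof.
move=> AB B0; apply/eqP; rewrite eq_le lebesgue_Rd_ge0 andbT -B0.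
exact: le_lebesgue_Rd.
Qed.

Lemma lebesgue_eq0_setU (A B : set V) : leb A = 0%E -> leb B = 0%E ->
  leb (A `|` B) = 0%E.
Proof.
move=> A0 B0; apply/eqP; rewrite eq_le lebesgue_Rd_ge0 andbT.
by apply: le_trans (lebesgue_setU2 _ _) _; rewrite A0 B0 adde0.
Qed.

(* Junk value 0 when A & K has infinite measure. *)
Definition volume (K A : set V) : R := fine (leb (A `&` K)).

Lemma volume_ge0 K A : 0 <= volume K A.
Proof. by rewrite fine_ge0// lebesgue_Rd_ge0. Qed.

Lemma volumeE K A : (leb K < +oo)%E -> leb (A `&` K) = (volume K A)%:E.
Proof.
move=> Koo; rewrite fineK// ge0_fin_numE ?lebesgue_Rd_ge0//.
by apply: le_lt_trans Koo; apply: le_lebesgue_Rd; exact: subIsetr.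
Qed.

Lemma volume_set0 K : volume K set0 = 0.
Proof. by rewrite /volume set0I lebesgue_Rd0. Qed.

Lemma volume_split K Q A : (leb K < +oo)%E -> lebesgue_set Q -> Q `<=` K ->
  volume K A = volume Q A + volume K (A `\` Q).
Proof.
move=> Koo mQ QK; apply: EFin_inj; rewrite EFinD -!volumeE//; last first.
  by apply: le_lt_trans Koo; exact: le_lebesgue_Rd.
rewrite (lebesgue_split (A `&` K) mQ) -setIA (setIidr QK); congr (_ + leb _)%E.
by rewrite !setDE setIAC.
Qed.

Lemma volume_splice K Q F G : (leb K < +oo)%E -> lebesgue_set Q -> Q `<=` K ->
  volume K (splice Q F G) = volume K G - volume Q G + volume Q F.
Proof.
move=> Koo mQ QK.
rewrite (volume_split (splice Q F G) Koo mQ QK) (volume_split G Koo mQ QK).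
rewrite splice_out addrC [X in _ = X - _ + _]addrC addrK; congr (_ + _).
by rewrite /volume splice_in.
Qed.

Lemma volume_le K A B : (leb K < +oo)%E -> leb ((A `\` B) `&` K) = 0%E ->
  volume K A <= volume K B.
Proof.
move=> Koo AB; rewrite -lee_fin -!volumeE//; apply: lebesgue_le_ae.
rewrite -AB; congr leb; apply/seteqP; split => x [] [] //=.
  by move=> Ax Kx /not_andP[|].
by move=> Ax nB Kx; split => // -[].
Qed.

Lemma volume_sub K A B : (leb K < +oo)%E -> A `<=` B -> volume K A <= volume K B.
Proof.
move=> Koo AB; rewrite -lee_fin -!volumeE//; apply: le_lebesgue_Rd.
exact: setSI.
Qed.

Lemma volume_dist K A B : (leb K < +oo)%E ->
  `|volume K A - volume K B| <= volume K (A `+` B).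
Proof.
move=> Koo.
have h (X Y : set V) : volume K X <= volume K Y + volume K (X `+` Y).
  rewrite -lee_fin EFinD -!volumeE//; apply: le_trans (lebesgue_setU2 _ _).
  apply: le_lebesgue_Rd => x [Xx Kx].
  by have [Yx|nYx] := pselect (Y x); [left|right; split => //; left].
rewrite ler_norml lerBlDl h andbT lerNl opprB lerBlDl setYC.
exact: h.
Qed.

Lemma volume_mono K K' A : (leb K' < +oo)%E -> K `<=` K' ->
  volume K A <= volume K' A.
Proof.
move=> Koo KK'; have Ko : (leb K < +oo)%E.
  by apply: le_lt_trans Koo; exact: le_lebesgue_Rd.
by rewrite -lee_fin -!volumeE//; apply: le_lebesgue_Rd; exact: setIS.
Qed.

End volumes.

Section flux_sets.
Context {R : realType} {d : nat}.
Local Notation V := 'rV[R]_d.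
Local Notation leb := (@lebesgue_Rd R d).
Local Notation fl := (@flux R d unit_ball).

Lemma Intg_ae (E E' W : set V) (f : V -> R) : lebesgue_set E ->
  lebesgue_set E' -> lebesgue_set W -> leb ((E `+` E') `&` W) = 0%E ->
  test_function W f -> Intg E f = Intg E' f.
Proof.
move=> mE mE' mW EE' tf; have [M _ fM] := test_bounded tf.
have := @Intg_dist _ _ _ f E E' W M 0 mE mE' mW tf fM.
rewrite mulr0 normr_le0 subr_eq0 EE' => h; apply/eqP/h => // x fx.
by have [_ _] := tf; apply; exact: subset_closure.
Qed.

Lemma flux_ae_le C (E E' W : set V) : lebesgue_set E -> lebesgue_set E' ->
  lebesgue_set W -> leb ((E `+` E') `&` W) = 0%E ->
  (flux C E W <= flux C E' W)%E.
Proof.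
move=> mE mE' mW EE'; apply: flux_le => phi fp.
by rewrite (Intg_ae mE mE' mW EE' (test_div fp.1)); exact: flux_ub.
Qed.

Lemma flux_ae C (E E' W : set V) : lebesgue_set E -> lebesgue_set E' ->
  lebesgue_set W -> leb ((E `+` E') `&` W) = 0%E -> flux C E W = flux C E' W.
Proof.
move=> mE mE' mW EE'; apply/eqP; rewrite eq_le !flux_ae_le// setYC//.
Qed.

Lemma flux_setU (A B W : set V) : lebesgue_set A -> lebesgue_set B ->
  lebesgue_set W -> leb (A `&` B `&` W) = 0%E ->
  (fl (A `|` B) W <= fl A W + fl B W)%E.
Proof.
move=> mA mB mW AB; have mBA := lebesgue_setD mB mA.
apply: flux_le => phi fp; have tp := test_div fp.1.
have -> : Intg (A `|` B) (div phi) = Intg A (div phi) + Intg B (div phi).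
  rewrite -(Intg_ae mBA mB mW _ tp); last first.
    apply: lebesgue_eq0_sub AB => x [[[[Bx nA] nB]|[Bx nBA]] Wx]; first by [].
    by split => //; split => //; apply: contrapT => nA; apply: nBA.
  have {1}-> : A `|` B = A `|` (B `\` A).
    apply/seteqP; split => x [Ax|]; try by left.
      by move=> Bx; have [Ax|nAx] := pselect (A x); [left|right].
    by move=> [Bx _]; right.
  rewrite /Intg Rintegral_setU//.
    by apply: test_integrable tp; exact: lebesgue_setU.
  by apply/disj_setPLR => x Ax [].
by rewrite EFinD; apply: leeD; exact: flux_ub.
Qed.

Lemma flux_set0l (W : set V) : fl set0 W = 0%E.
Proof.
apply/eqP; rewrite eq_le (flux_ge0 unit_ball_starshaped) ?andbT//; last first.
  exact: lebesgue_set0.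
by apply: flux_le => phi _; rewrite /Intg Rintegral_set0.
Qed.

Definition splice_const : R := sval (cid2 (@flux_splice R d)).

Lemma splice_const_gt0 : 0 < splice_const.
Proof. exact: (s2valP (cid2 (@flux_splice R d))). Qed.

Lemma flux_spliceE (F G U : set V) c r lambda e0 :
  lebesgue_set F -> lebesgue_set G -> ocube c r `<=` U -> 0 < e0 ->
  (forall e, 0 < e -> e <= e0 ->
    (leb ((F `+` G) `&` (ocube c r `\` ocube c (r - e))) <= (lambda * e)%:E)%E) ->
  (fl (splice (ocube c r) F G) U + fl G (ocube c r) <=
   fl F (ocube c r) + fl G U + (splice_const * lambda)%:E)%E.
Proof. exact: (s2valP' (cid2 (@flux_splice R d))). Qed.

(** The cost of splicing arbitrary sets along the boundary of a cube: the whole shell is counted,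
    and [lebesgue_shell] gives the value of lambda. *)
Definition cube_cost (r : R) : R :=
  splice_const * (3 * d%:R * (2 * r) ^+ d.-1).

Lemma cube_cost_ge0 r : 0 <= r -> 0 <= cube_cost r.
Proof.
move=> r0; rewrite mulr_ge0 ?(ltW splice_const_gt0)//.
by rewrite mulr_ge0 ?exprn_ge0 ?mulr_ge0.
Qed.

Lemma cube_cost_le r s : 0 <= r -> r <= s -> cube_cost r <= cube_cost s.
Proof.
move=> r0 rs; rewrite ler_wpM2l ?(ltW splice_const_gt0)// ler_wpM2l ?mulr_ge0//.
by rewrite lerXn2r ?nnegrE ?mulr_ge0 ?ler_wpM2l//; exact: le_trans rs.
Qed.

Lemma cube_cost_small (e : R) : (2 <= d)%N -> 0 < e ->
  exists2 r, 0 < r & cube_cost r <= e.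
Proof.
move=> d2 e0; pose A := splice_const * (3 * d%:R) * 2 + 1.
have A0 : 0 < A.
  by rewrite ltr_wpDl// !mulr_ge0 ?(ltW splice_const_gt0).
(* As d >= 2 the exponent d - 1 is positive, so 2 r <= 1 bounds the power by 2 r. *)
pose r := Num.min 2^-1 (e / A).
have r0 : 0 < r by rewrite lt_min invr_gt0 ltr0n divr_gt0.
exists r => //.
have r1 : 2 * r <= 1 by rewrite -ler_pdivlMl// mulr1 ge_min lexx.
have rA : r * A <= e by rewrite -ler_pdivlMr// ge_min lexx orbT.
apply: le_trans rA.
have -> : cube_cost r = splice_const * (3 * d%:R) * (2 * r) ^+ d.-1.
  by rewrite /cube_cost !mulrA.
apply: (@le_trans _ _ (splice_const * (3 * d%:R) * (2 * r))).
  rewrite ler_wpM2l ?mulr_ge0 ?(ltW splice_const_gt0)//.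
  have -> : d.-1 = d.-2.+1 by case: (d) d2 => // -[].
  rewrite exprS; apply: ler_piMr; first by rewrite mulr_ge0// ltW.
  by apply: exprn_ile1 => //; rewrite mulr_ge0// ltW.
rewrite [leLHS]mulrA [r * _]mulrC; apply: ler_wpM2r; first exact: ltW.
by rewrite /A lerDl.
Qed.

Lemma flux_splice_cube (F G U : set V) c r : lebesgue_set F ->
  lebesgue_set G -> ocube c r `<=` U -> 0 <= r ->
  (fl (splice (ocube c r) F G) U + fl G (ocube c r) <=
   fl F (ocube c r) + fl G U + (cube_cost r)%:E)%E.
Proof.
move=> mF mG QU r0; apply: (@flux_spliceE _ _ _ _ _ _ 1) => // e e0 _.
rewrite mulrAC; apply: le_trans (lebesgue_shell c r0 e0).
by apply: le_lebesgue_Rd; exact: subIsetr.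
Qed.

Lemma lfp_flux_fin (U E W : set V) : open U -> lebesgue_set E ->
  locally_finite_perimeter U E -> open W -> compact (closure W) ->
  closure W `<=` U -> (fl E W < +oo)%E.
Proof. by move=> oU mE [m dm] oW cW WU; exact: (flux_fin mE dm oW cW WU). Qed.

Lemma closure_ocube (c : V) r : closure (ocube c r) `<=` ccube c r.
Proof.
rewrite (iffLR (closure_id _) (@closed_ccube _ _ c r)).
exact/closureS/ocube_ccube.
Qed.

Lemma compact_closure_ocube (c : V) r : compact (closure (ocube c r)).
Proof.
apply: subclosed_compact (@compact_ccube _ _ c r) (@closure_ocube c r).
exact: closed_closure.
Qed.

Lemma lfp_splice (U F G : set V) c r : open U -> lebesgue_set F ->
  lebesgue_set G -> locally_finite_perimeter U G ->
  (fl F (ocube c r) < +oo)%E -> 0 <= r -> ccube c r `<=` U ->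
  locally_finite_perimeter U (splice (ocube c r) F G).
Proof.
move=> oU mF mG fG fF r0 cU.
have mQ : lebesgue_set (ocube c r) by exact/lebesgue_set_open/open_ocube.
apply: flux_locally_finite_perimeter => //; first exact: lebesgue_set_splice.
(* The splicing estimate is made in an open set that contains the cube, hence the enlargement of
   W. *)
move=> W oW cW WU; pose W' := W `|` ocube c r.
have oW' : open W' by apply: openU => //; exact: open_ocube.
have WW' : W `<=` W' by exact: subsetUl.
apply: le_lt_trans (flux_mono _ _ WW') _.
have clW' : closure W' = closure W `|` closure (ocube c r) by exact: closureU.
have GW' : (fl G W' < +oo)%E.
  apply: (lfp_flux_fin oU mG fG oW').
    by rewrite clW'; apply: compactU => //; exact: compact_closure_ocube.
  rewrite clW' subUset; split => //.
  by apply: subset_trans cU; exact: closure_ocube.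
apply: (@le_lt_trans _ _ (fl F (ocube c r) + fl G W' + (cube_cost r)%:E)%E).
  apply: le_trans (flux_splice_cube mF mG (@subsetUr _ _ _) r0).
  by rewrite leeDl// (flux_ge0 unit_ball_starshaped).
by rewrite !lte_add_pinfty// ltry.
Qed.

End flux_sets.

(** * Partitions *)

Section cube_supply.
Context {R : realType} {d : nat}.
Local Notation V := 'rV[R]_d.
Local Notation leb := (@lebesgue_Rd R d).

Lemma volume_sum_lt n (A K : set V) (Q : 'I_n -> set V) (s : R) :
  (leb K < +oo)%E -> (forall i, leb (Q i) < +oo)%E ->
  K `<=` \bigcup_i Q i -> (forall i, volume (Q i) A < s) ->
  volume K A <= n%:R * s.
Proof.
move=> Koo Qoo KQ Qs; rewrite -lee_fin -volumeE//.
apply: (@le_trans _ _ (\sum_(i < n) leb (A `&` Q i))%E).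
  apply: le_trans (lebesgue_bigsetU _); apply: le_lebesgue_Rd => x [Ax /KQ[i _ Qx]].
  by rewrite (bigD1 i)//=; left.
rewrite (eq_bigr (fun i => (volume (Q i) A)%:E)); last by move=> i _; rewrite volumeE.
rewrite sumEFin lee_fin -[n in n%:R]card_ord -sumr_const mulr_suml.
by apply: ler_sum => i _; rewrite mul1r ltW.
Qed.

(** Among the n cubes of radius rho of a finite cover, one contains more than its share w / (n + 1)
    or exactly this share of A; by continuity in the radius, a concentric cube contains any smaller
    amount. The threshold sigma is uniform in A, as needed for a sequence of partitions. *)
Lemma cube_supply (a w rho : R) : (0 < d)%N -> 0 < w -> 0 < rho ->
  exists2 sigma, 0 < sigma & forall (A : set V) s,
    w <= volume (ocube 0 a) A -> 0 <= s <= sigma ->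
    exists x t, [/\ 0 <= t <= rho, ccube 0 a x & volume (ocube x t) A = s].
Proof.
move=> d0 w0 rho0.
have cK := @compact_ccube R d 0 a.
have := cK; rewrite compact_cover => /(_ V (ccube 0 a) (fun x => ocube x rho)).
move=> [|x ax|D DK KD]; first by move=> x _; exact: open_ocube.
  by exists x => // i; rewrite subrr normr0.
pose l : seq V := finmap.enum_fset D; pose n := size l.
exists (w / (n.+1)%:R); first by rewrite divr_gt0.
move=> A s wA /andP[s0 ssig].
have [x xD xs] : exists2 x, x \in l & w / (n.+1)%:R <= volume (ocube x rho) A.
  apply: contrapT => nex.
  have : volume (ocube 0 a) A <= n%:R * (w / (n.+1)%:R).
    apply: (@volume_sum_lt n _ _ (fun i => ocube (nth 0 l i) rho)).
    - exact: lebesgue_ocube_lty.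
    - by move=> i; exact: lebesgue_ocube_lty.
    - move=> x /ocube_ccube /KD[y /= yD xy].
      have yn : (index y l < n)%N by rewrite index_mem.
      by exists (Ordinal yn) => //=; rewrite nth_index.
    - move=> i; rewrite ltNge; apply/negP => wi; apply: nex.
      by exists (nth 0 l i) => //; exact: mem_nth.
  move=> /(le_trans wA); apply/negP; rewrite -ltNge.
  by rewrite mulrA ltr_pdivrMr// mulrC ltr_pM2l// ltr_nat.
have [|t tr tE] := @cube_volume_ivt R d A x 0 rho s (lexx _) (ltW rho0).
  by rewrite (cube_volume0 _ _ d0) s0; exact: le_trans ssig xs.
by exists x, t; split => //; apply/set_mem/DK.
Qed.

End cube_supply.

Section partitions.
Context {R : realType} {d N : nat}.
Local Notation V := 'rV[R]_d.
Local Notation leb := (@lebesgue_Rd R d).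
Local Notation fl := (@flux R d unit_ball).
Local Notation parts := ('I_N -> set V).

(** Twice the perimeter of the partition in an open set [W]. *)
Definition tflux (E : parts) (W : set V) : \bar R := (\sum_(i < N) fl (E i) W)%E.

Lemma tflux_ge0 (E : parts) W : (forall i, lebesgue_set (E i)) ->
  (0 <= tflux E W)%E.
Proof. by move=> mE; apply: sume_ge0 => i _; exact: flux_ge0 unit_ball_starshaped (mE i) _. Qed.

Lemma tflux_mono (E : parts) W W' : W `<=` W' -> (tflux E W <= tflux E W')%E.
Proof. by move=> WW'; apply: lee_sum => i _; exact: flux_mono. Qed.

Lemma tflux_fin (E : parts) Om W : open Om -> (forall i, lebesgue_set (E i)) ->
  (forall i, locally_finite_perimeter Om (E i)) -> open W ->
  compact (closure W) -> closure W `<=` Om -> tflux E W \is a fin_num.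
Proof.
move=> oO mE fE oW cW WO; rewrite ge0_fin_numE; last exact: tflux_ge0.
by apply: lte_sum_pinfty => i _; exact: lfp_flux_fin oO (mE i) (fE i) oW cW WO.
Qed.

Lemma lebesgue_ae_disjoint n (F : 'I_n -> set V) :
  (forall i, lebesgue_set (F i)) ->
  (forall i j, i != j -> leb (F i `&` F j) = 0%E) ->
  leb (\big[setU/set0]_(i < n) F i) = (\sum_(i < n) leb (F i))%E.
Proof.
elim: n F => [|n IH] F mF dF; first by rewrite !big_ord0 lebesgue_Rd0.
rewrite !big_ord_recr/= -IH//; last first.
  by move=> i j ij; apply: dF; apply: contra_neq ij => /(congr1 val) ij; exact: val_inj.
set A := \big[setU/set0]_(i < n) _; set B := F ord_max.
rewrite (lebesgue_split (A `|` B) (mF ord_max)) (lebesgue_split A (mF ord_max)) -/B.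
have -> : leb (A `&` B) = 0%E.
  apply/eqP; rewrite eq_le lebesgue_Rd_ge0 andbT /A -/B.
  rewrite big_distrl/=; apply: le_trans (lebesgue_bigsetU _) _.
  rewrite big1// => i _; apply: dF.
  by rewrite -val_eqE/= ltn_eqF.
rewrite add0e addeC; congr (leb _ + leb _)%E.
  by rewrite setDUl setDv setU0.
by apply/seteqP; split => x; [case|split => //; right].
Qed.

Lemma is_partition_sub Om Om' (E : parts) : Om' `<=` Om ->
  is_partition Om E -> is_partition Om' E.
Proof.
move=> OO [mE dE cE]; split => // [k j kj|].
  by apply: lebesgue_eq0_sub (dE k j kj); exact: setIS.
by apply: lebesgue_eq0_sub cE; exact: setSD.
Qed.

Lemma partition_volume Om K (E : parts) : is_partition Om E ->
  lebesgue_set K -> (leb K < +oo)%E -> K `<=` Om ->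
  \sum_i volume K (E i) = fine (leb K).
Proof.
move=> pE mK Koo KO; have [mE dE cE] := is_partition_sub KO pE.
apply: EFin_inj; rewrite -sumEFin fineK; last first.
  by rewrite ge0_fin_numE ?lebesgue_Rd_ge0.
rewrite (eq_bigr (fun i => leb (E i `&` K))); last by move=> i _; rewrite volumeE.
rewrite -lebesgue_ae_disjoint; last 2 first.
- by move=> i; exact: lebesgue_setI.
- move=> i j ij; apply: lebesgue_eq0_sub (dE i j ij) => x [[? ?] [? ?]].
  by split.
apply/eqP; rewrite eq_le; apply/andP; split.
  apply: le_lebesgue_Rd; rewrite -big_distrl/=; exact: subIsetr.
apply: lebesgue_le_ae; apply: lebesgue_eq0_sub cE => x [Kx nx]; split => //.
move=> [i _ Ex]; apply: nx; rewrite -big_distrl/=; split => //.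
by rewrite (bigD1 i)//=; left.
Qed.

Lemma is_partition_splice Om Q (F G : parts) : lebesgue_set Q ->
  is_partition Om G -> is_partition Q F ->
  is_partition Om (fun i => splice Q (F i) (G i)).
Proof.
move=> mQ [mG dG cG] [mF dF cF]; split => [k|k j kj|].
- exact: lebesgue_set_splice.
- apply: lebesgue_eq0_sub (lebesgue_eq0_setU (dF k j kj) (dG k j kj)).
  by move=> x [[[[? ?]|[? ?]] [[? ?]|[? ?]]] ?]; [left|by []|by []|right].
- apply: lebesgue_eq0_sub (lebesgue_eq0_setU cF cG) => x [Ox nx].
  have [Qx|nQx] := pselect (Q x).
    by left; split => // -[i _ hi]; apply: nx; exists i => //; left.
  by right; split => // -[i _ hi]; apply: nx; exists i => //; right.
Qed.

Lemma tflux_splice (F G : parts) (U : set V) c r lambda e0 :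
  (forall i, lebesgue_set (F i)) -> (forall i, lebesgue_set (G i)) ->
  ocube c r `<=` U -> 0 < e0 ->
  (forall i e, 0 < e -> e <= e0 ->
    (leb ((F i `+` G i) `&` (ocube c r `\` ocube c (r - e))) <= (lambda * e)%:E)%E) ->
  (tflux (fun i => splice (ocube c r) (F i) (G i)) U + tflux G (ocube c r) <=
   tflux F (ocube c r) + tflux G U + (N%:R * (@splice_const R d * lambda))%:E)%E.
Proof.
move=> mF mG QU e0_gt0 hFG.
have -> : (N%:R * (@splice_const R d * lambda))%:E =
    (\sum_(i < N) (@splice_const R d * lambda)%:E)%E.
  by rewrite sumEFin sumr_const card_ord mulr_natl.
rewrite /tflux -!big_split/=; apply: lee_sum => i _.
exact: flux_spliceE e0_gt0 (hFG i).
Qed.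

Lemma tflux_splice_cube (F G : parts) (U : set V) c r :
  (forall i, lebesgue_set (F i)) -> (forall i, lebesgue_set (G i)) ->
  ocube c r `<=` U -> 0 <= r ->
  (tflux (fun i => splice (ocube c r) (F i) (G i)) U + tflux G (ocube c r) <=
   tflux F (ocube c r) + tflux G U + (N%:R * @cube_cost R d r)%:E)%E.
Proof.
move=> mF mG QU r0.
have -> : (N%:R * @cube_cost R d r)%:E = (\sum_(i < N) (@cube_cost R d r)%:E)%E.
  by rewrite sumEFin sumr_const card_ord mulr_natl.
rewrite /tflux -!big_split/=; apply: lee_sum => i _.
exact: flux_splice_cube.
Qed.

Definition transfer (G : parts) (h j : 'I_N) : parts :=
  fun i => if i == h then set0 else if i == j then G h `|` G j else G i.

Lemma transfer_set (G : parts) h j i : (forall k, lebesgue_set (G k)) ->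
  lebesgue_set (transfer G h j i).
Proof.
move=> mG; rewrite /transfer; case: eqP => _; first exact: lebesgue_set0.
by case: eqP => _ //; exact: lebesgue_setU.
Qed.

Lemma transfer_partition Q (G : parts) h j : h != j -> is_partition Q G ->
  is_partition Q (transfer G h j).
Proof.
move=> hj [mG dG cG]; split => [k|k l kl|].
- exact: transfer_set.
- rewrite /transfer; case: eqP => [_|/eqP kh]; first by rewrite !set0I lebesgue_Rd0.
  case: (eqVneq l h) => [_|lh]; first by rewrite setI0 set0I lebesgue_Rd0.
  case: eqP => [kj|/eqP kj].
    have lj : l != j by rewrite -kj eq_sym.
    rewrite (negbTE lj) setIUl setIUl; apply: lebesgue_eq0_setU; apply: dG.
      by rewrite eq_sym.
    by rewrite eq_sym.
  case: eqP => [lj|_]; last exact: dG.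
  by rewrite setIUr setIUl; apply: lebesgue_eq0_setU; apply: dG => //; rewrite -lj.
- apply: lebesgue_eq0_sub cG => x [Qx nx]; split => // -[i _ Gx]; apply: nx.
  have [ih|ih] := eqVneq i h.
    by exists j => //; rewrite /transfer eq_sym (negbTE hj) eqxx -ih; left.
  exists i => //; rewrite /transfer (negbTE ih); case: eqP => [ij|//].
  by right; rewrite -ij.
Qed.

Lemma tflux_transfer Q (G : parts) h j : h != j -> lebesgue_set Q ->
  is_partition Q G -> (tflux (transfer G h j) Q <= tflux G Q)%E.
Proof.
move=> hj mQ [mG dG cG]; rewrite /tflux (bigD1 h)//= (bigD1 j) 1?eq_sym//=.
rewrite [leRHS](bigD1 h)//= [X in (_ <= _ + X)%E](bigD1 j) 1?eq_sym//=.
rewrite {1}/transfer eqxx flux_set0l add0e {1}/transfer eq_sym (negbTE hj) eqxx addeA.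
apply: leeD; last first.
  by rewrite le_eqVlt; apply/orP; left; apply/eqP; apply: eq_bigr => i /andP[ih ij];
    rewrite /transfer (negbTE ih) (negbTE ij).
exact: flux_setU (dG h j hj).
Qed.

Lemma volume_setU Q A B : (leb Q < +oo)%E -> lebesgue_set A ->
  leb (A `&` B `&` Q) = 0%E -> volume Q (A `|` B) = volume Q A + volume Q B.
Proof.
move=> Qoo mA AB; apply: EFin_inj; rewrite EFinD -!volumeE//.
rewrite (lebesgue_split _ mA) (lebesgue_split (B `&` Q) mA).
have -> : leb (B `&` Q `&` A) = 0%E by rewrite setIAC (setIC B).
rewrite add0e; congr (leb _ + leb _)%E.
  apply/seteqP; split => x; first by case=> -[_ Qx] Ax; split.
  by move=> [Ax Qx]; split => //; split => //; left.
apply/seteqP; split => x [[]].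
  by move=> [Ax|Bx] Qx nA.
by move=> Bx Qx nA; split => //; split => //; right.
Qed.

(** Merging two regions inside Q does not increase the flux there, so only the boundary of Q is paid
    for. Every region except the emptied one can only grow. *)
Lemma transfer_cube Om (G : parts) h j c r : open Om -> is_partition Om G ->
  (forall k, locally_finite_perimeter Om (G k)) -> h != j -> 0 <= r ->
  ccube c r `<=` Om -> let Q := ocube c r in
  exists G' : parts, [/\ is_partition Om G',
    forall k, locally_finite_perimeter Om (G' k),
    (forall k, G' k `\` Q = G k `\` Q) /\ (forall k, k != h -> G k `<=` G' k),
    forall U, Q `<=` U -> (tflux G' U <= tflux G U + (N%:R * @cube_cost R d r)%:E)%E &
    forall K, (leb K < +oo)%E -> Q `<=` K -> forall k,
      volume K (G' k) = volume K (G k) + (if k == h then - volume Q (G h)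
        else if k == j then volume Q (G h) else 0)].
Proof.
move=> oO pG fG hj r0 cO Q.
have QO : Q `<=` Om by apply: subset_trans cO; exact: ocube_ccube.
have mQ : lebesgue_set Q by exact/lebesgue_set_open/open_ocube.
have [mG dG cG] := pG.
have pQ := is_partition_sub QO pG.
have mg i := transfer_set h j i mG.
have Qfin : tflux G Q \is a fin_num.
  apply: tflux_fin oO mG fG _ _ _; first exact: open_ocube.
    exact: compact_closure_ocube.
  by apply: subset_trans cO; exact: closure_ocube.
have gfin : (tflux (transfer G h j) Q < +oo)%E.
  by apply: le_lt_trans (tflux_transfer hj mQ pQ) _; rewrite ltey_eq Qfin.
exists (fun i => splice Q (transfer G h j i) (G i)); split.
- exact: is_partition_splice (transfer_partition hj pQ).
- move=> k; apply: lfp_splice => //; apply: le_lt_trans gfin.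
  rewrite /tflux (bigD1 k)//= leeDl// sume_ge0// => i _.
  exact: flux_ge0 unit_ball_starshaped (mg i) _.
- split => [k|k kh]; first exact: splice_out.
  move=> x Gx; have [Qx|nQx] := pselect (Q x); last by right.
  left; split => //; rewrite /transfer (negbTE kh); case: eqP => // kj.
  by right; rewrite -kj.
- move=> U QU; have := tflux_splice_cube mg mG QU r0.
  move=> /le_trans/(_ (leeD2r _ (leeD2r _ (tflux_transfer hj mQ pQ)))).
  by rewrite -addeA [leLHS]addeC leeD2lE.
- move=> K Koo QK k; rewrite volume_splice// /transfer.
  case: eqP => [->|_]; first by rewrite volume_set0 addr0.
  have Qoo : (leb Q < +oo)%E by exact: lebesgue_ocube_lty.
  case: eqP => [kj|_]; last by rewrite subrK addr0.
  rewrite volume_setU//; last first.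
    by case: pQ => _ + _; apply.
  by rewrite kj; ring.
Qed.

End partitions.

Lemma mulr_succl (R : pzRingType) (n : nat) (x : R) :
  x + n%:R * x = n.+1%:R * x.
Proof. by rewrite -natr1 mulrDl mul1r addrC. Qed.

(** * Restoring prescribed volumes *)

Section volume_adjustment.
Context {R : realType} {d N : nat}.
Local Notation V := 'rV[R]_d.
Local Notation leb := (@lebesgue_Rd R d).
Local Notation parts := ('I_N -> set V).

Lemma volume_loss (K Q A A' : set V) : (leb K < +oo)%E -> (leb Q < +oo)%E ->
  A `\` Q = A' `\` Q -> volume K A <= volume K A' + volume Q A.
Proof.
move=> Koo Qoo AA'; rewrite -lee_fin EFinD -!volumeE//.
apply: le_trans (lebesgue_setU2 _ _); apply: le_lebesgue_Rd => x [Ax Kx].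
have [Qx|nQx] := pselect (Q x); [by right|left; split => //].
by have [] : (A' `\` Q) x by rewrite -AA'.
Qed.

Lemma ccubeS (c : V) r r' : r <= r' -> ccube c r `<=` ccube c r'.
Proof. by move=> rr' x xr i; exact: le_trans rr'. Qed.

(** Each region of l is corrected by one small cube: its content passes from h to j when delta j >=
    0, and from j to h otherwise. The volume of h itself is left free; for a full set of constraints
    it follows from the total volume. *)
Lemma adjust_volumes Om K U a rho w sigma h (l : seq 'I_N) (delta : 'I_N -> R)
    (G : parts) :
  open Om -> (leb K < +oo)%E -> K `<=` U -> K `<=` Om ->
  (forall x, ccube 0 a x -> ccube x rho `<=` K) ->
  (forall (A : set V) s, w <= volume (ocube 0 a) A -> 0 <= s <= sigma ->
    exists x t, [/\ 0 <= t <= rho, ccube 0 a x & volume (ocube x t) A = s]) ->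
  is_partition Om G -> (forall k, locally_finite_perimeter Om (G k)) ->
  uniq l -> h \notin l -> (forall j, j \in l -> `|delta j| <= sigma) ->
  (forall j, j \in l -> delta j < 0 -> w <= volume (ocube 0 a) (G j)) ->
  w + \sum_(j <- l) `|delta j| <= volume (ocube 0 a) (G h) ->
  exists G' : parts, [/\ is_partition Om G',
    forall k, locally_finite_perimeter Om (G' k),
    forall k, G' k `\` K = G k `\` K,
    (tflux G' U <= tflux G U +
      ((size l)%:R * (N%:R * @cube_cost R d rho))%:E)%E &
    forall k, k != h ->
      volume K (G' k) = volume K (G k) + (if k \in l then delta k else 0)].
Proof.
move=> oO Koo KU KO rhoK supply; elim: l G => [|j l IH] G pG fG.
  move=> _ _ _ _ _; exists G; split => //; first by rewrite mul0r adde0.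
  by move=> k _; rewrite in_nil addr0.
rewrite /= inE negb_or big_cons => /andP[jl ul] /andP[hj hl] dsig dneg hubw.
have Qaoo : (leb (ocube 0 a : set V) < +oo)%E by exact: lebesgue_ocube_lty.
have sum0 : 0 <= \sum_(j <- l) `|delta j| by exact: sumr_ge0.
have djs : `|delta j| <= sigma by apply: dsig; rewrite mem_head.
have lj k : k \in l -> k != j by move=> kl; apply: contraNneq jl => <-.
have lh k : k \in l -> k != h by move=> kl; apply: contraNneq hl => <-.
(* A single correction maintains the hypotheses of the induction: the reserve of h decreases by at
   most |delta j|, already counted in the sum, and the regions still to be corrected lose
   nothing. *)
suff [G1 [pG1 fG1 G1K flux1 [vol1 hub1 ge1]]] : exists G1 : parts,
    [/\ is_partition Om G1, forall k, locally_finite_perimeter Om (G1 k),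
      forall k, G1 k `\` K = G k `\` K,
      (tflux G1 U <= tflux G U + (N%:R * @cube_cost R d rho)%:E)%E &
      [/\ forall k, k != h ->
        volume K (G1 k) = volume K (G k) + (if k == j then delta j else 0),
        volume (ocube 0 a) (G h) <= volume (ocube 0 a) (G1 h) + `|delta j| &
        forall k, k \in l -> G k `<=` G1 k]].
  have [|||G2 [pG2 fG2 G2K flux2 vol2]] := IH G1 pG1 fG1 ul hl.
  - by move=> k kl; apply: dsig; rewrite inE kl orbT.
  - move=> k kl dk; apply: le_trans (volume_sub Qaoo (ge1 k kl)).
    by apply: dneg => //; rewrite inE kl orbT.
  - by rewrite -(lerD2r `|delta j|); apply: le_trans hub1; rewrite -addrA [_ + `|_|]addrC.
  exists G2; split => //.
  - by move=> k; rewrite G2K.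
  - apply: le_trans flux2 _; apply: le_trans (leeD2r _ flux1) _.
    by rewrite -addeA -EFinD mulr_succl.
  - move=> k kh; rewrite vol2// vol1// inE -addrA; congr (_ + _).
    by case: eqP => [->|_]; rewrite ?(negbTE jl) ?addr0 ?add0r.
have cubeK x t : ccube 0 a x -> t <= rho -> ccube x t `<=` K.
  by move=> ax tr; apply: subset_trans (rhoK x ax); exact: ccubeS.
have cost t : 0 <= t -> t <= rho -> forall x : \bar R,
    (x + (N%:R * @cube_cost R d t)%:E <= x + (N%:R * @cube_cost R d rho)%:E)%E.
  by move=> t0 tr x; rewrite leeD2l// lee_fin ler_wpM2l// cube_cost_le.
have offK x t (A B : set V) : ccube 0 a x -> t <= rho ->
    A `\` ocube x t = B `\` ocube x t -> A `\` K = B `\` K.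
  move=> ax tr AB; have QK : ocube x t `<=` K.
    by apply: subset_trans (cubeK x t ax tr); exact: ocube_ccube.
  have aux (C : set V) : C `\` K = (C `\` ocube x t) `\` K.
    by apply/seteqP; split => y; [move=> [Cy nK]; split => //; split => // /QK|case=> -[]].
  by rewrite aux AB -aux.
have [dj|dj] := leP 0 (delta j).
- have [||x [t [/andP[t0 tr] ax vE]]] := supply (G h) (delta j).
  + by apply: le_trans hubw; rewrite lerDl addr_ge0.
  + by rewrite dj -(ger0_norm dj).
  have [|G1 [pG1 fG1 [offG1 geG1] fluxG1 volG1]] :=
      @transfer_cube R d N Om G h j x t oO pG fG hj t0.
    exact: subset_trans (cubeK x t ax tr) KO.
  have QK : ocube x t `<=` K.
    by apply: subset_trans (cubeK x t ax tr); exact: ocube_ccube.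
  exists G1; split => //.
  + by move=> k; exact: offK ax tr (offG1 k).
  + by apply: le_trans (fluxG1 U _) (cost t t0 tr _); exact: subset_trans KU.
  split.
  + by move=> k kh; rewrite volG1// (negbTE kh) vE.
  + rewrite (ger0_norm dj) -vE; apply: volume_loss => //; first exact: lebesgue_ocube_lty.
  + by move=> k kl; apply: geG1; exact: lh.
have [||x [t [/andP[t0 tr] ax vE]]] := supply (G j) (- delta j).
- by apply: dneg => //; rewrite mem_head.
- by rewrite -(ltr0_norm dj) normr_ge0.
have jh : j != h by rewrite eq_sym.
have [|G1 [pG1 fG1 [offG1 geG1] fluxG1 volG1]] :=
    @transfer_cube R d N Om G j h x t oO pG fG jh t0.
  exact: subset_trans (cubeK x t ax tr) KO.
have QK : ocube x t `<=` K.
  by apply: subset_trans (cubeK x t ax tr); exact: ocube_ccube.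
exists G1; split => //.
- by move=> k; exact: offK ax tr (offG1 k).
- by apply: le_trans (fluxG1 U _) (cost t t0 tr _); exact: subset_trans KU.
split.
- by move=> k kh; rewrite volG1// (negbTE kh) vE opprK.
- apply: (@le_trans _ _ (volume (ocube 0 a) (G1 h))); last by rewrite lerDl.
  by apply: volume_sub => //; exact: geG1.
- by move=> k kl; apply: geG1; exact: lj.
Qed.

End volume_adjustment.

(** * Isoperimetric partitions in terms of fluxes *)

Section minimality.
Context {R : realType} {d N : nat}.
Local Notation V := 'rV[R]_d.
Local Notation leb := (@lebesgue_Rd R d).
Local Notation fl := (@flux R d unit_ball).
Local Notation parts := ('I_N -> set V).

(** Additivity of the variation measure; this converts comparisons on compact sets into comparisons
    on open sets and back. *)
Lemma variation_split (E K U : set V) : lebesgue_set E -> compact K ->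
  open U -> K `<=` U -> fl E U = (variation E K + fl E (U `\` K))%E.
Proof.
move=> mE cK oU KU; pose cm := flux_content unit_ball_starshaped mE.
have clK : closed K by exact: compact_is_closed.
have oUK : open (U `\` K) by apply: openI => //; exact: closed_openC.
rewrite -(outer_open cm oU) -(outer_open cm oUK).
rewrite -[in LHS](setDUK KU) -[LHS](content_measureE cm) measureU//.
- exact: borel_closed.
- exact: borel_open.
- by rewrite setDIK.
Qed.

Lemma sum_variation_split (E : parts) K U : (forall i, lebesgue_set (E i)) ->
  compact K -> open U -> K `<=` U ->
  tflux E U = (\sum_i variation (E i) K + tflux E (U `\` K))%E.
Proof.
move=> mE cK oU KU; rewrite /tflux -big_split/=; apply: eq_bigr => i _.
exact: variation_split.
Qed.

Lemma tflux_ae (E F : parts) W : (forall i, lebesgue_set (E i)) ->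
  (forall i, lebesgue_set (F i)) -> lebesgue_set W ->
  (forall i, leb ((E i `+` F i) `&` W) = 0%E) -> tflux E W = tflux F W.
Proof. by move=> mE mF mW EF; apply: eq_bigr => i _; exact: flux_ae. Qed.

Lemma partition_perimeterE (Om : set V) (E : parts) K : open Om ->
  (forall i, lebesgue_set (E i)) ->
  (forall i, locally_finite_perimeter Om (E i)) -> compact K -> K `<=` Om ->
  partition_perimeter Om E K = ((2^-1)%:E * \sum_i variation (E i) K)%E.
Proof.
move=> oO mE fE cK KO; congr (_ * _)%E; apply: eq_bigr => i _.
exact: perimeterE.
Qed.

Lemma partition_perimeter_le (Om : set V) (E F : parts) K : open Om ->
  (forall i, lebesgue_set (E i)) -> (forall i, lebesgue_set (F i)) ->
  (forall i, locally_finite_perimeter Om (E i)) ->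
  (forall i, locally_finite_perimeter Om (F i)) -> compact K -> K `<=` Om ->
  (partition_perimeter Om E K <= partition_perimeter Om F K)%E =
  (\sum_i variation (E i) K <= \sum_i variation (F i) K)%E.
Proof.
move=> oO mE mF fE fF cK KO; rewrite !partition_perimeterE//.
by rewrite lee_pmul2l// lte_fin invr_gt0.
Qed.

(** E and H agree almost everywhere outside K, so adding their common flux in U minus K preserves
    the comparison on K. *)
Lemma isoperimetric_tflux J (Om K U : set V) (E H : parts) : open Om ->
  locally_isoperimetric J Om E -> compact K -> open U -> K `<=` U ->
  U `<=` Om -> is_partition Om H ->
  (forall i, locally_finite_perimeter Om (H i)) ->
  (forall i, leb ((H i `+` E i) `\` K) = 0%E) ->
  (forall j, j \in J -> leb (H j `&` K) = leb (E j `&` K)) ->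
  (tflux E U <= tflux H U)%E.
Proof.
move=> oO [pE fE minE] cK oU KU UO pH fH HE vol.
have KO : K `<=` Om by exact: subset_trans UO.
have [mE _ _] := pE; have [mH _ _] := pH.
have := minE K H cK KO pH fH HE vol.
rewrite partition_perimeter_le// => le_var.
rewrite (sum_variation_split mE cK oU KU) (sum_variation_split mH cK oU KU).
apply: leeD => //; rewrite le_eqVlt; apply/orP; left; apply/eqP.
have mW : lebesgue_set (U `\` K).
  apply: lebesgue_setD; first exact: lebesgue_set_open.
  by apply: lebesgue_set_closed; exact: compact_is_closed.
apply: tflux_ae => // i; rewrite setYC; apply: lebesgue_eq0_sub (HE i).
by move=> x [hx [_ nKx]].
Qed.

(** The passage in the other direction: the common flux in U minus B is finite, since U is
    relatively compact in Om, and can be cancelled. *)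
Lemma tflux_isoperimetric (Om B U : set V) (E F : parts) : open Om ->
  is_partition Om E -> is_partition Om F ->
  (forall i, locally_finite_perimeter Om (E i)) ->
  (forall i, locally_finite_perimeter Om (F i)) -> compact B -> open U ->
  B `<=` U -> compact (closure U) -> closure U `<=` Om ->
  (forall i, leb ((F i `+` E i) `\` B) = 0%E) ->
  (tflux E U <= tflux F U)%E ->
  (partition_perimeter Om E B <= partition_perimeter Om F B)%E.
Proof.
move=> oO [mE _ _] [mF _ _] fE fF cB oU BU cU UO FE.
have BO : B `<=` Om by apply: subset_trans BU _; apply: subset_trans UO; exact: subset_closure.
rewrite partition_perimeter_le//.
rewrite (sum_variation_split mE cB oU BU) (sum_variation_split mF cB oU BU).
have clB := compact_is_closed cB.
have oW : open (U `\` B) by apply: openI => //; exact: closed_openC.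
have -> : tflux E (U `\` B) = tflux F (U `\` B).
  apply: tflux_ae => //; first exact: lebesgue_set_open.
  move=> i; rewrite setYC; apply: lebesgue_eq0_sub (FE i).
  by move=> x [hx [_ nKx]].
rewrite leeD2rE//.
have subU : closure (U `\` B) `<=` closure U by apply: closureS; exact: subDsetl.
apply: (tflux_fin oO mF fF oW); last exact: subset_trans subU UO.
by apply: subclosed_compact cU subU; exact: closed_closure.
Qed.

End minimality.

(** * Competitors made of concentric shells *)

Section shells.
Context {R : realType} {d : nat}.
Local Notation V := 'rV[R]_d.
Local Notation leb := (@lebesgue_Rd R d).
Local Notation fl := (@flux R d unit_ball).

Lemma cube_radii (c : V) r (s : nat -> R) n : (0 < d)%N -> 0 <= r ->
  s 0%N = 0 -> (forall m, s m <= s m.+1 <= cube_volume setT c r) ->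
  exists rho : nat -> R, [/\ rho 0%N = 0,
    forall m, (m < n)%N -> rho m <= rho m.+1 &
    forall m, (m <= n)%N -> 0 <= rho m <= r /\ cube_volume setT c (rho m) = s m].
Proof.
move=> d0 r0 s0 sm; elim: n => [|n [rho [rho0 rhom rhos]]].
  exists (fun=> 0); split => // m; rewrite leqn0 => /eqP->.
  by rewrite lexx r0 cube_volume0.
have [/andP[rn0 rnr] vn] := rhos n (leqnn n).
have [|t /andP[t1 t2] vt] := @cube_volume_ivt R d setT c (rho n) r (s n.+1) rn0 rnr.
  by rewrite vn; exact: sm.
exists (fun m => if (m <= n)%N then rho m else t); split => //= m.
  rewrite ltnS => mn; rewrite mn; move: mn.
  by rewrite leq_eqVlt => /orP[/eqP->|mn]; [rewrite ltnn|rewrite mn rhom].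
rewrite leq_eqVlt => /orP[/eqP->|]; last by rewrite ltnS => mn; rewrite mn; exact: rhos.
by rewrite ltnn t2 vt (le_trans rn0).
Qed.

Lemma splice_setT (Q : set V) : splice Q setT set0 = Q.
Proof. by rewrite /splice setTI set0D setU0. Qed.

Lemma splice_set0 (Q G : set V) : splice Q set0 G = G `\` Q.
Proof. by rewrite /splice set0I set0U. Qed.

(** A cube is the whole space spliced into the empty set; neither has flux, so only the splicing
    cost remains. *)
Lemma flux_ocube (c : V) r : 0 <= r ->
  (fl (ocube c r) setT <= (@cube_cost R d r)%:E)%E.
Proof.
move=> r0; have := @flux_splice_cube R d setT set0 setT c r lebesgue_setT
  lebesgue_set0 (@subsetT _ _) r0.
rewrite splice_setT !flux_set0l (flux_setT _ unit_ball_starshaped).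
by rewrite adde0 !add0e.
Qed.

Lemma flux_shell (c : V) r s : 0 <= s -> s <= r ->
  (fl (ocube c r `\` ocube c s) setT <= (2 * @cube_cost R d r)%:E)%E.
Proof.
move=> s0 sr; have mr : lebesgue_set (ocube c r) by exact/lebesgue_set_open/open_ocube.
have := @flux_splice_cube R d set0 (ocube c r) setT c s lebesgue_set0 mr
  (@subsetT _ _) s0.
rewrite splice_set0 flux_set0l add0e => h.
apply: (@le_trans _ _ (fl (ocube c r) setT + (@cube_cost R d s)%:E)%E).
  by apply: le_trans h; rewrite leeDl// (flux_ge0 unit_ball_starshaped mr).
rewrite mulr2n mulrDl mul1r EFinD; apply: leeD; first by apply: flux_ocube; exact: le_trans sr.
by rewrite lee_fin cube_cost_le.
Qed.

End shells.

Section bound.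
Context {R : realType} {d N : nat}.
Local Notation V := 'rV[R]_d.
Local Notation leb := (@lebesgue_Rd R d).
Local Notation fl := (@flux R d unit_ball).
Local Notation parts := ('I_N -> set V).

Lemma shell_partition (c : V) r (v : 'I_N -> R) : (0 < d)%N -> 0 <= r ->
  (forall i, 0 <= v i) -> \sum_i v i = cube_volume setT c r ->
  exists S : parts, [/\ is_partition (ocube c r) S,
    forall i, volume (ocube c r) (S i) = v i &
    forall i, (fl (S i) (ocube c r) <= (2 * @cube_cost R d r)%:E)%E].
Proof.
move=> d0 r0 v0 vr.
(* Cumulative volumes: the region i will fill the shell between the cubes of volumes [s i] and
   [s i.+1]. *)
pose s (m : nat) := \sum_(i < N | (i < m)%N) v i.
have sS (i : 'I_N) : s i.+1 = s i + v i.
  rewrite /s (bigD1 i)//= addrC; congr (_ + _); apply: eq_bigl => k.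
  by rewrite ltnS [RHS]ltn_neqAle andbC.
have sN m : (N <= m)%N -> s m = cube_volume setT c r.
  move=> Nm; rewrite -vr /s; apply: eq_bigl => i.
  by rewrite (leq_trans (ltn_ord i) Nm).
have [|m|rho [rho0 rhom rhos]] := @cube_radii R d c r s N d0 r0.
- by rewrite /s big1.
- apply/andP; split; last first.
    by rewrite -vr [leRHS](bigID (fun i : 'I_N => (i < m.+1)%N))/= lerDl sumr_ge0.
  have [mN|Nm] := ltnP m N; first by rewrite (sS (Ordinal mN)) lerDl.
  by rewrite !sN// leqW.
have rho_mono m n : (m <= n)%N -> (n <= N)%N -> rho m <= rho n.
  elim: n => [|n IH]; first by rewrite leqn0 => /eqP->.
  rewrite leq_eqVlt => /orP[/eqP->//|mn] nN.
  by apply: le_trans (rhom n nN); apply: IH => //; exact: ltnW.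
pose S (i : 'I_N) := ocube c (rho i.+1) `\` ocube c (rho i).
have mQ t : lebesgue_set (ocube c t : set V) by exact/lebesgue_set_open/open_ocube.
have Soo t : (leb (ocube c t) < +oo)%E by exact: lebesgue_ocube_lty.
exists S; split.
- split => [i|k j kj|].
  + exact: lebesgue_setD.
  + wlog kj' : k j kj / (k < j)%N.
      move=> h; have /orP[kj'|jk'] : (k < j)%N || (j < k)%N by rewrite -neq_ltn.
        exact: h.
      by rewrite (setIC (S k)); apply: h => //; rewrite eq_sym.
    rewrite (_ : _ `&` _ = set0) ?lebesgue_Rd0// -subset0.
    move=> x [[[k1 k2] [j1 j2]] _]; apply: j2; apply: ocubeS k1.
    by apply: rho_mono => //; exact: ltnW.
  + have cover m : (m <= N)%N -> ocube c (rho m) `<=` \bigcup_(i in setT) S i.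
      elim: m => [_ x|m IH mN x xm].
        rewrite rho0 => /(_ (Ordinal d0)); rewrite ltNge normr_ge0//.
      have [xm'|xm'] := pselect (ocube c (rho m) x); first by apply: IH => //; exact: ltnW.
      by exists (Ordinal mN).
    have [/andP[rN0 rNr] vN] := rhos N (leqnn N).
    (* [rho N] is only known to give a cube with the volume of the whole cube; the shell left over
       is then negligible. *)
    have : leb (ocube c r `\` ocube c (rho N)) = 0%E.
      have := @volume_split R d (ocube c r) (ocube c (rho N)) setT (Soo r) (mQ _) (ocubeS rNr).
      rewrite -[volume _ setT]/(cube_volume setT c r) -[volume _ setT]/(cube_volume setT c (rho N)).
      rewrite vN sN// => /eqP; rewrite addrC -subr_eq subrr => /eqP h.
      rewrite (_ : _ `\` _ = (setT `\` ocube c (rho N)) `&` ocube c r).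
        by rewrite volumeE// -h.
      by rewrite setTD setIC setDE.
    apply: lebesgue_eq0_sub => x [xr nx]; split => // xN; apply: nx.
    exact: cover xN.
- move=> i; have iN := ltn_ord i.
  have [/andP[ri0 rir] vi] := rhos i (ltnW iN).
  have [/andP[rj0 rjr] vj] := rhos i.+1 iN.
  have SE : volume (ocube c r) (S i) = volume (ocube c (rho i.+1)) (setT `\` ocube c (rho i)).
    congr (fine (leb _)); apply/seteqP; split => x; first by case=> -[x1 x2] _.
    by move=> [[_ x2] x1]; split => //; exact: ocubeS x1.
  have := @volume_split R d (ocube c (rho i.+1)) (ocube c (rho i)) setT
    (Soo _) (mQ _) (ocubeS (rhom i iN)).
  rewrite -SE -[volume _ setT]/(cube_volume setT c (rho i.+1)).
  rewrite -[volume _ setT]/(cube_volume setT c (rho i)) vi vj sS.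
  by move/addrI.
- move=> i; have iN := ltn_ord i.
  have [/andP[ri0 rir] vi] := rhos i (ltnW iN).
  have [/andP[rj0 rjr] vj] := rhos i.+1 iN.
  apply: le_trans (flux_mono _ _ (@subsetT _ _)) _.
  apply: le_trans (flux_shell _ ri0 (rhom i iN)) _.
  by rewrite lee_fin ler_pM2l// cube_cost_le.
Qed.

(** The shells are given the volumes of all the regions of E in the cube, so the competitor is
    admissible for every J. The bound does not depend on E or Om, hence is uniform along the
    sequence. *)
Lemma isoperimetric_bound J (Om : set V) (E : parts) r r' : (0 < d)%N ->
  0 <= r -> r < r' -> open Om -> locally_isoperimetric J Om E ->
  ccube 0 r' `<=` Om ->
  (tflux E (ocube 0 r) <= (N%:R * (2 * @cube_cost R d r) + N%:R * @cube_cost R d r)%:E)%E.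
Proof.
move=> d0 r0 rr' oO isoE cO; have [pE fE _] := isoE; have [mE _ _] := pE.
pose Q : set V := ocube 0 r; pose U : set V := ocube 0 r'; pose K : set V := ccube 0 r.
have KU : K `<=` U by exact: ccube_ocube.
have UO : U `<=` Om by apply: subset_trans cO; exact: ocube_ccube.
have QK : Q `<=` K by exact: ocube_ccube.
have mQ : lebesgue_set Q by exact/lebesgue_set_open/open_ocube.
have QO : Q `<=` Om by apply: subset_trans UO; exact: subset_trans KU.
have Qoo : (leb Q < +oo)%E by exact: lebesgue_ocube_lty.
have Koo : (leb K < +oo)%E by exact: lebesgue_ccube_lty.
have [||S [pS vS fS]] := @shell_partition 0 r (fun i => volume Q (E i)) d0 r0.
- by move=> i; exact: volume_ge0.
- by rewrite (partition_volume pE mQ Qoo QO) /cube_volume setTI.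
have [mS _ _] := pS.
pose H : parts := fun i => splice Q (S i) (E i).
have EU : tflux E U \is a fin_num.
  apply: (tflux_fin oO mE fE); first exact: open_ocube.
    exact: compact_closure_ocube.
  by apply: subset_trans cO; exact: closure_ocube.
have EH : (tflux E U <= tflux H U)%E.
  apply: (isoperimetric_tflux oO isoE (@compact_ccube _ _ 0 r) _ KU UO).
  - exact: open_ocube.
  - exact: is_partition_splice.
  - move=> i; apply: lfp_splice => //; last by apply: subset_trans KU UO.
    by apply: le_lt_trans (fS i) _; rewrite ltry.
  - move=> i; rewrite (_ : _ `\` _ = set0) ?lebesgue_Rd0// -subset0 => x [].
    by move=> [[[[_ /QK]|[]]]|[Ex nH]] // nK; apply: nH; right; split => // /QK.
  - move=> j _; rewrite !volumeE//; congr EFin.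
    by rewrite volume_splice// vS subrK.
have := tflux_splice_cube mS mE (subset_trans QK KU) r0.
have SQ : (tflux S Q <= (N%:R * (2 * @cube_cost R d r))%:E)%E.
  apply: (@le_trans _ _ (\sum_(i < N) (2 * @cube_cost R d r)%:E)%E).
    by apply: lee_sum => i _; exact: fS.
  by rewrite sumEFin sumr_const card_ord lee_fin [leRHS]mulr_natl.
move=> hH; have := le_trans (leeD2r (tflux E Q) EH) hH.
rewrite -addeA [X in (_ <= _ + X)%E -> _]addeC.
rewrite addeA [X in (_ <= X)%E -> _]addeC leeD2lE// => h.
apply: le_trans h _; rewrite EFinD; exact: leeD2r.
Qed.

End bound.

Lemma sum_div_le (R : realFieldType) n (x : R) : 0 <= x ->
  \sum_(i < n) (x / n.+1%:R) <= x.
Proof.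
move=> x0; rewrite sumr_const card_ord -mulrnAl ler_pdivrMr// -mulr_natr.
by rewrite ler_wpM2l// ler_nat.
Qed.

(** * Lower semicontinuity of the total flux *)

Section lsc.
Context {R : realType}.

Lemma ereal_sup_sum n (S : 'I_n -> set (\bar R)) (A : \bar R) :
  (forall i x, S i x -> x \is a fin_num) -> (forall i, 0 <= ereal_sup (S i))%E ->
  (forall f, (forall i, S i (f i)) -> (\sum_i f i <= A)%E) ->
  (\sum_i ereal_sup (S i) <= A)%E.
Proof.
elim: n S A => [|n IH] S A Sfin S0 SA.
  by have := SA (fun=> 0%E) (fun i => False_ind _ (notF (ltn_ord i))); rewrite !big_ord0.
rewrite big_ord_recl/=.
pose B := [set (\sum_i f i)%E | f in [set f | forall i : 'I_n, S (lift ord0 i) (f i)]].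
have SB : (\sum_(i < n) ereal_sup (S (lift ord0 i)) <= ereal_sup B)%E.
  apply: IH => [i x|i|f Sf]; [exact: Sfin|exact: S0|].
  by apply: ereal_sup_ubound; exists f.
apply: le_trans (leeD2l _ SB) _; apply: ereal_sup_addl.
- by move=> a; exact: Sfin.
- by move=> _ [f Sf <-]; apply/sum_fin_numP => i _ _; exact: Sfin (Sf i).
- exact: S0.
- by apply: le_trans SB; apply: sume_ge0 => i _; exact: S0.
move=> a _ Sa [f Sf <-].
have := SA (fun i => oapp f a (unlift ord0 i)).
rewrite big_ord_recl unlift_none/=.
rewrite (eq_bigr f); last by move=> i _; rewrite liftK.
by apply=> i; case: unliftP => [j ->|->].
Qed.

Context {d N : nat}.
Local Notation V := 'rV[R]_d.
Local Notation leb := (@lebesgue_Rd R d).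
Local Notation fl := (@flux R d unit_ball).
Local Notation parts := ('I_N -> set V).

Lemma tflux_le (E : parts) W A : (forall i, lebesgue_set (E i)) ->
  (forall phi : 'I_N -> 'I_d -> V -> R, (forall i, field unit_ball W (phi i)) ->
    ((\sum_i Intg (E i) (div (phi i)))%:E <= A)%E) ->
  (tflux E W <= A)%E.
Proof.
move=> mE hA; apply: ereal_sup_sum => [i x [phi _ <-]//|i|f Sf].
  exact: (flux_ge0 unit_ball_starshaped (mE i)).
pose phi i := sval (cid2 (Sf i)).
rewrite (eq_bigr (fun i => (Intg (E i) (div (phi i)))%:E)); last first.
  by move=> i _; rewrite /phi; case: cid2 => /= ? ? ->.
rewrite sumEFin; apply: hA => i.
by rewrite /phi; case: cid2.
Qed.

Lemma fields_shrink (phi : 'I_N -> 'I_d -> V -> R) c b :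
  (forall i, field unit_ball (ocube c b) (phi i)) ->
  exists2 a, a < b & forall i, field unit_ball (ocube c a) (phi i).
Proof.
move=> fp.
have [||s sb hs] := @compact_ocube_shrink R d
    (\bigcup_i \bigcup_j supp (phi i j)) c b.
- apply: compact_bigcup_ord => i; apply: compact_bigcup_ord => j.
  by have [] := (fp i).1 j.
- by move=> x [i _ [j _]]; have [_ _] := (fp i).1 j; apply.
exists s => // i; apply: (field_sub (fp i)) => j x xj; apply: hs.
by exists i => //; exists j.
Qed.

(** Finitely many fields on the open cube of radius b have their supports in a cube of some radius a
    < b. Bounding the approximating partitions on all smaller cubes is therefore enough, and this
    leaves room for the change of radius in the comparison. *)
Lemma tflux_lsc (E : parts) (Ek : nat -> parts) b (A : \bar R) :
  (forall i, lebesgue_set (E i)) -> (forall k i, lebesgue_set (Ek k i)) ->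
  (forall j (K : set V), compact K ->
    leb ((Ek k j `+` E j) `&` K) @[k --> \oo] --> 0%E) ->
  (forall a delta, a < b -> 0 < delta ->
    \forall k \near \oo, (tflux (Ek k) (ocube 0 a) <= A + delta%:E)%E) ->
  (tflux E (ocube 0 b) <= A)%E.
Proof.
move=> mE mEk cvE hA; apply: tflux_le => // phi fp.
have [a ab fpa] := fields_shrink fp.
apply/lee_addgt0Pr => delta delta0.
have d2 : 0 < delta / 2 by rewrite divr_gt0.
pose e := delta / 2 / (N.+1)%:R.
have e0 : 0 < e by rewrite divr_gt0.
have near_i i : \forall k \near \oo,
    `|Intg (Ek k i) (div (phi i)) - Intg (E i) (div (phi i))| <= e.
  have [M M0 hM] := test_bounded (test_div (fp i).1).
  have c0 : 0 < e / M by rewrite divr_gt0.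
  have cK := @compact_ccube R d 0 b.
  have : \forall k \near \oo, (leb ((Ek k i `+` E i) `&` ccube 0 b) < (e / M)%:E)%E.
    have /fine_cvgP[_ /cvgrPdist_lt/(_ _ c0)] := cvE i _ cK.
    apply: filterS => k /=.
    rewrite sub0r normrN ger0_norm ?fine_ge0 ?lebesgue_Rd_ge0// => h.
    by rewrite (volumeE _ (lebesgue_compact_lty cK)) lte_fin.
  apply: filterS => k hk.
  have -> : e = M * (e / M) by rewrite mulrC divfK// gt_eqF.
  apply: (@Intg_dist _ _ _ (div (phi i)) _ _ (ccube 0 b) M (e / M) (mEk k i) (mE i) _
    (test_div (fp i).1) hM _ (ltW hk)).
    by apply: lebesgue_set_closed; exact: closed_ccube.
  apply: div_supp => j; apply: (@subset_trans _ (ocube 0 b)); last exact: ocube_ccube.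
  by have [_ _] := (fp i).1 j.
have [k [Ak hk]] := filter_ex (filterI (hA a _ ab d2) (filter_forall _ near_i)).
apply: (@le_trans _ _ (tflux (Ek k) (ocube 0 a) + (delta / 2)%:E)%E); last first.
  apply: le_trans (leeD2r _ Ak) _.
  by rewrite -addeA -EFinD -splitr.
apply: (@le_trans _ _ ((\sum_i Intg (Ek k i) (div (phi i)))%:E + (delta / 2)%:E)%E).
  rewrite -EFinD lee_fin -lerBlDl -sumrB; apply: (@le_trans _ _ (\sum_(i < N) e)).
    apply: ler_sum => i _; apply: le_trans (hk i); rewrite distrC; exact: ler_norm.
  exact/sum_div_le/ltW.
apply: leeD2r; rewrite -sumEFin; apply: lee_sum => i _.
exact: flux_ub.
Qed.

End lsc.

Lemma sum_diff_le (R : numDomainType) (a b s t : R) : t <= s ->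
  a <= b + (a + s - (b + t)).
Proof.
move=> ts; have -> : b + (a + s - (b + t)) = a + (s - t) by ring.
by rewrite lerDl subr_ge0.
Qed.

(** * Choice of a cube with small mismatch near its boundary *)

Section radius.
Context {R : realType} {d N : nat}.
Local Notation V := 'rV[R]_d.
Local Notation leb := (@lebesgue_Rd R d).

(* The radius is a minimum point of the difference between the total volume in
   the cube of radius t and lambda * t. *)
Lemma good_radius (A : 'I_N -> set V) a b lambda : 0 <= a -> a < b ->
  \sum_i volume (ocube 0 b) (A i `\` ocube 0 a) < lambda * (b - a) ->
  exists2 r, a < r <= b & forall i e, 0 < e -> e <= r - a ->
    (leb (A i `&` (ocube 0 r `\` ocube 0 (r - e))) <= (lambda * e)%:E)%E.
Proof.
move=> a0 ab small.
pose g t := \sum_i cube_volume (A i `\` ocube 0 a) 0 t.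
pose f t := g t - lambda * t.
have cf : {within `[a, b], continuous f}.
  move=> t; apply: cvgB.
    apply: cvg_big => [|i _]; last exact: (@cube_volume_continuous R d _ _ a b a0 t).
    by move=> [x y]; exact: add_continuous.
  have cl : {within `[a, b], continuous (fun x : R => lambda * x)}.
    by apply: continuous_subspaceT; exact: mulrl_continuous.
  exact: cl.
have [r /[!in_itv]/= /andP[ar rb] rmin] := EVT_min (ltW ab) cf.
have ga : g a = 0.
  rewrite /g big1// => i _; rewrite /cube_volume (_ : _ `&` _ = set0).
    by rewrite lebesgue_Rd0.
  by rewrite -subset0 => x [[]].
(* This excludes a minimum at [a]. Comparing the minimum point r with r - e then bounds the growth
   of g between them by lambda e. *)
have fba : f b < f a.
  by rewrite /f ga; move: small; rewrite -/(g b) mulrBr; lra.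
exists r.
  rewrite rb andbT lt_neqAle ar andbT; apply/eqP => ra.
  by have := rmin b; rewrite in_itv/= lexx ltW// => /(_ isT); rewrite -ra leNgt fba.
move=> i e e0 era.
have re : r - e \in `[a, b] by rewrite in_itv/=; apply/andP; split; lra.
have := rmin _ re; rewrite /f => fr.
have ge : g r - g (r - e) <= lambda * e by rewrite mulrBr in fr; lra.
(* As e <= r - a, the shell avoids [ocube 0 a], so removing this cube in the definition of g loses
   nothing. *)
have sub (x : V) : (A i `&` (ocube 0 r `\` ocube 0 (r - e))) x ->
    (((A i `\` ocube 0 a) `&` ocube 0 r) `\` ocube 0 (r - e)) x.
  move=> [Ax [xr nx]]; split => //; split => //; split => // xa; apply: nx.
  by apply: ocubeS xa; rewrite lerBrDl -lerBrDr.
apply: le_trans (le_lebesgue_Rd sub) _.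
have mq : lebesgue_set (ocube 0 (r - e) : set V) by apply: lebesgue_set_open; exact: open_ocube.
have := lebesgue_split ((A i `\` ocube 0 a) `&` ocube 0 r) mq.
rewrite -setIA (setIidr (@ocubeS _ _ _ _ _ _)); last by rewrite lerBlDr lerDl ltW.
rewrite !cube_volumeE => h.
have fin : leb (((A i `\` ocube 0 a) `&` ocube 0 r) `\` ocube 0 (r - e)) \is a fin_num.
  rewrite ge0_fin_numE ?lebesgue_Rd_ge0//.
  apply: le_lt_trans (lebesgue_ocube_lty 0 r); apply: le_lebesgue_Rd => x [[]] //.
move: h; rewrite -(fineK fin) -EFinD => -[h]; rewrite lee_fin; apply: le_trans ge.
rewrite -(lerD2l (cube_volume (A i `\` ocube 0 a) 0 (r - e))) -h /g.
rewrite (bigD1 i)//= [X in _ <= _ + (_ - X)](bigD1 i)//=.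
apply: sum_diff_le; apply: ler_sum => k _; apply: cube_volume_le.
by rewrite lerBlDr lerDl ltW.
Qed.

End radius.

Lemma norm_triangle_le (R : realDomainType) (x y a b r : R) :
  `|y - x| <= r -> `|x| <= a -> a + r <= b -> `|y| <= b.
Proof.
move=> yx xa arb; apply: le_trans arb; rewrite -[y](subrK x) addrC.
by apply: le_trans (ler_normD _ _) _; exact: lerD.
Qed.

Lemma ereal_cancel_le (R : realDomainType) (x g q f : \bar R) (c1 c2 : R) :
  x \is a fin_num -> (x <= g + c2%:E)%E -> (g + q <= f + x + c1%:E)%E ->
  (q <= f + (c1 + c2)%:E)%E.
Proof.
move=> xfin xg gq.
have h : (x + q <= x + (f + (c1 + c2)%:E))%E.
  apply: le_trans (leeD2r q xg) _.
  rewrite addeAC; apply: le_trans (leeD2r c2%:E gq) _.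
  by rewrite -[X in (X <= _)%E]addeA -EFinD [(f + x)%E]addeC addeA.
by rewrite -(leeD2lE _ _ xfin).
Qed.

(** * Comparison and limit *)

Section comparison.
Context {R : realType} {d N : nat}.
Local Notation V := 'rV[R]_d.
Local Notation leb := (@lebesgue_Rd R d).
Local Notation fl := (@flux R d unit_ball).
Local Notation parts := ('I_N -> set V).

Lemma partition_null (F : parts) : is_partition setT F ->
  (forall i, leb (F i) = 0%E) -> leb (setT : set V) = 0%E.
Proof.
move=> [mF dF cF] F0; have : leb (\big[setU/set0]_(i < N) F i) = 0%E.
  apply/eqP; rewrite eq_le lebesgue_Rd_ge0 andbT.
  by apply: le_trans (lebesgue_bigsetU _) _; rewrite big1.
move=> U0; apply: lebesgue_eq0_sub (lebesgue_eq0_setU cF U0) => x _.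
have [[i _ Fx]|nF] := pselect ((\bigcup_(k in [set: 'I_N]) F k) x); last by left.
by right; rewrite (bigD1 i)//=; left.
Qed.

(* When every region outside J is negligible, the constraints for J imply the
   constraints for all the regions. *)
Lemma hub_region (J : {set 'I_N}) B (E F : parts) : is_partition setT E ->
  is_partition setT F -> lebesgue_set B -> (leb B < +oo)%E ->
  (forall j, j \in J -> leb (F j `&` B) = leb (E j `&` B)) ->
  leb (setT : set V) <> 0%E ->
  exists (J' : {set 'I_N}) h, [/\ J \subset J', leb (F h) <> 0%E,
    h \in J' -> forall j, j \in J' &
    forall j, j \in J' -> leb (F j `&` B) = leb (E j `&` B)].
Proof.
move=> pE pF mB Boo vol T0.
have [[h hJ Fh]|nhub] := pselect (exists2 h, h \notin J & leb (F h) <> 0%E).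
  by exists J, h; split => // hJ'; rewrite hJ' in hJ.
have F0 j : j \notin J -> leb (F j) = 0%E.
  by move=> jJ; apply: contrapT => Fj; apply: nhub; exists j.
have [h Fh] : exists h, leb (F h) <> 0%E.
  apply: contrapT => nF; apply: T0; apply: partition_null pF _ => i.
  by apply: contrapT => Fi; apply: nF; exists i.
exists [set: 'I_N]%SET, h; split => //.
move=> j _; have [jJ|jJ] := boolP (j \in J); first exact: vol.
have FB : leb (F j `&` B) = 0%E.
  by apply: lebesgue_eq0_sub (F0 j jJ); exact: subIsetl.
rewrite FB volumeE//; congr EFin.
have vF k : k \notin J -> volume B (F k) = 0.
  move=> kJ; apply: EFin_inj; rewrite -volumeE//.
  by apply: lebesgue_eq0_sub (F0 k kJ); exact: subIsetl.
have := partition_volume pE mB Boo (@subsetT _ _).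
rewrite -(partition_volume pF mB Boo (@subsetT _ _)).
rewrite (bigID (fun k => k \in J))/= [RHS](bigID (fun k => k \in J))/=.
rewrite [X in _ = _ + X]big1 ?addr0//.
have -> : \sum_(k | k \in J) volume B (F k) = \sum_(k | k \in J) volume B (E k).
  by apply: eq_bigr => k kJ; congr fine; exact: vol.
move=> /eqP; rewrite -subr_eq0 addrAC subrr add0r => /eqP s0.
by rewrite (psumr_eq0P _ s0)// => k _; exact: volume_ge0.
Qed.

Lemma min_pos_finite n (P : pred 'I_n) (f : 'I_n -> R) : (forall i, P i -> 0 < f i) ->
  exists2 w, 0 < w & forall i, P i -> w <= f i.
Proof.
move=> f0; have : \forall w \near 0^'+, 0 < w /\ forall i, P i -> w <= f i.
  apply: filterI; first exact: nbhs_right_gt.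
  apply: (filter_forall _ (_ : forall i, \forall w \near 0^'+, P i -> w <= f i)) => i.
  have [Pi|nPi] := boolP (P i); last by near=> w.
  have := nbhs_right_le (f0 i Pi); apply: filterS => w wf _; exact: wf.
by move=> /filter_ex[w [w0 wf]]; exists w.
Unshelve. all: by end_near. Qed.

Lemma symdiff_trans (A B C : set V) x :
  (A `+` B) x -> ~ (B `+` C) x -> (A `+` C) x.
Proof.
move=> AB nBC; have [Ax|nAx] := pselect (A x); have [Cx|nCx] := pselect (C x).
- by exfalso; case: AB => -[_ nB]//; apply: nBC; right.
- by left.
- by right.
- by exfalso; case: AB => -[]// Bx _; apply: nBC; left.
Qed.

(** The competitor of [Ek] is F inside the cube of radius r, [Ek] outside, then corrected by
    [adjust_volumes]. For j in J', F j and E j have the same volume in this cube, so the corrections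
    are controlled by the distance of [Ek] to E. The number 2 w leaves at least w in h after all the
    corrections. *)
Lemma tflux_comparison_step (J J' : {set 'I_N}) (Om B : set V) (E F Ek : parts)
    h a b rho w sigma lambda :
  is_partition setT E -> is_partition setT F ->
  (forall i, locally_finite_perimeter setT (F i)) -> lebesgue_set B ->
  B `<=` ocube 0 a -> 0 <= a -> a < b ->
  (forall i, leb ((F i `+` E i) `\` B) = 0%E) ->
  J \subset J' -> (h \in J' -> forall j, j \in J') -> leb (F h) <> 0%E ->
  (forall j, j \in J' -> leb (F j `&` B) = leb (E j `&` B)) ->
  (forall i, leb (F i) <> 0%E -> 2 * w <= volume (ocube 0 a) (F i)) ->
  0 <= rho -> a + rho <= b -> 0 <= w ->
  (forall (A : set V) s, w <= volume (ocube 0 a) A -> 0 <= s <= sigma ->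
    exists x t, [/\ 0 <= t <= rho, ccube 0 a x & volume (ocube x t) A = s]) ->
  open Om -> locally_isoperimetric J Om Ek -> ccube 0 (b + 1) `<=` Om ->
  \sum_i volume (ccube 0 b) (Ek i `+` E i) < lambda * (b - a) ->
  \sum_i volume (ccube 0 b) (Ek i `+` E i) <= w ->
  \sum_i volume (ccube 0 b) (Ek i `+` E i) <= sigma ->
  (tflux Ek (ocube 0 a) <= tflux F (ocube 0 b) +
    (N%:R * (@splice_const R d * lambda) + N%:R * (N%:R * @cube_cost R d rho))%:E)%E.
Proof.
move=> pE pF fF mB Ba a0 ab FE JJ' hJ' Fh vol wF rho0 arho w0 supply oO isoEk cO
  small_l small_w small_s.
pose K : set V := ccube 0 b; pose U : set V := ocube 0 (b + 1).
have KU : K `<=` U by apply: ccube_ocube; rewrite ltrDl.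
have UO : U `<=` Om by apply: subset_trans cO; exact: ocube_ccube.
have KO := subset_trans KU UO.
have Koo : (leb K < +oo)%E by exact: lebesgue_ccube_lty.
have mK : lebesgue_set K by apply: lebesgue_set_closed; exact: closed_ccube.
have [pEk fEk _] := isoEk; have [mEk _ _] := pEk.
have [mE _ _] := pE; have [mF _ _] := pF.
have [|r /andP[ar rb] hr] := @good_radius R d N (fun i => F i `+` Ek i) a b lambda a0 ab.
  (* Off [ocube 0 a], which contains B, the sets F i and E i agree up to a null set, so the mismatch
     of F and [Ek] there is controlled by that of [Ek] and E. *)
  apply: le_lt_trans small_l; apply: ler_sum => i _.
  apply: le_trans (volume_mono _ Koo (@ocube_ccube _ _ _ _)) _.
  apply: volume_le => //; apply: lebesgue_eq0_sub (FE i) => x [[[FEk nxa] nEkE] Kx].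
  by split; [exact: symdiff_trans FEk nEkE|move=> /Ba].
pose Q : set V := ocube 0 r.
have QK : Q `<=` K by apply: subset_trans (@ocube_ccube _ _ _ _) _; exact: ccubeS.
have aQ : ocube 0 a `<=` Q by apply: ocubeS; exact: ltW.
have mQ : lebesgue_set Q by apply: lebesgue_set_open; exact: open_ocube.
have Qoo : (leb Q < +oo)%E by exact: lebesgue_ocube_lty.
have r0 : 0 <= r by apply: le_trans a0 _; exact: ltW.
pose G0 : parts := fun i => splice Q (F i) (Ek i).
have pG0 : is_partition Om G0.
  by apply: is_partition_splice => //; exact: is_partition_sub (@subsetT _ _) pF.
have fG0 i : locally_finite_perimeter Om (G0 i).
  apply: lfp_splice => //; last by apply: subset_trans KO; exact: ccubeS.
  apply: (lfp_flux_fin openT (mF i) (fF i)); first exact: open_ocube.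
    exact: compact_closure_ocube.
  exact: subsetT.
have flux0 : (tflux G0 U + tflux Ek Q <=
    tflux F Q + tflux Ek U + (N%:R * (@splice_const R d * lambda))%:E)%E.
  apply: (@tflux_splice _ _ _ _ _ _ _ _ _ (r - a)) => //.
    exact: subset_trans KU.
  by rewrite subr_gt0.
pose delta j := volume Q (Ek j) - volume Q (F j).
have volQ j : j \in J' -> volume Q (F j) = volume Q (E j).
  move=> jJ'; have BQ : B `<=` Q by exact: subset_trans aQ.
  rewrite (volume_split (F j) Qoo mB BQ) (volume_split (E j) Qoo mB BQ).
  congr (_ + _); first by congr fine; exact: vol.
  apply/eqP; rewrite eq_le !volume_le//; apply: lebesgue_eq0_sub (FE j).
    by move=> x [[[Ex nB] nF] Qx]; split => //; right; split => // Fx; exact: nF.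
  by move=> x [[[Fx nB] nE] Qx]; split => //; left; split => // Ex; exact: nE.
have delta_le j : j \in J' -> `|delta j| <= volume K (Ek j `+` E j).
  move=> jJ'; rewrite /delta volQ//; apply: le_trans (volume_dist _ _ Qoo) _.
  exact: volume_mono.
have vol0 k : 0 <= volume K (Ek k `+` E k) by exact: volume_ge0.
have le_sum j : volume K (Ek j `+` E j) <= \sum_i volume K (Ek i `+` E i).
  by rewrite (bigD1 j)//= lerDl sumr_ge0.
have volG0 j : volume (ocube 0 a) (G0 j) = volume (ocube 0 a) (F j).
  congr (fine (leb _)); apply/seteqP; split => x [hx ax]; split => //.
    by case: hx => [[]//|[_ nQ]]; have := aQ _ ax.
  by left; split => //; exact: aQ.
(* The region h is left out: when it is constrained, J' contains all the regions and its volume is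
   fixed by those of the others. *)
pose l := [seq j <- enum 'I_N | (j \in J') && (j != h)].
have lP j : (j \in l) = (j \in J') && (j != h).
  by rewrite mem_filter mem_enum andbT.
have size_l : (size l <= N)%N.
  by rewrite size_filter (leq_trans (count_size _ _))// size_enum_ord.
have [||||||G [pG fG GK fluxG volG]] :=
    @adjust_volumes R d N Om K U a rho w sigma h l delta G0 oO Koo KU KO _ supply pG0 fG0.
- move=> x ax y xy i; have := xy i; have := ax i; rewrite mxE !subr0 => h1 h2.
  exact: norm_triangle_le h2 h1 arho.
- by rewrite filter_uniq// enum_uniq.
- by rewrite lP eqxx andbF.
- move=> j; rewrite lP => /andP[jJ' _]; apply: le_trans (delta_le j jJ') _.
  exact: le_trans (le_sum j) small_s.
- move=> j; rewrite lP => /andP[jJ' _] dj; rewrite volG0.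
  apply: (@le_trans _ _ (2 * w)); first by rewrite mulr2n mulrDl mul1r lerDl.
  (* A region that must lose volume is not negligible: |F j| = 0 would make delta j nonnegative. *)
  apply: wF => Fj0; move: dj; rewrite /delta ltNge => /negP; apply.
  have -> : volume Q (F j) = 0.
    apply: EFin_inj; rewrite -volumeE//; apply: lebesgue_eq0_sub Fj0.
    exact: subIsetl.
  by rewrite subr0 volume_ge0.
- rewrite volG0; apply: le_trans (wF h Fh); rewrite mulr2n mulrDl mul1r lerD2l.
  apply: le_trans small_w; rewrite big_filter big_enum_cond/=.
  rewrite [leRHS](bigID (fun j => (j \in J') && (j != h)))/=.
  rewrite ler_wpDr ?sumr_ge0//; apply: ler_sum => j /andP[jJ' _].
  exact: delta_le.
have volG' j : j \in l -> volume K (G j) = volume K (Ek j).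
  move=> jl; have jh : j != h by move: jl; rewrite lP => /andP[].
  rewrite volG// jl volume_splice// /delta; ring.
have EkG : (tflux Ek U <= tflux G U)%E.
  apply: (isoperimetric_tflux oO isoEk (@compact_ccube _ _ 0 b) _ KU UO pG fG).
  - exact: open_ocube.
  - move=> i; rewrite (_ : _ `\` _ = set0) ?lebesgue_Rd0// -subset0 => x [hx nKx].
    have GEk : (G i `\` K) = Ek i `\` K.
      rewrite GK; apply/seteqP; split => y [hy nKy]; split => //.
        by case: hy => [[_ /QK]|[]].
      by right; split => // /QK.
    case: hx => -[h1 h2]; apply: h2.
      by have [] : (Ek i `\` K) x by rewrite -GEk.
    by have [] : (G i `\` K) x by rewrite GEk.
  - move=> j jJ; rewrite !volumeE//; congr EFin.
    have jJ' : j \in J' by exact: (fintype.subsetP JJ').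
    have [jh|jh] := eqVneq j h; last by apply: volG'; rewrite lP jJ'.
    (* The case j = h: both partitions have the same total volume in K, and all the other regions
       already have the right one. *)
    have := partition_volume pG mK Koo KO; rewrite -(partition_volume pEk mK Koo KO).
    rewrite jh in jJ' *.
    rewrite (bigD1 h)//= [RHS](bigD1 h)//=.
    rewrite (eq_bigr (fun i => volume K (Ek i))); first by move/addIr.
    by move=> i ih; apply: volG'; rewrite lP (hJ' jJ') ih.
have Ufin : tflux Ek U \is a fin_num.
  apply: (tflux_fin oO mEk fEk); first exact: open_ocube.
    exact: compact_closure_ocube.
  by apply: subset_trans cO; exact: closure_ocube.
apply: (@le_trans _ _ (tflux Ek Q)); first exact: tflux_mono.
apply: (@le_trans _ _ (tflux F Q +
    (N%:R * (@splice_const R d * lambda) + N%:R * (N%:R * @cube_cost R d rho))%:E)%E);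
  last by apply: leeD2r; apply: tflux_mono; exact: ocubeS.
have EkG0 : (tflux Ek U <= tflux G0 U + (N%:R * (N%:R * @cube_cost R d rho))%:E)%E.
  apply: le_trans EkG _; apply: le_trans fluxG _; apply: leeD2l.
  rewrite lee_fin ler_wpM2r ?ler_nat// mulr_ge0//; exact: cube_cost_ge0.
exact: ereal_cancel_le Ufin EkG0 flux0.
Qed.

Lemma mul_div_le (c x : R) : 0 <= c -> 0 < x -> c * (x / (c + 1)) <= x.
Proof.
move=> c0 x0; have c1 : 0 < c + 1 by rewrite ltr_wpDl.
rewrite mulrA ler_pdivrMr// mulrC ler_pM2l//.
by rewrite lerDl.
Qed.

(** Order of the choices: w depends on F; rho and lambda on delta, so that each of the two costs is
    at most delta / 2; sigma on w and rho; eps on all of these, before [Ek] is given. *)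
Lemma tflux_comparison (J : {set 'I_N}) (B : set V) (E F : parts) a b delta :
  (2 <= d)%N -> is_partition setT E -> is_partition setT F ->
  (forall i, locally_finite_perimeter setT (F i)) -> compact B ->
  B `<=` ocube 0 a -> 0 <= a -> a < b ->
  (forall i, leb ((F i `+` E i) `\` B) = 0%E) ->
  (forall j, j \in J -> leb (F j `&` B) = leb (E j `&` B)) ->
  leb (setT : set V) <> 0%E -> 0 < delta ->
  (forall i, leb (F i) <> 0%E -> 0 < volume (ocube 0 a) (F i)) ->
  exists2 eps, 0 < eps & forall Om Ek, open Om ->
    locally_isoperimetric J Om Ek -> ccube 0 (b + 1) `<=` Om ->
    \sum_i volume (ccube 0 b) (Ek i `+` E i) < eps ->
    (tflux Ek (ocube 0 a) <= tflux F (ocube 0 b) + delta%:E)%E.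
Proof.
move=> d2 pE pF fF cB Ba a0 ab FE vol T0 delta0 Fpos.
have mB : lebesgue_set B by apply: lebesgue_set_closed; exact: compact_is_closed.
have Boo := lebesgue_compact_lty cB.
have [J' [h [JJ' Fh hJ' vol']]] := hub_region pE pF mB Boo vol T0.
have [v v0 vF] := @min_pos_finite N (fun i => `[< leb (F i) <> 0%E >])
  (fun i => volume (ocube 0 a) (F i)) (fun i Pi => Fpos i (asboolW Pi)).
(* One half of the volume remains available for the cubes, the other half absorbs the
   corrections. *)
pose w := v / 2.
have w0 : 0 < w by rewrite divr_gt0.
have delta2 : 0 < delta / 2 by rewrite divr_gt0.
pose NN : R := N%:R * N%:R.
have NN0 : 0 <= NN by rewrite mulr_ge0.
have [rho0 rho0_gt0 cost0] : exists2 r, 0 < r & @cube_cost R d r <= delta / 2 / (NN + 1).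
  by apply: cube_cost_small => //; rewrite divr_gt0// ltr_wpDl.
(* The bound b - a keeps the small cubes, centred in the cube of radius a, inside the cube of radius
   b. *)
pose rho := Num.min rho0 (b - a).
have rho_gt0 : 0 < rho by rewrite lt_min rho0_gt0 subr_gt0.
have cost : @cube_cost R d rho <= delta / 2 / (NN + 1).
  by apply: le_trans cost0; apply: cube_cost_le; [exact: ltW|rewrite ge_min lexx].
have arho : a + rho <= b by rewrite -lerBrDl ge_min lexx orbT.
pose kN : R := N%:R * @splice_const R d.
have kN0 : 0 <= kN by rewrite mulr_ge0// ltW// splice_const_gt0.
pose lambda := delta / 2 / (kN + 1).
have lambda0 : 0 < lambda by rewrite divr_gt0// ltr_wpDl.
have d0 : (0 < d)%N by exact: leq_trans d2.
have [sigma sigma0 supply] := @cube_supply R d a w rho d0 w0 rho_gt0.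
exists (Num.min (lambda * (b - a)) (Num.min w sigma)).
  by rewrite !lt_min w0 sigma0 !andbT mulr_gt0// subr_gt0.
move=> Om Ek oO isoEk cO; rewrite !lt_min => /and3P[small_l small_w small_s].
have wF i : leb (F i) <> 0%E -> 2 * w <= volume (ocube 0 a) (F i).
  by move=> Fi; rewrite /w mulrC divfK//; apply: vF; exact/asboolP.
have := tflux_comparison_step pE pF fF mB Ba a0 ab FE JJ' hJ' Fh vol' wF (ltW rho_gt0)
  arho (ltW w0) supply oO isoEk cO small_l (ltW small_w) (ltW small_s).
move=> /le_trans; apply; apply: leeD2l; rewrite lee_fin [leRHS]splitr.
apply: lerD; rewrite mulrA; first exact: mul_div_le.
apply: le_trans (mul_div_le NN0 delta2).
exact: ler_wpM2l.
Qed.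

End comparison.

Section limit.
Context {R : realType} {d : nat}.
Local Notation V := 'rV[R]_d.
Local Notation leb := (@lebesgue_Rd R d).

Lemma compact_exhaustion (Om : nat -> set V) (K : set V) :
  (forall k, open (Om k)) -> (forall k l, (k <= l)%N -> Om k `<=` Om l) ->
  \bigcup_k Om k = setT -> compact K -> \forall k \near \oo, K `<=` Om k.
Proof.
move=> oO incO covO; rewrite compact_cover => /(_ nat setT Om).
move=> [k _|x _|D _ KD]; first exact: oO.
  by rewrite /cover covO.
exists (\max_(i <- finmap.enum_fset D) i)%N => // k /= Dk x /KD[i /= iD Oi].
apply: incO Oi; apply: leq_trans Dk.
exact: leq_bigmax_seq.
Qed.

Lemma volume_gt0_near (A : set V) : leb A <> 0%E ->
  \forall n \near \oo, 0 < volume (ocube 0 n%:R) A.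
Proof.
move=> A0; have [n An] : exists n, leb (A `&` ocube 0 n%:R) <> 0%E.
  apply: contrapT => nA; apply: A0; apply/eqP; rewrite eq_le lebesgue_Rd_ge0 andbT.
  have An n : leb (A `&` ocube 0 n%:R) = 0%E.
    by apply: contrapT => An; apply: nA; exists n.
  have AU : A `<=` \bigcup_n (A `&` ocube 0 n%:R).
    move=> x Ax; exists (Num.truncn `|x|).+1 => //; split => // i.
    rewrite mxE subr0; apply: le_lt_trans (coord_le_norm x i) _.
    exact: truncnS_gt.
  apply: le_trans (le_lebesgue_Rd AU) _.
  apply: le_trans (lebesgue_Rd_sigma_subadditive _) _.
  by rewrite eseries0// => m _ _; exact: An.
exists n => // m /= nm; rewrite lt_neqAle volume_ge0 andbT eq_sym.
have moo := @lebesgue_ocube_lty R d 0 m%:R.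
apply/eqP => v0; apply: An; apply/eqP; rewrite eq_le lebesgue_Rd_ge0 andbT.
have nm' : ocube 0 n%:R `<=` (ocube 0 m%:R : set V) by apply: ocubeS; rewrite ler_nat.
have Am : leb (A `&` ocube 0 m%:R) = 0%E by rewrite volumeE// v0.
by rewrite -[leRHS]Am; apply: le_lebesgue_Rd; exact: setIS.
Qed.

End limit.

Theorem theorem2p13 (R : realType) (d N : nat) (J : {set 'I_N})
  (Omega : nat -> set 'rV[R]_d)
  (Ek : nat -> 'I_N -> set 'rV[R]_d)
  (E : 'I_N -> set 'rV[R]_d) :
  (2 <= d)%N -> (1 <= N)%N ->
  (forall k, open (Omega k)) ->
  (forall k l, (k <= l)%N -> Omega k `<=` Omega l) ->
  \bigcup_k Omega k = setT ->
  (forall k, locally_isoperimetric J (Omega k) (Ek k)) ->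
  is_partition setT E ->
  (forall j (K : set 'rV[R]_d), compact K ->
     lebesgue_Rd ((Ek k j `+` E j) `&` K) @[k --> \oo] --> 0%E) ->
  locally_isoperimetric J setT E.
Proof.
move=> d2 _ oO incO covO isoE pE cvE.
have d0 : (0 < d)%N by exact: leq_trans d2.
have [mE _ _] := pE.
have mEk k i : lebesgue_set (Ek k i) by have [[mEk _ _] _ _] := isoE k.
have near_in r : \forall k \near \oo, ccube 0 r `<=` Omega k.
  by apply: compact_exhaustion oO incO covO _; exact: compact_ccube.
have fE i : locally_finite_perimeter setT (E i).
  apply: flux_locally_finite_perimeter => //; first exact: openT.
  move=> W oW cW _; have [r r0 Wr] := compact_sub_ccube cW.
  pose b := r + 1; have b0 : 0 <= b by rewrite addr_ge0// ltW.
  pose A : \bar R := (N%:R * (2 * @cube_cost R d b) + N%:R * @cube_cost R d b)%:E.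
  have EA : (tflux E (ocube 0 b) <= A)%E.
    apply: (tflux_lsc mE mEk cvE) => a delta ab delta0.
    apply: filterS (near_in (b + 1)) => k bk.
    apply: le_trans (tflux_mono _ (ocubeS (ltW ab))) _.
    have bb : b < b + 1 by rewrite ltrDl.
    apply: le_trans (isoperimetric_bound d0 b0 bb (oO k) (isoE k) bk) _.
    by rewrite leeDl// lee_fin ltW.
  have WQ : W `<=` ocube 0 b.
    apply: subset_trans (@subset_closure _ W) _; apply: subset_trans Wr _.
    by apply: ccube_ocube; rewrite ltrDl.
  apply: le_lt_trans (flux_mono _ _ WQ) _; apply: (@le_lt_trans _ _ A); last exact: ltry.
  apply: le_trans EA; rewrite /tflux (bigD1 i)//= leeDl// sume_ge0// => j _.
  exact: (flux_ge0 unit_ball_starshaped (mE j)).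
split => // B F cB _ pF fF FE vol; have [mF _ _] := pF.
have [r r0 Br] := compact_sub_ccube cB.
have [a [ra Fa]] : exists a : R, r < a /\
    forall i, lebesgue_Rd (F i) <> 0%E -> 0 < volume (ocube 0 a) (F i).
  have near_F i : \forall n \near \oo,
      lebesgue_Rd (F i) <> 0%E -> 0 < volume (ocube 0 n%:R) (F i).
    have [Fi|Fi] := pselect (lebesgue_Rd (F i) = 0%E); first by near=> n.
    by apply: filterS (volume_gt0_near Fi) => n.
  have [n [nr Fn]] := filter_ex (filterI (nbhs_infty_gtr r) (filter_forall _ near_F)).
  by exists n%:R.
have a0 : 0 <= a by rewrite ltW// (lt_trans r0).
have Ba : B `<=` ocube 0 a by apply: subset_trans Br _; exact: ccube_ocube.
pose b := a + 1.
have ab : a < b by rewrite ltrDl.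
have Bb : B `<=` ocube 0 b by apply: subset_trans Ba _; apply: ocubeS; exact: ltW.
apply: (tflux_isoperimetric (U := ocube 0 b) openT pE pF fE fF cB) => //.
- exact: open_ocube.
- exact: compact_closure_ocube.
(* If the whole space is null, then E and F have equal fluxes; otherwise some region of F is not
   negligible, as [hub_region] requires. *)
have [T0|T0] := pselect (lebesgue_Rd (setT : set 'rV[R]_d) = 0%E).
  rewrite (@tflux_ae _ _ _ E F)// => [|i]; last exact: lebesgue_eq0_sub T0.
  by apply: lebesgue_set_open; exact: open_ocube.
apply: (tflux_lsc mE mEk cvE) => a' delta a'b delta0.
(* Lower semicontinuity asks for every a' < b, however small, while the comparison is made on a cube
   that contains B and meets all the nonnegligible regions of F. *)
pose s := Num.max a a'.
have sb : s < b by rewrite gt_max ab.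
have as_ : a <= s by rewrite le_max lexx.
have [||eps eps0 heps] :=
  tflux_comparison d2 pE pF fF cB (subset_trans Ba (ocubeS as_)) _ sb FE vol T0 delta0.
- exact: le_trans as_.
- move=> i Fi; apply: lt_le_trans (Fa i Fi) _; apply: volume_mono (ocubeS as_).
  exact: lebesgue_ocube_lty.
have near_small i : \forall k \near \oo,
    volume (ccube 0 b) (Ek k i `+` E i) <= eps / 2 / N.+1%:R.
  have e0 : 0 < eps / 2 / N.+1%:R by rewrite !divr_gt0.
  have /fine_cvgP[_ /cvgrPdist_lt/(_ _ e0)] := cvE i _ (@compact_ccube _ _ 0 b).
  apply: filterS => k /=; rewrite sub0r normrN => h.
  by apply: le_trans (ltW h); exact: ler_norm.
apply: filterS2 (near_in (b + 1)) (filter_forall _ near_small) => k bk small.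
have a's : a' <= s by rewrite le_max lexx orbT.
apply: le_trans (tflux_mono _ (ocubeS a's)) _.
apply: heps (oO k) (isoE k) bk _.
apply: (@le_lt_trans _ _ (eps / 2)); last by rewrite ltr_pdivrMr// ltr_pMr// ltr1n.
apply: le_trans (sum_div_le N _); last by rewrite divr_ge0// ltW.
by apply: ler_sum => i _; exact: small.
Unshelve. all: by end_near. Qed.
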